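(* Let $a,b\in\mathbb Q$ with $a\neq 0$ and $d:=d(a,b)\neq 0$, and assume the curves $E_{a,b}$, $E^\ast_{a,b}$ below are nonsingular. Then: (1) For every rational point $P\in E_{a,b}(\mathbb Q)$ other than the point at infinity, the polynomial $\mathrm{Bru}(P;X)$ is reducible over $\mathbb Q$ if and only if $P\in\phi^\ast(E^\ast_{a,b}(\mathbb Q))$. (2) The quotient $E_{a,b}(\mathbb Q)/\phi^\ast(E^\ast_{a,b}(\mathbb Q))$ is finite, and the correspondence $P\mapsto \mathrm{Bru}(P;X)$ induces a bijection between the set of subgroups of order $5$ of $E_{a,b}(\mathbb Q)/\phi^\ast(E^\ast_{a,b}(\mathbb Q))$ and the set $\{\mathrm{Spl}_{\mathbb Q}(\mathrm{Bru}(P;X)) : P\in E_{a,b}(\mathbb Q)\setminus \phi^\ast(E^\ast_{a,b}(\mathbb Q))\}$ of splitting fields over $\mathbb Q$. (Concretely, a subgroup $\langle \bar P\rangle$ of order 5 is sent to $\mathrm{Spl}_{\mathbb Q}(\mathrm{Bru}(P;X))$, which depends only on the subgroup.)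
   Context: Brumer's quintic: $\mathrm{Bru}(a,b;X):=X^5+(a-3)X^4-(a-b-3)X^3+(a^2-a-2b-1)X^2+bX+a$. Put $d(a,b):=-4b^3+(a^2-30a+1)b^2+2a(3a+1)(4a-7)b-a(4a^4-4a^3-40a^2+91a-4)$, $d:=d(a,b)$, and $k:=\mathbb Q(\sqrt d)$. $\mathrm{Spl}_{\mathbb Q}(g)$ denotes the splitting field of $g$ over $\mathbb Q$. Curves over $\mathbb Q$: $E_{a,b}: y^2=x^3+d(a^2-30a+1)x^2-8d^2a(3a+1)(4a-7)x-16d^3a(4a^4-4a^3-40a^2+91a-4)$; $E^\ast_{a,b}: y^2=x^3+(a^2-30a+1)dx^2-8(26a^4-310a^3+327a^2+315a+26)d^2x+16(68a^6-1120a^5+3804a^4+1760a^3+6929a^2+1380a+68)d^3$; $E^\ast_a: y^2-(a-1)xy-ay=x^3-ax^2$ (on which $(0,0)$ is a rational point of order 5); $E_a: y^2-(a-1)xy-ay=x^3-ax^2-5a(a^2+2a-1)x-a(a^4+10a^3-5a^2+15a-1)$. $\lambda^\ast:E^\ast_a\to E_a$ is the degree-5 isogeny over $\mathbb Q$ with kernel $\langle(0,0)\rangle$; on $x$-coordinates it is $x\mapsto N(x)/D(x)$ with $N(x)=x^5-2ax^4+a(a^2+3a-1)x^3-3a^2(a-1)x^2+a^3(a-3)x+a^4$, $D(x)=x^2(x-a)^2$. Isomorphisms defined over $k$: $f:E_{a,b}\to E_a$, $(x,y)\mapsto\big(\tfrac{x}{4d}-2a,\ \tfrac{a-1}{8d}x+\tfrac{1}{8d\sqrt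 d}y-\tfrac{a(2a-3)}{2}\big)$, and $f^\ast:E^\ast_{a,b}\to E^\ast_a$, $(x,y)\mapsto\big(\tfrac{x}{100d}-\tfrac{2(a^2-5a+1)}{25},\ \tfrac{a-1}{200d}x+\tfrac{1}{1000d\sqrt d}y-\tfrac{2a^3-12a^2-13a-2}{50}\big)$. $\phi^\ast:E^\ast_{a,b}\to E_{a,b}$ is the degree-5 isogeny defined over $\mathbb Q$ satisfying $f\circ\phi^\ast=\lambda^\ast\circ f^\ast$ (it is the dual of a degree-5 $\mathbb Q$-isogeny $\phi:E_{a,b}\to E^\ast_{a,b}$). For $P=(x(P),y(P))\in E_{a,b}(\mathbb Q)$, $\mathrm{Bru}(P;X):=\mathrm{Bru}\big(a,\tfrac{x(P)}{-4d};X\big)$. *)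

(* Defs.v *)
From HB Require Import structures.
From mathcomp Require Import all_boot all_order all_algebra all_field.
Set Implicit Arguments. Unset Strict Implicit. Unset Printing Implicit Defensive.
Import Order.TTheory GRing.Theory Num.Theory.
Local Open Scope ring_scope.

(* y^2 + a1 xy + a3 y = x^3 + a2 x^2 + a4 x + a6 *)
Record wcurve := WCurve { wa1 : rat; wa2 : rat; wa3 : rat; wa4 : rat; wa6 : rat }.

(* Projective points: None is the point at infinity O, Some (x,y) an affine point. *)
Definition point := option (rat * rat).

Definition on_curve (E : wcurve) (P : point) : Prop :=
  match P with
  | None => True
  | Some (x, y) =>
      y ^+ 2 + wa1 E * x * y + wa3 E * y =
      x ^+ 3 + wa2 E * x ^+ 2 + wa4 E * x + wa6 E
  end.

(* Discriminant (Silverman III.1). *)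
Definition wdisc (E : wcurve) : rat :=
  let b2 := wa1 E ^+ 2 + 4 * wa2 E in
  let b4 := 2 * wa4 E + wa1 E * wa3 E in
  let b6 := wa3 E ^+ 2 + 4 * wa6 E in
  let b8 := wa1 E ^+ 2 * wa6 E + 4 * wa2 E * wa6 E - wa1 E * wa3 E * wa4 E
            + wa2 E * wa3 E ^+ 2 - wa4 E ^+ 2 in
  - b2 ^+ 2 * b8 - 8 * b4 ^+ 3 - 27 * b6 ^+ 2 + 9 * b2 * b4 * b6.

Definition nonsingular (E : wcurve) : Prop := wdisc E != 0.

Definition wneg (E : wcurve) (P : point) : point :=
  match P with
  | None => None
  | Some (x, y) => Some (x, - y - wa1 E * x - wa3 E)
  end.

(* Chord-and-tangent addition (Silverman III.2.3). *)
Definition wadd (E : wcurve) (P Q : point) : point :=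
  match P, Q with
  | None, _ => Q
  | _, None => P
  | Some (x1, y1), Some (x2, y2) =>
      if (x1 == x2) && (y1 + y2 + wa1 E * x2 + wa3 E == 0) then None
      else
        let lam := if x1 == x2
                   then (3 * x1 ^+ 2 + 2 * wa2 E * x1 + wa4 E - wa1 E * y1)
                        / (2 * y1 + wa1 E * x1 + wa3 E)
                   else (y2 - y1) / (x2 - x1) in
        let nu := if x1 == x2
                  then (- x1 ^+ 3 + wa4 E * x1 + 2 * wa6 E - wa3 E * y1)
                       / (2 * y1 + wa1 E * x1 + wa3 E)
                  else (y1 * x2 - y2 * x1) / (x2 - x1) in
        let x3 := lam ^+ 2 + wa1 E * lam - wa2 E - x1 - x2 in
        Some (x3, - (lam + wa1 E) * x3 - nu - wa3 E)
  end.

Definition wsub (E : wcurve) (P Q : point) : point := wadd E P (wneg E Q).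

Fixpoint wmul (E : wcurve) (n : nat) (P : point) : point :=
  match n with
  | 0%N => None
  | n'.+1 => wadd E P (wmul E n' P)
  end.

Definition dab (a b : rat) : rat :=
  - 4 * b ^+ 3 + (a ^+ 2 - 30 * a + 1) * b ^+ 2 + 2 * a * (3 * a + 1) * (4 * a - 7) * b
  - a * (4 * a ^+ 4 - 4 * a ^+ 3 - 40 * a ^+ 2 + 91 * a - 4).

Definition Bru (a b : rat) : {poly rat} :=
  'X^5 + (a - 3)%:P * 'X^4 - (a - b - 3)%:P * 'X^3
  + (a ^+ 2 - a - 2 * b - 1)%:P * 'X^2 + b%:P * 'X + a%:P.

Definition Eab (a b : rat) : wcurve :=
  let d := dab a b in
  WCurve 0 (d * (a ^+ 2 - 30 * a + 1)) 0
    (- 8 * d ^+ 2 * a * (3 * a + 1) * (4 * a - 7))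
    (- 16 * d ^+ 3 * a * (4 * a ^+ 4 - 4 * a ^+ 3 - 40 * a ^+ 2 + 91 * a - 4)).

Definition Estab (a b : rat) : wcurve :=
  let d := dab a b in
  WCurve 0 ((a ^+ 2 - 30 * a + 1) * d) 0
    (- 8 * (26 * a ^+ 4 - 310 * a ^+ 3 + 327 * a ^+ 2 + 315 * a + 26) * d ^+ 2)
    (16 * (68 * a ^+ 6 - 1120 * a ^+ 5 + 3804 * a ^+ 4 + 1760 * a ^+ 3
           + 6929 * a ^+ 2 + 1380 * a + 68) * d ^+ 3).

(* x-coordinate map of lambda^* : E^*_a -> E_a is N/D. *)
Definition Nlam (a : rat) : {poly rat} :=
  'X^5 - (2 * a)%:P * 'X^4 + (a * (a ^+ 2 + 3 * a - 1))%:P * 'X^3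
  - (3 * a ^+ 2 * (a - 1))%:P * 'X^2 + (a ^+ 3 * (a - 3))%:P * 'X + (a ^+ 4)%:P.

Definition Dlam (a : rat) : {poly rat} := 'X^2 * ('X - a%:P) ^+ 2.

(* phi^* : E^*_{a,b} -> E_{a,b}, phi^* = f^{-1} o lambda^* o f^*, computed over Q.  With x' = x/(100d) - 2(a^2-5a+1)/25 (the x-coordinate of f^*(P)),
   X(t) = N(t)/D(t), one gets
     phi^*(x,y) = ( 4d (X(x') + 2a),  y X'(x') / 125 ),
   and phi^*(P) = O when P = O or f^*(P) is in ker lambda^* (i.e. D(x') = 0). *)
Definition phistar (a b : rat) (P : point) : point :=
  let d := dab a b in
  match P with
  | None => None
  | Some (x, y) =>
      let x' := x / (100 * d) - 2 * (a ^+ 2 - 5 * a + 1) / 25 in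
      let Dx := (Dlam a).[x'] in
      if Dx == 0 then None
      else
        let X := (Nlam a).[x'] / Dx in
        let X' := ((Nlam a)^`().[x'] * Dx - (Nlam a).[x'] * (Dlam a)^`().[x']) / Dx ^+ 2 in
        Some (4 * d * (X + 2 * a), y * X' / 125)
  end.

Definition in_image (a b : rat) (P : point) : Prop :=
  exists Q : point, on_curve (Estab a b) Q /\ phistar a b Q = P.

Definition BruP (a b : rat) (P : point) : {poly rat} :=
  match P with
  | None => 0 (* not used: P is always affine *)
  | Some (x, _) => Bru a (x / (- 4 * dab a b))
  end.

Definition congH (a b : rat) (P Q : point) : Prop :=
  in_image a b (wsub (Eab a b) P Q).

(* Subgroups of the quotient E(Q)/H correspond to subgroups S of E(Q) containing H
   (correspondence theorem); S is given as a predicate on points. *)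
Definition is_subgroup_over_H (a b : rat) (S : point -> Prop) : Prop :=
  (forall P, S P -> on_curve (Eab a b) P) /\
  (forall P, on_curve (Eab a b) P -> in_image a b P -> S P) /\
  (forall P Q, S P -> S Q -> S (wsub (Eab a b) P Q)).

Definition quot_order5 (a b : rat) (S : point -> Prop) : Prop :=
  exists s : seq point,
    size s = 5%N /\ (forall P, P \in s -> S P) /\
    (forall i j, (i < 5)%N -> (j < 5)%N ->
        congH a b (nth None s i) (nth None s j) -> i = j) /\
    (forall P, S P -> exists2 Q, Q \in s & congH a b P Q).

Definition subgroup5 (a b : rat) (S : point -> Prop) : Prop :=
  is_subgroup_over_H a b S /\ quot_order5 a b S.

Definition generated_by (a b : rat) (S : point -> Prop) (P : point) : Prop :=
  forall Q, S Q <-> (on_curve (Eab a b) Q /\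
                      exists n : nat, congH a b Q (wmul (Eab a b) n P)).

Definition quotient_finite (a b : rat) : Prop :=
  exists s : seq point, (forall Q, Q \in s -> on_curve (Eab a b) Q) /\
    forall P, on_curve (Eab a b) P -> exists2 Q, Q \in s & congH a b P Q.

Inductive Spl (g : {poly rat}) : algC -> Prop :=
  | Spl_rat (q : rat) : Spl g (ratr q)
  | Spl_root (z : algC) : root (map_poly ratr g) z -> Spl g z
  | Spl_add (u v : algC) : Spl g u -> Spl g v -> Spl g (u + v)
  | Spl_opp (u : algC) : Spl g u -> Spl g (- u)
  | Spl_mul (u v : algC) : Spl g u -> Spl g v -> Spl g (u * v)
  | Spl_inv (u : algC) : Spl g u -> Spl g (u^-1).

Definition same_field (K L : algC -> Prop) : Prop := forall z, K z <-> L z.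

(* Main.v *)
(** Over Q(sqrt d) the curves E*_{a,b} and E_{a,b} become short models W* and W
    of E*_a and E_a, and their rational points are the points of W* and W fixed
    by the Galois action twisted by sqrt d.  The roots of Bru(P; X) are the
    numbers 4a / U(R), where R runs over the fibre of lambda* above P, a coset of
    <T> = Z/5.  On automorphisms fixing sqrt d, the cocycle nu |-> nu R - R is a
    homomorphism to Z/5.  It vanishes exactly when P comes from a rational point
    of E*_{a,b}; otherwise the roots are permuted transitively.  Points whose
    Bru polynomials have the same splitting field have cocycles with the same
    kernel, hence proportional, so they generate the same subgroup.

    Finiteness is a Kummer descent that avoids heights and class groups.  A
    function F on W with divisor 5 (T') - 5 (O), T' generating the kernel of the
    dual isogeny, satisfies F o lambda* = rho^5 up to a constant, with
    rho(R + T) = zeta rho(R).  Hence the class of F(P) modulo fifth powers of a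
    cyclic quartic field Q(om) determines P modulo the image.  If t is the
    denominator of P, a pigeonhole argument on a lattice of rank 4 produces gamma
    in Q(om) such that gamma^5 / (t^5 F(P)) has a denominator and conjugates
    bounded independently of P; this number takes finitely many values. *)

Require Import Defs.
From Stdlib Require Import Classical_Prop.
From HB Require Import structures.
From mathcomp Require Import all_boot all_order all_algebra all_field.
From mathcomp Require Import ring lra zify.
Set Implicit Arguments. Unset Strict Implicit. Unset Printing Implicit Defensive.
Import Order.TTheory GRing.Theory Num.Theory.
Local Open Scope ring_scope.

(** The kernel point T is rational on W*, so the twisted action multiplies it by the quadratic
    character of Q(sqrt d), and the roots of unity needed by the Kummer map have degree 4. Both
    obstructions have order prime to 5, which is why [descent] may test triviality of a cocycle only
    on automorphisms that fix sqrt d and a primitive fifth root of unity.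

    Finiteness by Kummer theory usually rests on class groups and units, which say that an element
    whose ideal is a fifth power has finitely many classes modulo fifth powers. Here the fifth root
    of the ideal is explicit. Let alpha be the integrally scaled value F(P) and x the scaled
    difference of the abscissae of P and T', of norm n from Q(sqrt 5). Then alpha times its
    conjugate under tau^2 is x^5, so alpha has norm n^5. A single linear congruence modulo n on the
    four coefficients of gamma puts t^5 gamma into the ideal (x, y) of T', whose fifth power is
    divisible by alpha up to a bounded factor. A box with sides proportional to the fifth roots of
    the conjugates of alpha has volume proportional to n, so it contains such a gamma; gamma^5 /
    alpha is then bounded at every place. *)

Local Notation aut := {rmorphism algC -> algC}.

(** * Chord-and-tangent groups over algC *)

(** A certificate format for identities that hold modulo hypotheses: the cofactors of the hypotheses
    are given explicitly, so that only a formal identity is left to [ring] or [field]. *)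
Lemma lincomb1 (R : comNzRingType) (x y c p q : R) :
  p = q -> x - y = c * (p - q) -> x = y.
Proof. by move=> -> /eqP; rewrite subrr mulr0 subr_eq0 => /eqP. Qed.

Lemma lincomb2 (R : comNzRingType) (x y c p q c' p' q' : R) :
  p = q -> p' = q' -> x - y = c * (p - q) + c' * (p' - q') -> x = y.
Proof. by move=> -> -> /eqP; rewrite !subrr !mulr0 addr0 subr_eq0 => /eqP. Qed.

Lemma lincomb3 (R : comNzRingType) (x y c p q c' p' q' c'' p'' q'' : R) :
  p = q -> p' = q' -> p'' = q'' ->
  x - y = c * (p - q) + c' * (p' - q') + c'' * (p'' - q'') -> x = y.
Proof. by move=> -> -> -> /eqP; rewrite !subrr !mulr0 !addr0 subr_eq0 => /eqP. Qed.

(* [l] is the slope of the line that meets the curve in the points 1 and 2,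
   counted with multiplicity: chords and tangents are treated uniformly. *)
Definition secant (A B x1 y1 x2 y2 l : algC) :=
  y1 - y2 = l * (x1 - x2) /\
  l * (y1 + y2) = x1 ^+ 2 + x1 * x2 + x2 ^+ 2 + A * (x1 + x2) + B.

Definition chord (A x1 y1 x2 l : algC) : algC * algC :=
  let x3 := l ^+ 2 - A - x1 - x2 in (x3, - (l * (x3 - x1) + y1)).

Lemma secant_sym A B x1 y1 x2 y2 l :
  secant A B x1 y1 x2 y2 l -> secant A B x2 y2 x1 y1 l.
Proof.
move=> [h1 h2]; split; last by rewrite addrC h2; ring.
by apply: (lincomb1 (c := -1) h1); ring.
Qed.

Lemma chord_sym A B x1 y1 x2 y2 l :
  secant A B x1 y1 x2 y2 l -> chord A x1 y1 x2 l = chord A x2 y2 x1 l.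
Proof.
move=> [h1 h2]; rewrite /chord; congr pair; first ring.
by apply: (lincomb1 (c := -1) h1); ring.
Qed.

Lemma secant_chord A B x1 y1 x2 y2 x3 y3 l : secant A B x1 y1 x2 y2 l ->
  chord A x1 y1 x2 l = (x3, y3) -> secant A B x1 (- y1) x3 y3 (- l).
Proof.
move=> [h1 h2] [<- <-]; split; first ring.
by apply: (lincomb2 (c := l) (c' := 1) h1 h2); ring.
Qed.

(** The degenerate case of associativity: two secants of equal slope through point 2 are one line,
    so point 3 is the third intersection of that line with the cubic. *)
Lemma secant_collinear A B x1 y1 x2 y2 x3 y3 l :
  secant A B x1 y1 x2 y2 l -> secant A B x2 y2 x3 y3 l -> x1 <> x3 ->
  chord A x1 y1 x2 l = (x3, - y3).
Proof.
move=> [h1 h2] [h3 h4] n13.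
have e : l ^+ 2 - A - x1 - x2 = x3.
  have nz : x1 - x3 != 0 by rewrite subr_eq0; apply/eqP.
  apply: (mulIf nz).
  have h5 : y1 - y3 = l * (x1 - x3) by apply: (lincomb2 (c := 1) (c' := 1) h1 h3); ring.
  by apply: (lincomb3 (c := -l) (c' := 1) (c'' := -1) h5 h2 h4); ring.
rewrite /chord e; congr pair.
by apply: (lincomb2 (c := -1) (c' := -1) h1 h3); ring.
Qed.

(* If r = (x3 - x1) / (l - p), the line through P1 + P2 and P3 has slope
   -(l + r) and the line through P1 and P2 + P3 has slope -(p + r). *)
Lemma secant_assoc A B x1 y1 x2 y2 x3 y3 l p :
  secant A B x1 y1 x2 y2 l -> secant A B x2 y2 x3 y3 p -> l <> p ->
  exists m m', let: (x, y) := chord A x1 y1 x2 l in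
  let: (x', y') := chord A x2 y2 x3 p in
  [/\ secant A B x y x3 y3 m, secant A B x1 y1 x' y' m' &
      chord A x y x3 m = chord A x1 y1 x' m'].
Proof.
move=> [h1 h2] [h3 h4] nlp.
have nz : l - p != 0 by rewrite subr_eq0; apply/eqP.
pose r := (x3 - x1) / (l - p).
have e3 : x3 = x1 + r * (l - p) by rewrite /r divfK // addrC subrK.
exists (- (l + r)), (- (p + r)); rewrite /chord /=.
(* The relations other than [h4] are linear in [y3], [y1] and [B], which are eliminated one by one;
   [h4] divided by [l - p] then becomes [e2], the only relation left. *)
clearbody r; subst x3.
have e : y3 = y2 - p * (x2 - (x1 + r * (l - p))).
  by apply: (lincomb1 (c := -1) h3); ring.
clear h3; subst y3.
have e : y1 = y2 + l * (x1 - x2).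
  by apply: (lincomb1 (c := 1) h1); ring.
clear h1; subst y1.
have e : B = l * (y2 + l * (x1 - x2) + y2)
   - (x1 ^+ 2 + x1 * x2 + x2 ^+ 2 + A * (x1 + x2)).
  by apply: (lincomb1 (c := -1) h2); ring.
clear h2; subst B.
have e2 : 2 * y2 = r * (l ^+ 2 - A - x1 - (x1 + r * (l - p)) - x2)
   - (x1 + r * (l - p) - x2) * (l + p).
  apply: (mulIf nz); apply: (lincomb1 (c := -1) h4); ring.
split; [split | split | congr pair].
- by apply: (lincomb1 (c := -1) e2); ring.
- by apply: (lincomb1 (c := -l) e2); ring.
- by apply: (lincomb1 (c := 1) e2); ring.
- by apply: (lincomb1 (c := -l) e2); ring.
- by ring.
- by apply: (lincomb1 (c := 1) e2); ring.
Qed.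

Record ecurve := ECurve {
  ecA : algC; ecB : algC; ecC : algC;
  ec_smooth : forall x, x ^+ 3 + ecA * x ^+ 2 + ecB * x + ecC = 0 ->
    3 * x ^+ 2 + 2 * ecA * x + ecB != 0 }.

Section GroupLaw.

Variable E : ecurve.
Local Notation A := (ecA E).
Local Notation B := (ecB E).
Local Notation C := (ecC E).

Implicit Types P Q : option (algC * algC).

Definition onE P : bool :=
  if P is Some (x, y) then y ^+ 2 == x ^+ 3 + A * x ^+ 2 + B * x + C else true.

Definition eneg P : option (algC * algC) :=
  if P is Some (x, y) then Some (x, - y) else None.

Definition slope (x1 y1 x2 y2 : algC) : algC :=
  if x1 == x2 then (3 * x1 ^+ 2 + 2 * A * x1 + B) / (2 * y1)
  else (y2 - y1) / (x2 - x1).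

Definition eadd P Q : option (algC * algC) :=
  match P, Q with
  | None, _ => Q
  | _, None => P
  | Some (x1, y1), Some (x2, y2) =>
      if (x1 == x2) && (y1 + y2 == 0) then None
      else Some (chord A x1 y1 x2 (slope x1 y1 x2 y2))
  end.

Lemma eadd0P : left_id None eadd.
Proof. by case=> [[]|]. Qed.

Lemma eaddP0 : right_id None eadd.
Proof. by case=> [[]|]. Qed.

Lemma enegK : involutive eneg.
Proof. by case=> [[x y]|] //=; rewrite opprK. Qed.

Lemma onE_neg P : onE (eneg P) = onE P.
Proof. by case: P => [[x y]|] //=; rewrite sqrrN. Qed.

Lemma onE_same_x x y y' : onE (Some (x, y)) -> onE (Some (x, y')) ->
  y + y' != 0 -> y = y'.
Proof.
move=> /eqP e /eqP e' ny; apply/eqP; rewrite -subr_eq0.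
have : (y - y') * (y + y') = 0 by rewrite -subr_sqr e e' subrr.
by move/eqP; rewrite mulf_eq0 (negPf ny) orbF.
Qed.

Lemma eadd_opp x y : eadd (Some (x, y)) (Some (x, - y)) = None.
Proof. by rewrite /= eqxx subrr eqxx. Qed.

Lemma slope_secant x1 y1 x2 y2 : onE (Some (x1, y1)) -> onE (Some (x2, y2)) ->
  ~~ ((x1 == x2) && (y1 + y2 == 0)) ->
  secant A B x1 y1 x2 y2 (slope x1 y1 x2 y2).
Proof.
rewrite /slope /secant; have [<- /= o1 o2 ny|nx /eqP e1 /eqP e2 _] := eqVneq x1 x2.
  have ey := onE_same_x o1 o2 ny; subst y2; rewrite !subrr mulr0; split=> //.
  have ny1 : y1 != 0 by apply: contraNneq ny => ->; rewrite addr0.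
  by field; rewrite ?ny1 ?pnatr_eq0.
have nz : x2 - x1 != 0 by rewrite subr_eq0 eq_sym.
split; first by field.
apply: (mulIf nz).
have -> : (y2 - y1) / (x2 - x1) * (y1 + y2) * (x2 - x1) = y2 ^+ 2 - y1 ^+ 2 by field.
by rewrite e1 e2; ring.
Qed.

(** Two opposite points satisfying the secant relations would have ordinate 0 and a vanishing
    derivative of the cubic, that is, they would be a singular point. *)
Lemma secant_nopp x1 y1 x2 y2 l : onE (Some (x1, y1)) ->
  secant A B x1 y1 x2 y2 l -> ~~ ((x1 == x2) && (y1 + y2 == 0)).
Proof.
move=> /eqP o1 [h1 h2]; apply/negP => /andP[/eqP ex /eqP ey]; subst x2.
have y0 : y1 = 0.
  have : 2 * y1 = 0 by apply: (lincomb2 (c := 1) (c' := 1) h1 ey); ring.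
  by move/eqP; rewrite mulf_eq0 pnatr_eq0 => /eqP.
have := @ec_smooth E x1; rewrite -o1 y0 expr0n /= => /(_ erefl) /eqP[].
by rewrite ey mulr0 in h2; rewrite [RHS]h2; ring.
Qed.

Lemma secant_inj x1 y1 x2 y2 l l' : ~~ ((x1 == x2) && (y1 + y2 == 0)) ->
  secant A B x1 y1 x2 y2 l -> secant A B x1 y1 x2 y2 l' -> l = l'.
Proof.
move=> nopp [h1 h2] [h3 h4]; move: nopp; have [ex /= ny|nx _] := eqVneq x1 x2.
  by apply: (mulIf ny); rewrite h2 h4.
by apply: (@mulIf _ (x1 - x2)); rewrite ?subr_eq0 // -h1 -h3.
Qed.

(** A sum can be computed from any [l] that satisfies the two polynomial relations, without deciding
    between chord and tangent. *)
Lemma eadd_secant x1 y1 x2 y2 l : onE (Some (x1, y1)) -> onE (Some (x2, y2)) ->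
  secant A B x1 y1 x2 y2 l ->
  eadd (Some (x1, y1)) (Some (x2, y2)) = Some (chord A x1 y1 x2 l).
Proof.
move=> o1 o2 sl; have nopp := secant_nopp o1 sl.
rewrite /= (negPf nopp); congr (Some (chord _ _ _ _ _)).
exact: secant_inj nopp (slope_secant o1 o2 nopp) sl.
Qed.

Variant eadd_spec x1 y1 x2 y2 : option (algC * algC) -> Type :=
| EaddOpp of x2 = x1 & y2 = - y1 : eadd_spec x1 y1 x2 y2 None
| EaddSecant l of secant A B x1 y1 x2 y2 l :
    eadd_spec x1 y1 x2 y2 (Some (chord A x1 y1 x2 l)).

Lemma eaddE x1 y1 x2 y2 : onE (Some (x1, y1)) -> onE (Some (x2, y2)) ->
  eadd_spec x1 y1 x2 y2 (eadd (Some (x1, y1)) (Some (x2, y2))).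
Proof.
move=> o1 o2 /=; case: ifP => [/andP[/eqP ex /eqP ey]|/negbT nopp].
  by apply: EaddOpp => //; apply/eqP; rewrite -addr_eq0 addrC ey.
by apply: EaddSecant; apply: slope_secant.
Qed.

Lemma onE_chord x1 y1 x2 y2 l : onE (Some (x1, y1)) ->
  secant A B x1 y1 x2 y2 l -> onE (Some (chord A x1 y1 x2 l)).
Proof.
move=> /eqP o1 [h1 h2]; apply/eqP.
pose X := l ^+ 2 - A - x1 - x2 - x1.
by apply: (lincomb3 (c := 1) (c' := X * l) (c'' := X) o1 h1 h2); rewrite /X; ring.
Qed.

Lemma onE_add P Q : onE P -> onE Q -> onE (eadd P Q).
Proof.
case: P Q => [[x1 y1]|] [[x2 y2]|] // o1 o2.
by case: eaddE => // l; apply: onE_chord.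
Qed.

Lemma eaddC P Q : onE P -> onE Q -> eadd P Q = eadd Q P.
Proof.
case: P Q => [[x1 y1]|] [[x2 y2]|] // o1 o2.
case: eaddE => // [-> ->|l sl]; first by rewrite -{2}[y1]opprK eadd_opp.
by rewrite (eadd_secant o2 o1 (secant_sym sl)) (chord_sym sl).
Qed.

Lemma eaddNP P : eadd (eneg P) P = None.
Proof. by case: P => [[x y]|] //; rewrite -{2}[y]opprK eadd_opp. Qed.

Lemma eaddKP P Q : onE P -> onE Q -> eadd (eneg P) (eadd P Q) = Q.
Proof.
case: P Q => [[x1 y1]|] [[x2 y2]|] // o1 o2; last by rewrite eaddP0 eaddNP.
case: eaddE => // [-> ->|l sl] //.
have o1' : onE (Some (x1, - y1)) by rewrite -(onE_neg (Some _)) /= opprK.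
have := onE_chord o1 sl; have := secant_chord sl.
case ch: chord => [x3 y3] /(_ _ _ erefl) sl' o3; rewrite (eadd_secant o1' o3 sl').
case: ch sl => <- _ [h1 _]; congr Some; rewrite /chord; congr pair; first ring.
by apply: (lincomb1 (c := 1) h1); ring.
Qed.

Lemma eaddA P Q R : onE P -> onE Q -> onE R ->
  eadd P (eadd Q R) = eadd (eadd P Q) R.
Proof.
case: P Q R => [[x1 y1]|] [[x2 y2]|] [[x3 y3]|] // o1 o2 o3; try by rewrite ?eaddP0 ?eadd0P.
case: (eaddE o1 o2) => [e1 e2|l s12].
  subst x2 y2; rewrite eadd0P -[in LHS](enegK (Some (x1, y1))).
  exact: eaddKP.
case: (eaddE o2 o3) => [e1 e2|p s23].
  subst x3 y3; rewrite eaddP0 eaddC ?(onE_chord o1 s12) //.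
  by rewrite -(eadd_secant o1 o2 s12) (eaddC o1) //; apply: esym; apply: (eaddKP o2 o1).
(* Equal slopes mean that the three points are collinear, the case that [secant_assoc] excludes.
   There either the outer points coincide and commutativity suffices, or both sides are opposite to
   the remaining point. *)
have [elp|/eqP nlp] := eqVneq l p; last first.
  case: (secant_assoc s12 s23 nlp) => m [m'].
  have := onE_chord o2 s23; have := onE_chord o1 s12.
  case: chord => x y; case: chord => x' y' o12 o23 [sm sm' e].
  by rewrite (eadd_secant o1 o23 sm') (eadd_secant o12 o3 sm) e.
subst p; have [ex|/eqP nx] := eqVneq x1 x3.
  have ey : y1 = y3.
    case: s12 s23 => [h1 _] [h3 _]; subst x3.
    by apply: (lincomb2 (c := 1) (c' := 1) h1 h3); ring.
  subst x3 y3; rewrite (chord_sym s23) eaddC //.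
  by have := onE_chord o1 s12.
rewrite (secant_collinear s12 s23 nx) [RHS](eaddNP (Some (x3, y3))).
have s21 := secant_sym s12; have s32 := secant_sym s23.
rewrite (chord_sym s23) (secant_collinear s32 s21) ?eadd_opp //.
by move=> e; apply: nx.
Qed.

End GroupLaw.

Record pt (E : ecurve) := Pt { ptval :> option (algC * algC); _ : onE E ptval }.
HB.instance Definition _ E := [isSub for @ptval E].
HB.instance Definition _ E := [Choice of pt E by <:].

Section PtZmod.
Variable E : ecurve.
Implicit Types P Q R : pt E.

Definition pt0 : pt E := @Pt E None isT.
Definition ptopp P : pt E := Pt (etrans (onE_neg E P) (valP P)).
Definition ptadd P Q : pt E := Pt (onE_add (valP P) (valP Q)).

Lemma ptaddA : associative ptadd.
Proof. by move=> P Q R; apply: val_inj; apply: eaddA; apply: valP. Qed.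
Lemma ptaddC : commutative ptadd.
Proof. by move=> P Q; apply: val_inj; apply: eaddC; apply: valP. Qed.
Lemma ptadd0 : left_id pt0 ptadd.
Proof. by move=> P; apply: val_inj; apply: eadd0P. Qed.
Lemma ptaddN : left_inverse pt0 ptopp ptadd.
Proof. by move=> P; apply: val_inj; apply: eaddNP. Qed.

HB.instance Definition _ := GRing.isZmodule.Build (pt E) ptaddA ptaddC ptadd0 ptaddN.

Lemma ptvalD P Q : ptval (P + Q) = eadd E P Q. Proof. by []. Qed.
Lemma ptvalN P : ptval (- P) = eneg P. Proof. by []. Qed.
End PtZmod.

Lemma pt_inj E : injective (@ptval E). Proof. exact: val_inj. Qed.

Lemma ptP E (P : pt E) : onE E (ptval P). Proof. exact: valP. Qed.

(** * The isogeny lambda* on the short models *)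

(** Elimination of x from f = f' = 0: dividing 9 f by f' leaves the linear relation [e], and putting
    it into f' leaves 9 times the discriminant. *)
Lemma cubic_smooth (F : numFieldType) (A B C x : F) :
  A ^+ 2 * B ^+ 2 - 4 * B ^+ 3 - 4 * A ^+ 3 * C - 27 * C ^+ 2 + 18 * A * B * C != 0 ->
  x ^+ 3 + A * x ^+ 2 + B * x + C = 0 -> 3 * x ^+ 2 + 2 * A * x + B != 0.
Proof.
move=> nD f0; apply: contraNneq nD => f1; apply/eqP.
have e : (6 * B - 2 * A ^+ 2) * x = A * B - 9 * C.
  by apply: (lincomb2 (c := 9) (c' := - (3 * x + A)) f0 f1); ring.
have e' : 9 * (A ^+ 2 * B ^+ 2 - 4 * B ^+ 3 - 4 * A ^+ 3 * C - 27 * C ^+ 2 + 18 * A * B * C) = 0.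
  pose D := 6 * B - 2 * A ^+ 2.
  by apply: (lincomb2 (c := - D ^+ 2) (c' := 3 * D * x + 3 * (A * B - 9 * C) + 2 * A * D) f1 e);
    rewrite /D; ring.
by move/eqP: e'; rewrite mulf_eq0 pnatr_eq0 /= => /eqP.
Qed.

Section Isogeny.

Variables (a : algC) (a0 : a != 0) (aD : a ^+ 2 - 11 * a - 1 != 0).

Lemma Wst_smooth x :
  x ^+ 3 + (a ^+ 2 - 6 * a + 1) * x ^+ 2 + 8 * a * (a - 1) * x + 16 * a ^+ 2 = 0 ->
  3 * x ^+ 2 + 2 * (a ^+ 2 - 6 * a + 1) * x + 8 * a * (a - 1) != 0.
Proof.
apply: cubic_smooth.
set D := (X in X != 0).
have -> : D = 256 * a ^+ 5 * (a ^+ 2 - 11 * a - 1) by rewrite /D; ring.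
by rewrite !mulf_neq0 ?expf_neq0 ?pnatr_eq0.
Qed.

Lemma W_smooth x :
  x ^+ 3 + (a ^+ 2 - 30 * a + 1) * x ^+ 2 + - 8 * a * (3 * a + 1) * (4 * a - 7) * x
    + - 16 * a * (4 * a ^+ 4 - 4 * a ^+ 3 - 40 * a ^+ 2 + 91 * a - 4) = 0 ->
  3 * x ^+ 2 + 2 * (a ^+ 2 - 30 * a + 1) * x + - 8 * a * (3 * a + 1) * (4 * a - 7) != 0.
Proof.
apply: cubic_smooth.
set D := (X in X != 0).
have -> : D = 256 * a * (a ^+ 2 - 11 * a - 1) ^+ 5 by rewrite /D; ring.
by rewrite !mulf_neq0 ?expf_neq0 ?pnatr_eq0.
Qed.

(* Short models of E*_a and E_a: x = U / 4 on E*_a and x = u / 4 - 2a on E_a. *)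
Definition Wst : ecurve := ECurve Wst_smooth.
Definition W : ecurve := ECurve W_smooth.

(** The nonzero points of the kernel, T, -T, 2T and -2T, have abscissa 0 or 4a. Below, [lamx] is
    Velu's formula in partial fractions, and [lamy] is V times the derivative of [lamx]. *)
Definition Ker (U : algC) : algC := U * (U - 4 * a).
Definition lamx (U : algC) : algC :=
  U + 8 * a + 16 * a * (a - 1) / U + 64 * a ^+ 2 / U ^+ 2
  + 16 * a ^+ 2 * (a + 1) / (U - 4 * a) + 64 * a ^+ 4 / (U - 4 * a) ^+ 2.
Definition lamy (U V : algC) : algC :=
  V * (1 - 16 * a * (a - 1) / U ^+ 2 - 128 * a ^+ 2 / U ^+ 3
  - 16 * a ^+ 2 * (a + 1) / (U - 4 * a) ^+ 2 - 128 * a ^+ 4 / (U - 4 * a) ^+ 3).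

Definition lamP (P : option (algC * algC)) : option (algC * algC) :=
  if P is Some (U, V) then
    if Ker U == 0 then None else Some (lamx U, lamy U V)
  else None.

Lemma KerP U : Ker U != 0 -> U != 0 /\ U - 4 * a != 0.
Proof. by rewrite /Ker mulf_eq0 negb_or => /andP[]. Qed.

Lemma lamP_on (P : pt Wst) : onE W (lamP P).
Proof.
case: P => [[[U V]|] //=]; case: ifP => // /negbT /KerP[U0 U1] /eqP e; apply/eqP.
have -> : lamy U V ^+ 2 = V ^+ 2 * lamy U 1 ^+ 2 by rewrite /lamy; ring.
by rewrite e /= /lamx /lamy /=; field; rewrite U0 U1.
Qed.

Definition lam (P : pt Wst) : pt W := Pt (lamP_on P).

Lemma lamN (P : pt Wst) : lam (- P) = - lam P.
Proof.
apply: val_inj; case: P => [[[U V]|] //= ?]; case: ifP => //= _.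
by rewrite /lamy mulNr.
Qed.

Lemma lam0 : lam 0 = 0. Proof. exact: val_inj. Qed.

Lemma T_on : onE Wst (Some (0, 4 * a)).
Proof. by apply/eqP => /=; ring. Qed.

Definition T : pt Wst := Pt T_on.

Lemma T2E : ptval (T *+ 2) = Some (4 * a, - (4 * a ^+ 2)).
Proof.
rewrite mulr2n ptvalD (eadd_secant (l := a - 1) T_on T_on).
  by congr (Some (_, _)); rewrite /=; ring.
by split=> /=; ring.
Qed.

Lemma T3E : T *+ 3 = - T *+ 2.
Proof.
apply: val_inj; rewrite mulrS mulNrn.
change (eadd Wst T (ptval (T *+ 2)) = eneg (ptval (T *+ 2))); rewrite T2E.
have o2 : onE Wst (Some (4 * a, - (4 * a ^+ 2))) by rewrite -T2E; apply: (valP (T *+ 2)).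
rewrite (eadd_secant (l := - (a + 1)) T_on o2).
  by congr (Some (_, _)); rewrite /=; ring.
by split=> /=; ring.
Qed.

Lemma T5 : T *+ 5 = 0.
Proof. by rewrite (mulrnDr _ 3 2) T3E mulNrn addNr. Qed.

Lemma lam_eq0 (R : pt Wst) :
  (lam R == 0) = (R \in [:: 0; T; - T; T *+ 2; - T *+ 2]).
Proof.
have eT n : lam (T *+ n) == 0 -> lam (- T *+ n) == 0.
  by rewrite mulNrn lamN oppr_eq0.
have KT : lam T == 0 by rewrite -val_eqE /= /Ker mul0r eqxx.
have KT2 : lam (T *+ 2) == 0.
  rewrite -val_eqE; change (lamP (ptval (T *+ 2)) == None).
  by rewrite T2E /= /Ker subrr mulr0 eqxx.
apply/idP/idP; last first.
  rewrite !inE => /or4P[|||/orP[]] /eqP->.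
  - by rewrite lam0.
  - exact: KT.
  - exact: (eT 1%N).
  - exact: KT2.
  - exact: eT.
have eqT (P Q : pt Wst) : ptval P = ptval Q -> P == Q by move=> e; apply/eqP/val_inj.
case: R => [[[U V]|]] o; last by rewrite !inE eqT.
rewrite -val_eqE /=; case: ifP => // /eqP/eqP; rewrite /Ker mulf_eq0 subr_eq0.
have /= /eqP o' := o.
move=> /orP[]/eqP e _; subst U; rewrite !inE.
  have : (V - 4 * a) * (V + 4 * a) = 0.
    by apply: (lincomb1 (c := 1) o'); rewrite /=; ring.
  move/eqP; rewrite mulf_eq0 subr_eq0 addr_eq0 => /orP[]/eqP e; subst V.
    by rewrite (eqT _ T) ?orbT.
  by rewrite (eqT _ (- T)) ?orbT.
have : (V + 4 * a ^+ 2) * (V - 4 * a ^+ 2) = 0.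
  by apply: (lincomb1 (c := 1) o'); rewrite /=; ring.
move/eqP; rewrite mulf_eq0 subr_eq0 addr_eq0 => /orP[]/eqP e; subst V.
  by rewrite (eqT _ (T *+ 2)) ?orbT // T2E.
by rewrite (eqT _ (- T *+ 2)) ?orbT // mulNrn ptvalN T2E /= opprK.
Qed.

Lemma lam_eq0P (R : pt Wst) : reflect (exists j : nat, R = T *+ j) (lam R == 0).
Proof.
have e1 : - T = T *+ 4.
  by apply/eqP; rewrite -subr_eq0 -opprD -mulrS T5 oppr0.
have e2 : - T *+ 2 = T *+ 3 by rewrite T3E.
rewrite lam_eq0; apply: (iffP idP); rewrite !inE.
  case/or4P=> [|||/orP[]] /eqP->; rewrite ?e2 ?e1.
  - by exists 0%N.
  - by exists 1%N.
  - by exists 4%N.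
  - by exists 2%N.
  - by exists 3%N.
case=> j ->; rewrite (divn_eq j 5) mulrnDr mulnC mulrnA T5 mul0rn add0r e1 -mulrnA.
have : (j %% 5 < 5)%N by rewrite ltn_mod.
case: (j %% 5)%N => [|[|[|[|[|]]]]] // _; rewrite ?mulr0n ?mulr1n ?eqxx ?orbT //.
have -> : T *+ (4 * 2) = T *+ 3 by rewrite (mulrnDr _ 5 3) T5 add0r.
by rewrite eqxx !orbT.
Qed.

Definition xc (P : option (algC * algC)) := if P is Some (x, _) then x else 0.
Definition yc (P : option (algC * algC)) := if P is Some (_, y) then y else 0.

Lemma eadd_chord (E : ecurve) x1 y1 x2 y2 : x1 != x2 ->
  eadd E (Some (x1, y1)) (Some (x2, y2)) =
  Some (chord (ecA E) x1 y1 x2 ((y2 - y1) / (x2 - x1))).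
Proof. by move=> /negPf n; rewrite /= /slope n. Qed.

(** Velu's formula as a plain sum over the coset of P. The abscissae of the kernel points, 8a in
    total, are not subtracted; this accounts for the constant 8a in [lamx]. Each sum reduces to the
    closed formula by the curve equation. *)
Lemma velu_coord U V (P : option (algC * algC) := Some (U, V))
  (Q : option (algC * algC) := Some (4 * a, - (4 * a ^+ 2))) :
  onE Wst P -> Ker U != 0 -> lamP P =
  Some (xc P + xc (eadd Wst P T) + xc (eadd Wst P (eneg T))
          + xc (eadd Wst P Q) + xc (eadd Wst P (eneg Q)),
        yc P + yc (eadd Wst P T) + yc (eadd Wst P (eneg T))
          + yc (eadd Wst P Q) + yc (eadd Wst P (eneg Q))).
Proof.
move=> /eqP o K0; have [U0 U1] := KerP K0; rewrite /= in o.
have U2 : U != 4 * a by rewrite -subr_eq0.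
have U3 : 4 * a - U != 0 by rewrite subr_eq0 eq_sym.
rewrite /lamP /P /Q (negPf K0) [ptval T]/= /eneg !eadd_chord // /chord /xc /yc /=.
congr (Some (_, _)).
  apply: (lincomb1 (c := - (2 / U ^+ 2 + 2 / (U - 4 * a) ^+ 2)) o).
  by rewrite /lamx; field; rewrite U0 U1 U3.
apply: (lincomb1 (c := 2 * V * ((U ^+ 3)^-1 + ((U - 4 * a) ^+ 3)^-1)) o).
by rewrite /lamy; field; rewrite U0 U1 U3.
Qed.

Lemma velu (R : pt Wst) : lam R != 0 -> ptval (lam R) =
  Some (xc R + xc (R + T) + xc (R - T) + xc (R + T *+ 2) + xc (R - T *+ 2),
        yc R + yc (R + T) + yc (R - T) + yc (R + T *+ 2) + yc (R - T *+ 2)).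
Proof.
rewrite -val_eqE !(ptvalD R) !ptvalN T2E; case: R => [[[U V]|]] o // K0.
by refine (velu_coord o _); apply: contra K0 => /= ->.
Qed.

(** Away from the kernel, translation by T only permutes the five summands of [velu]. *)
Lemma lamDT (R : pt Wst) : lam (R + T) = lam R.
Proof.
have T4 : T *+ 2 + T *+ 2 = - T.
  by apply/eqP; rewrite -subr_eq0 opprK -mulrnDr -mulrSr T5.
have [/lam_eq0P[j ->]|R0] := boolP (lam R == 0).
  have -> : lam (T *+ j) = 0 by apply/eqP/lam_eq0P; exists j.
  by apply/eqP/lam_eq0P; exists j.+1; rewrite mulrSr.
have R1 : lam (R + T) != 0.
  apply: contra R0 => /lam_eq0P[j e]; apply/lam_eq0P; exists (j + 4)%N.
  by rewrite mulrnDr -e -addrA -mulrS T5 addr0.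
apply: pt_inj; rewrite !velu //.
have -> : R + T + T = R + T *+ 2 by rewrite -addrA.
have -> : R + T - T = R by rewrite addrK.
have -> : R + T + T *+ 2 = R - T *+ 2.
  by rewrite -addrA -mulrS T3E mulNrn.
have -> : R + T - T *+ 2 = R - T by rewrite mulr2n opprD addrA addrK.
by congr (Some (_, _)); ring.
Qed.

Lemma lamDTn (R : pt Wst) n : lam (R + T *+ n) = lam R.
Proof. by elim: n => [|n IH]; rewrite ?mulr0n ?addr0 // mulrSr addrA lamDT. Qed.

(* The points (U_i, l U_i + n) of a line are mapped by lam to points of the
   line with slope lineL / lineK and intercept lineM / lineK. *)
Definition lineK (l n : algC) : algC :=
  (4 * a - n) * (4 * a + n) * (4 * a ^+ 2 - 4 * a * l - n)
    * (4 * a ^+ 2 + 4 * a * l + n).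
Definition lineL (l n : algC) : algC :=
  16 * l ^+ 3 * n ^+ 2 * a ^+ 2 + 3 * 2 ^+ 8 * l ^+ 3 * a ^+ 4 + 8 * l ^+ 2 * n ^+ 3 *
  a - 2 ^+ 8 * l ^+ 2 * n * a ^+ 4 + 5 * 2 ^+ 7 * l ^+ 2 * n * a ^+ 3 + l * n ^+ 4 -
  16 * l * n ^+ 2 * a ^+ 4 - 3 * 2 ^+ 6 * l * n ^+ 2 * a ^+ 3 + 11 * 2 ^+ 4 * l * n ^+
  2 * a ^+ 2 - 3 * 2 ^+ 8 * l * a ^+ 6 + 2 ^+ 10 * l * a ^+ 5 - 16 * n ^+ 3 * a ^+ 3 -
  32 * n ^+ 3 * a ^+ 2 + 16 * n ^+ 3 * a + 2 ^+ 8 * n * a ^+ 6 + 2 ^+ 8 * n * a ^+ 4.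
Definition lineM (l n : algC) : algC :=
  - 2 ^+ 10 * l ^+ 5 * a ^+ 4 + 2 ^+ 8 * l ^+ 4 * n * a ^+ 4 - 3 * 2 ^+ 8 * l ^+ 4 * n
  * a ^+ 3 + 64 * l ^+ 3 * n ^+ 2 * a ^+ 3 - 3 * 2 ^+ 6 * l ^+ 3 * n ^+ 2 * a ^+ 2 + 2
  ^+ 11 * l ^+ 3 * a ^+ 6 - 13 * 2 ^+ 10 * l ^+ 3 * a ^+ 5 + 2 ^+ 10 * l ^+ 3 * a ^+ 4
  + 16 * l ^+ 2 * n ^+ 3 * a ^+ 3 - 16 * l ^+ 2 * n ^+ 3 * a ^+ 2 - 16 * l ^+ 2 * n ^+
  3 * a - 2 ^+ 9 * l ^+ 2 * n * a ^+ 6 + 17 * 2 ^+ 8 * l ^+ 2 * n * a ^+ 5 - 49 * 2 ^+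
  8 * l ^+ 2 * n * a ^+ 4 + 3 * 2 ^+ 8 * l ^+ 2 * n * a ^+ 3 - 9 * 2 ^+ 6 * l * n ^+ 2
  * a ^+ 5 + 37 * 2 ^+ 6 * l * n ^+ 2 * a ^+ 4 - 61 * 2 ^+ 6 * l * n ^+ 2 * a ^+ 3 + 3
  * 2 ^+ 6 * l * n ^+ 2 * a ^+ 2 - 2 ^+ 10 * l * a ^+ 8 + 5 * 2 ^+ 10 * l * a ^+ 7 -
  23 * 2 ^+ 10 * l * a ^+ 6 + 2 ^+ 10 * l * a ^+ 5 + n ^+ 5 - 16 * n ^+ 3 * a ^+ 5 - 5
  * 2 ^+ 4 * n ^+ 3 * a ^+ 4 + 5 * 2 ^+ 6 * n ^+ 3 * a ^+ 3 - 25 * 2 ^+ 4 * n ^+ 3 * a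
  ^+ 2 + 16 * n ^+ 3 * a + 2 ^+ 8 * n * a ^+ 8 + 2 ^+ 9 * n * a ^+ 7 - 5 * 2 ^+ 8 * n
  * a ^+ 6 - 11 * 2 ^+ 9 * n * a ^+ 5 + 2 ^+ 8 * n * a ^+ 4.
(** The cofactor with which the equation of the line section enters [lam_line], once denominators
    are cleared. *)
Definition lineS (l n U : algC) : algC :=
  - 2 ^+ 10 * U ^+ 4 * l ^+ 3 * a ^+ 4 + 2 ^+ 8 * U ^+ 4 * l ^+ 2 * n * a ^+ 4 - 3 * 2
  ^+ 8 * U ^+ 4 * l ^+ 2 * n * a ^+ 3 + 3 * 2 ^+ 6 * U ^+ 4 * l * n ^+ 2 * a ^+ 3 - 3
  * 2 ^+ 6 * U ^+ 4 * l * n ^+ 2 * a ^+ 2 + 2 ^+ 10 * U ^+ 4 * l * a ^+ 6 - 2 ^+ 10 *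
  U ^+ 4 * l * a ^+ 5 + 16 * U ^+ 4 * n ^+ 3 * a ^+ 3 + 32 * U ^+ 4 * n ^+ 3 * a ^+ 2
  - 16 * U ^+ 4 * n ^+ 3 * a - 2 ^+ 8 * U ^+ 4 * n * a ^+ 6 - 2 ^+ 8 * U ^+ 4 * n * a
  ^+ 4 + 3 * 2 ^+ 12 * U ^+ 3 * l ^+ 3 * a ^+ 5 - 3 * 2 ^+ 10 * U ^+ 3 * l ^+ 2 * n *
  a ^+ 5 + 11 * 2 ^+ 10 * U ^+ 3 * l ^+ 2 * n * a ^+ 4 + 2 ^+ 9 * U ^+ 3 * l * n ^+ 2
  * a ^+ 5 - 7 * 2 ^+ 8 * U ^+ 3 * l * n ^+ 2 * a ^+ 4 + 13 * 2 ^+ 8 * U ^+ 3 * l * n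
  ^+ 2 * a ^+ 3 - 2 ^+ 12 * U ^+ 3 * l * a ^+ 7 + 5 * 2 ^+ 12 * U ^+ 3 * l * a ^+ 6 +
  64 * U ^+ 3 * n ^+ 3 * a ^+ 4 - 2 ^+ 8 * U ^+ 3 * n ^+ 3 * a ^+ 3 + 5 * 2 ^+ 6 * U
  ^+ 3 * n ^+ 3 * a ^+ 2 - 2 ^+ 10 * U ^+ 3 * n * a ^+ 7 + 2 ^+ 11 * U ^+ 3 * n * a ^+
  6 + 5 * 2 ^+ 10 * U ^+ 3 * n * a ^+ 5 - 3 * 2 ^+ 14 * U ^+ 2 * l ^+ 3 * a ^+ 6 + 3 *
  2 ^+ 12 * U ^+ 2 * l ^+ 2 * n * a ^+ 6 - 15 * 2 ^+ 12 * U ^+ 2 * l ^+ 2 * n * a ^+ 5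
  + 3 * 2 ^+ 11 * U ^+ 2 * l * n ^+ 2 * a ^+ 5 - 21 * 2 ^+ 10 * U ^+ 2 * l * n ^+ 2 *
  a ^+ 4 - 2 ^+ 14 * U ^+ 2 * l * a ^+ 8 - 2 ^+ 17 * U ^+ 2 * l * a ^+ 7 + 3 * 2 ^+ 8
  * U ^+ 2 * n ^+ 3 * a ^+ 4 - 9 * 2 ^+ 8 * U ^+ 2 * n ^+ 3 * a ^+ 3 + 2 ^+ 12 * U ^+
  2 * n * a ^+ 8 - 3 * 2 ^+ 12 * U ^+ 2 * n * a ^+ 7 - 2 ^+ 15 * U ^+ 2 * n * a ^+ 6 +
  2 ^+ 16 * U * l ^+ 3 * a ^+ 7 - 2 ^+ 14 * U * l ^+ 2 * n * a ^+ 7 + 9 * 2 ^+ 14 * U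
  * l ^+ 2 * n * a ^+ 6 - 2 ^+ 13 * U * l * n ^+ 2 * a ^+ 6 + 15 * 2 ^+ 12 * U * l * n
  ^+ 2 * a ^+ 5 - 2 ^+ 16 * U * l * a ^+ 9 + 2 ^+ 18 * U * l * a ^+ 8 - 2 ^+ 10 * U *
  n ^+ 3 * a ^+ 5 + 7 * 2 ^+ 10 * U * n ^+ 3 * a ^+ 4 + 2 ^+ 14 * U * n * a ^+ 9 - 3 *
  2 ^+ 14 * U * n * a ^+ 8 + 2 ^+ 16 * U * n * a ^+ 7 - 2 ^+ 17 * l ^+ 2 * n * a ^+ 7
  - 2 ^+ 16 * l * n ^+ 2 * a ^+ 6 - 2 ^+ 13 * n ^+ 3 * a ^+ 5 + 2 ^+ 17 * n * a ^+ 9.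

(** [lineK] vanishes exactly on the lines through one of the four nonzero kernel points, where an
    image point goes to infinity. *)
Lemma lam_line (l n U : algC) :
  U ^+ 3 + (a ^+ 2 - 6 * a + 1) * U ^+ 2 + 8 * a * (a - 1) * U + 16 * a ^+ 2
    = (l * U + n) ^+ 2 ->
  Ker U != 0 -> lineK l n != 0 ->
  lamy U (l * U + n) = lineL l n / lineK l n * lamx U + lineM l n / lineK l n.
Proof.
move=> e /KerP[U0 U1] K0.
apply: (lincomb1 (c := lineS l n U / (lineK l n * Ker U ^+ 3)) e).
rewrite /lamx /lamy /Ker; set K := lineK l n in K0 *.
have eK : K = lineK l n by [].
have -> : forall x y z t : algC, x - (y / K * z + t / K) = (x * K - y * z - t) / K.
  by move=> x y z t; field.
rewrite [X in X / K]addrC {1}eK.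
by rewrite /lineK /lineL /lineM /lineS; field; rewrite U0 U1 K0.
Qed.

Lemma lam_line_sum (l n U1 U2 U3 : algC) :
  U1 + U2 + U3 = l ^+ 2 - (a ^+ 2 - 6 * a + 1) ->
  U1 * U2 + U1 * U3 + U2 * U3 = 8 * a * (a - 1) - 2 * l * n ->
  U1 * U2 * U3 = n ^+ 2 - 16 * a ^+ 2 ->
  Ker U1 != 0 -> Ker U2 != 0 -> Ker U3 != 0 ->
  lineK l n != 0 /\
  lamx U1 + lamx U2 + lamx U3 = (lineL l n / lineK l n) ^+ 2 - (a ^+ 2 - 30 * a + 1).
Proof.
move=> s1 s2 s3 /KerP[x1 y1] /KerP[x2 y2] /KerP[x3 y3].
have inv1 (x y z : algC) : x != 0 -> y != 0 -> z != 0 ->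
    x^-1 + y^-1 + z^-1 = (x * y + x * z + y * z) / (x * y * z).
  by move=> hx hy hz; field; rewrite hx hy hz.
have inv2 (x y z : algC) : x != 0 -> y != 0 -> z != 0 ->
    (x ^+ 2)^-1 + (y ^+ 2)^-1 + (z ^+ 2)^-1 =
    ((x * y + x * z + y * z) ^+ 2 - 2 * (x + y + z) * (x * y * z)) / (x * y * z) ^+ 2.
  by move=> hx hy hz; field; rewrite hx hy hz.
have e30 : n ^+ 2 - 16 * a ^+ 2 != 0 by rewrite -s3 !mulf_neq0.
pose e1 := l ^+ 2 - (a ^+ 2 - 6 * a + 1).
pose e2 := 8 * a * (a - 1) - 2 * l * n.
pose f2 := e2 - 8 * a * e1 + 48 * a ^+ 2.
pose f3 := n ^+ 2 - 16 * a ^+ 2 - 4 * a * e2 + 16 * a ^+ 2 * e1 - 64 * a ^+ 3.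
have t1 : (U1 - 4 * a) + (U2 - 4 * a) + (U3 - 4 * a) = e1 - 12 * a.
  by rewrite /e1 -s1; ring.
have t2 : (U1 - 4 * a) * (U2 - 4 * a) + (U1 - 4 * a) * (U3 - 4 * a)
    + (U2 - 4 * a) * (U3 - 4 * a) = f2.
  by rewrite /f2 /e1 /e2 -s1 -s2; ring.
have t3 : (U1 - 4 * a) * (U2 - 4 * a) * (U3 - 4 * a) = f3.
  by rewrite /f3 /e1 /e2 -s1 -s2 -s3; ring.
have f30 : f3 != 0 by rewrite -t3 !mulf_neq0.
have eK : lineK l n = (n ^+ 2 - 16 * a ^+ 2) * f3.
  by rewrite /lineK /f3 /e1 /e2; ring.
split; first by rewrite eK mulf_neq0.
have -> : lamx U1 + lamx U2 + lamx U3 = (U1 + U2 + U3) + 24 * a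
   + 16 * a * (a - 1) * (U1^-1 + U2^-1 + U3^-1)
   + 64 * a ^+ 2 * ((U1 ^+ 2)^-1 + (U2 ^+ 2)^-1 + (U3 ^+ 2)^-1)
   + 16 * a ^+ 2 * (a + 1) * ((U1 - 4 * a)^-1 + (U2 - 4 * a)^-1 + (U3 - 4 * a)^-1)
   + 64 * a ^+ 4 * (((U1 - 4 * a) ^+ 2)^-1 + ((U2 - 4 * a) ^+ 2)^-1
                    + ((U3 - 4 * a) ^+ 2)^-1).
  by rewrite /lamx; ring.
rewrite !inv2 // !inv1 // t1 t2 t3 s1 s2 s3 eK.
by rewrite /lineL /f2 /f3 /e1 /e2 in f30 *; field; rewrite e30 f30.
Qed.

(** R, S and -(R + S) lie on a line, so their images lie on the image line; as [lam R] and [lam S]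
    have different abscissae, that line is their chord. *)
Lemma lamD_generic (R S : pt Wst) : lam R != 0 -> lam S != 0 -> lam (R + S) != 0 ->
  xc (lam R) != xc (lam S) -> lam (R + S) = lam R + lam S.
Proof.
have lamE (P : pt Wst) : lam P != 0 -> exists U V, [/\ ptval P = Some (U, V),
    Ker U != 0 & ptval (lam P) = Some (lamx U, lamy U V)].
  case: P => [[[U V]|]] o; last by move/eqP=> []; apply: pt_inj.
  rewrite -val_eqE => K0; have K1 : Ker U != 0 by apply: contra K0 => /= ->.
  by exists U, V; split=> //=; rewrite (negPf K1).
move=> /lamE[U1 [V1 [eR K1 lR]]] /lamE[U2 [V2 [eS K2 lS]]] /lamE[U3 [V3 [eRS K3 lRS]]] nx.
have oR := valP R; have oS := valP S.
rewrite lR lS /= in nx.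
have n12 : U1 != U2 by apply: contraNneq nx => ->.
apply: pt_inj; rewrite lRS ptvalD lR lS eadd_chord //.
have := eRS; rewrite ptvalD eR eS eadd_chord //.
have := slope_secant (E := Wst) (x1 := U1) (y1 := V1) (x2 := U2) (y2 := V2).
rewrite -eR -eS => /(_ oR oS); rewrite (negPf n12) /slope (negPf n12) => /(_ isT).
set l := _ / _ => -[h1 h2] [].
pose n := V1 - l * U1.
have eV1 : V1 = l * U1 + n by rewrite /n addrC subrK.
have eV2 : V2 = l * U2 + n by apply: (lincomb1 (c := -1) h1); rewrite /n; ring.
move=> eU3 eV3.
have {eV3} eV3 : V3 = - (l * U3 + n) by rewrite -eV3 eU3 /n; ring.
have /eqP c1 : onE Wst (Some (U1, V1)) by rewrite -eR.
have /eqP c2 : onE Wst (Some (U2, V2)) by rewrite -eS.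
have /eqP c3 : onE Wst (Some (U3, V3)) by rewrite -eRS; apply: valP.
rewrite /= eV1 eV2 in h2 c1 c2 *; rewrite /= eV3 sqrrN in c3.
clearbody l n; clear eV1 eV2 h1.
have s1 : U1 + U2 + U3 = l ^+ 2 - (a ^+ 2 - 6 * a + 1) by rewrite -eU3 /=; ring.
have s2 : U1 * U2 + U1 * U3 + U2 * U3 = 8 * a * (a - 1) - 2 * l * n.
  by rewrite -eU3 /=; apply: (lincomb1 (c := 1) h2); ring.
have s3 : U1 * U2 * U3 = n ^+ 2 - 16 * a ^+ 2.
  rewrite -eU3 /=; apply: (lincomb2 (c := U1) (c' := -1) h2 c1); ring.
have [K0 ss] := lam_line_sum s1 s2 s3 K1 K2 K3.
have e1 := lam_line (esym c1) K1 K0; have e2 := lam_line (esym c2) K2 K0.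
have e3 := lam_line (esym c3) K3 K0.
have -> : (lamy U2 (l * U2 + n) - lamy U1 (l * U1 + n)) / (lamx U2 - lamx U1)
   = lineL l n / lineK l n.
  rewrite e1 e2; have : lamx U2 - lamx U1 != 0 by rewrite subr_eq0 eq_sym.
  by move=> hx; field; rewrite hx K0.
rewrite /chord /=.
have -> : (lineL l n / lineK l n) ^+ 2 - (a ^+ 2 - 30 * a + 1) - lamx U1 - lamx U2
  = lamx U3 by rewrite -ss; ring.
congr (Some (_, _)).
have -> : lamy U3 V3 = - lamy U3 (l * U3 + n) by rewrite eV3 /lamy mulNr.
by rewrite e3 e1; ring.
Qed.

Lemma exists_pt (E : ecurve) (L : seq (pt E)) : exists P : pt E, P \notin L.
Proof.
pose xs := [seq xc (ptval P) | P <- L].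
pose x : algC := 1 + \sum_(z <- xs) `|z|.
have xn : x \notin xs.
  apply/negP => xin; have : `|x| <= \sum_(z <- xs) `|z|.
    by rewrite (big_rem x xin) /= lerDl sumr_ge0.
  rewrite ger0_norm ?addr_ge0 ?sumr_ge0 // /x gerDr.
  by rewrite ler10.
pose y := sqrtC (x ^+ 3 + ecA E * x ^+ 2 + ecB E * x + ecC E).
have o : onE E (Some (x, y)) by rewrite /= sqrtCK.
by exists (Pt o); apply: contra xn => oin; apply/mapP; exists (Pt o).
Qed.

Lemma pts_over (E : ecurve) (xs : seq algC) : exists L : seq (pt E),
  forall P : pt E, P != 0 -> xc P \in xs -> P \in L.
Proof.
pose f x := x ^+ 3 + ecA E * x ^+ 2 + ecB E * x + ecC E.
exists (pmap insub ([seq Some (x, sqrtC (f x)) | x <- xs]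
                ++ [seq Some (x, - sqrtC (f x)) | x <- xs])).
case=> [[[x y]|]] o // P0 /= xin; rewrite mem_pmap_sub /= mem_cat.
have /eqP : y ^+ 2 = (sqrtC (f x)) ^+ 2 by rewrite sqrtCK; apply/eqP.
rewrite eqf_sqr => /orP[]/eqP->; apply/orP; [left | right]; apply/mapP; by exists x.
Qed.

Lemma root_seq (p : {poly algC}) : p != 0 ->
  exists s : seq algC, forall x, root p x -> x \in s.
Proof.
move=> p0; have [s e] := closed_field_poly_normal p; exists s => x.
by rewrite e rootZ ?lead_coef_eq0 // root_prod_XsubC.
Qed.

(** The numerator of [lamx U - u], with denominator [Ker U ^+ 2]. Its roots are the abscissae of the
    fibre above u. *)
Definition lamx_poly (u : algC) : {poly algC} :=
  Poly [:: 2 ^+ 10 * a ^+ 4; 256 * a ^+ 3 * (a - 3);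
           - (64 * a ^+ 2 * (a - 3)) - 16 * a ^+ 2 * u;
           16 * a * (a ^+ 2 - a - 1) + 8 * a * u; - u; 1].

Lemma size_lamx_poly u : size (lamx_poly u) = 6%N.
Proof. by rewrite /lamx_poly (@PolyK _ 0) //= oner_eq0. Qed.

Lemma lamx_polyE u U : Ker U != 0 ->
  (lamx_poly u).[U] = (lamx U - u) * Ker U ^+ 2.
Proof.
move=> /KerP[U0 U1]; rewrite /lamx_poly /lamx /Ker.
rewrite horner_Poly /=.
by field; rewrite U0 U1.
Qed.

Lemma lamx_poly_at0 u : (lamx_poly u).[0] = 2 ^+ 10 * a ^+ 4.
Proof.
rewrite /lamx_poly horner_Poly /=.
by ring.
Qed.

Lemma lamx_poly_at4a u : (lamx_poly u).[4 * a] = 2 ^+ 10 * a ^+ 6.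
Proof.
rewrite /lamx_poly horner_Poly /=.
by ring.
Qed.

Lemma lamx_poly_neq0 u : lamx_poly u != 0.
Proof. by rewrite -size_poly_eq0 size_lamx_poly. Qed.

Lemma root_lamx_poly u U : root (lamx_poly u) U -> Ker U != 0 /\ lamx U = u.
Proof.
move=> /rootP r0; have K0 : Ker U != 0.
  have n0 : (2 ^+ 10 * a ^+ 4 != 0) && (2 ^+ 10 * a ^+ 6 != 0).
    by rewrite !mulf_neq0 ?expf_neq0 ?pnatr_eq0.
  apply/negP; rewrite /Ker mulf_eq0 subr_eq0 => /orP[]/eqP e; move: r0 n0; rewrite e.
    by rewrite lamx_poly_at0 => ->; rewrite eqxx.
  by rewrite lamx_poly_at4a => ->; rewrite eqxx andbF.
split=> //; move/eqP: r0; rewrite lamx_polyE // mulf_eq0 expf_eq0 (negPf K0) orbF.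
by rewrite subr_eq0 => /eqP.
Qed.

(** For fixed R, general position fails for S only in finitely many places: S or R + S in the
    kernel, or S above the abscissa of [lam R]. *)
Lemma lamD_cofinite (R : pt Wst) : lam R != 0 -> exists L : seq (pt Wst),
  forall S, S \notin L -> lam (R + S) = lam R + lam S.
Proof.
move=> R0; have [s hs] := root_seq (lamx_poly_neq0 (xc (lam R))).
have [L hL] := pts_over Wst s.
pose K := [:: 0; T; - T; T *+ 2; - T *+ 2].
exists (L ++ K ++ [seq P - R | P <- K]) => S; rewrite mem_cat negb_or mem_cat negb_or.
case/and3P=> SL SK SR.
have S0 : lam S != 0 by rewrite lam_eq0; exact: SK.
have S1 : S != 0 by apply: contraNneq S0 => ->; rewrite lam0.
apply: lamD_generic => //.
  rewrite lam_eq0; apply: contra SR => SR; apply/mapP; exists (R + S) => //.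
  by rewrite addrAC subrr add0r.
apply: contra SL => /eqP e; apply: hL => //; apply: hs.
move: S S0 e {SK SR S1} => [[[U V]|]] o //; rewrite -val_eqE /= => K0 e.
have K1 : Ker U != 0 by apply: contra K0 => ->.
by rewrite /root lamx_polyE // e (negPf K1) /= subrr mul0r.
Qed.

Lemma lamD : {morph lam : R S / R + S}.
Proof.
move=> R S.
have [/lam_eq0P[j eR]|R0] := boolP (lam R == 0).
  rewrite eR addrC lamDTn; have -> : lam (T *+ j) = 0 by apply/eqP/lam_eq0P; exists j.
  by rewrite add0r.
have [/lam_eq0P[j eS]|S0] := boolP (lam S == 0).
  rewrite eS lamDTn; have -> : lam (T *+ j) = 0 by apply/eqP/lam_eq0P; exists j.
  by rewrite addr0.
have [RS0|RS0] := boolP (lam (R + S) == 0).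
  have /lam_eq0P[j e] := RS0.
  have -> : S = - R + T *+ j by rewrite -e addrA addNr add0r.
  rewrite lamDTn lamN subrr addrA subrr add0r.
  by apply/eqP/lam_eq0P; exists j.
(* General position by an auxiliary X outside a finite list: lam (R + S) + lam X = lam (R + S + X) =
   lam R + lam (S + X) = lam R + lam S + lam X. *)
have [L1 h1] := lamD_cofinite RS0; have [L2 h2] := lamD_cofinite R0.
have [L3 h3] := lamD_cofinite S0.
have [X] := exists_pt (L1 ++ [seq Y - S | Y <- L2] ++ L3).
rewrite !mem_cat !negb_or => /and3P[X1 X2 X3].
apply: (addIr (lam X)); rewrite -h1 // -addrA h2; last first.
  by apply: contra X2 => XL; apply/mapP; exists (S + X) => //; rewrite addrAC subrr add0r.
by rewrite h3 // addrA.
Qed.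

HB.instance Definition _ := GRing.isZmodMorphism.Build (pt Wst) (pt W) lam
  (fun R S => etrans (lamD R (- S)) (congr1 _ (lamN S))).

Lemma lam_lift (P : pt W) u v U : ptval P = Some (u, v) -> Ker U != 0 ->
  lamx U = u -> exists R V, ptval R = Some (U, V) /\ lam R = P.
Proof.
move=> eP K0 eu; have o := ptP P; rewrite eP in o.
pose V := sqrtC (U ^+ 3 + (a ^+ 2 - 6 * a + 1) * U ^+ 2 + 8 * a * (a - 1) * U + 16 * a ^+ 2).
have oV : onE Wst (Some (U, V)) by rewrite /= sqrtCK.
have e : lamP (Some (U, V)) = Some (u, lamy U V) by rewrite /= (negPf K0) eu.
have := lamP_on (Pt oV); rewrite e => /eqP o'.
have /eqP o'' := o; move: o'; rewrite -o'' => /eqP; rewrite eqf_sqr => /orP[]/eqP ev.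
  by exists (Pt oV), V; split=> //; apply: pt_inj; rewrite eP /= -/(lamP (Some (U, V))) e ev.
exists (- Pt oV), (- V); split=> //; rewrite lamN; apply: pt_inj; rewrite ptvalN eP /=.
by rewrite (negPf K0) /= eu ev opprK.
Qed.

Lemma lam_surj (P : pt W) : exists R, lam R = P.
Proof.
case eP: (ptval P) => [[u v]|]; last by exists 0; apply: pt_inj; rewrite eP.
have : size (lamx_poly u) != 1%N by rewrite size_lamx_poly.
move=> /closed_rootP[U /root_lamx_poly[K0 eu]].
by have [R [V [_ <-]]] := lam_lift eP K0 eu; exists R.
Qed.

End Isogeny.

(** * Rational points and the twisted Galois action *)

Lemma irreducible_separable (q : {poly rat}) : irreducible_poly q -> separable_poly q.
Proof.
move=> irr; have [sq _] := irr; rewrite unlock irreducible_poly_coprime //.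
have q0 : q != 0 by rewrite -size_poly_gt0 ltnW.
have dq : q^`() != 0.
  apply: contraTneq sq => /polyP/(_ (size q).-2); rewrite coef_deriv coef0.
  case sz: (size q) => [|[|n]] //= /eqP; rewrite mulrn_eq0 /=.
  have -> : q`_n.+1 = lead_coef q by rewrite lead_coefE sz.
  by rewrite lead_coef_eq0 (negPf q0).
by rewrite gtNdvdp // lt_size_deriv.
Qed.

(** The roots of the minimal polynomial of z generate a Galois extension of the rationals, and each
    automorphism of it extends to [algC]. *)
Lemma aut_fixed_rat (z : algC) :
  (forall nu : {rmorphism algC -> algC}, nu z = z) -> exists q : rat, z = ratr q.
Proof.
move=> fixz.
have [q [Dq mq] dv] := minCpolyP z.
have [r Dr] := closed_field_poly_normal (minCpoly z).
rewrite (monicP (minCpoly_monic z)) scale1r in Dr.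
have [Qs [QsC [s Ds gens]]] := num_field_exists r.
pose p : {poly Qs} := map_poly (in_alg Qs) q.
have pC : map_poly QsC p = minCpoly z.
  rewrite Dq /p -map_poly_comp; apply: eq_map_poly => c /=.
  by rewrite alg_num_field fmorph_rat.
have Dp : p = \prod_(y <- s) ('X - y%:P).
  apply: (map_poly_inj QsC); rewrite pC Dr -Ds big_map rmorph_prod.
  by apply: eq_bigr => y _; rewrite rmorphB /= map_polyX map_polyC.
have p1 : p \is a polyOver 1%AS by apply/alg_polyOver.
have spl : splittingFieldFor 1 p {:Qs} by exists s; rewrite // -Dp eqpxx.
have sep : separable_poly p.
  rewrite /p separable_map; apply: irreducible_separable.
  have rz : root (map_poly ratr q) z by rewrite -Dq root_minCpoly.
  by apply/(subfx_irreducibleP rz (monic_neq0 mq)) => t tz nzt; rewrite dvdp_leq // -dv.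
have Qs_ax : FieldExt_isSplittingField _ Qs by constructor; exists p.
pose L : splittingFieldType rat := HB.pack Qs Qs_ax.
have gal : galois 1 {:L} by apply/splitting_galoisField; exists p.
have : z \in r by rewrite -root_prod_XsubC -Dr root_minCpoly.
rewrite -Ds => /mapP[y _ Dz].
have : (y : L) \in fixedField 'Gal({:L} / 1%AS)%g.
  apply/fixedFieldP => [|x _]; first exact: memvf.
  have [nu Dnu] := extend_algC_subfield_aut QsC x.
  by apply: (fmorph_inj QsC); rewrite Dnu -Dz fixz.
move/galois_fixedField: gal => -> /vlineP[c Dy].
by exists c; rewrite Dz Dy; rewrite alg_num_field fmorph_rat.
Qed.

Definition rational_curve (E : ecurve) : Prop := forall nu : aut,
  [/\ nu (ecA E) = ecA E, nu (ecB E) = ecB E & nu (ecC E) = ecC E].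

Section TwistedAction.

Variables (d : rat) (d0 : d != 0).
Let w : algC := sqrtC (ratr d).

Definition chi (nu : aut) : algC := nu w / w.

Lemma w2 : w ^+ 2 = ratr d. Proof. exact: sqrtCK. Qed.

Lemma w_neq0 : w != 0.
Proof. by rewrite sqrtC_eq0 fmorph_eq0. Qed.

Lemma chi2 nu : chi nu ^+ 2 = 1.
Proof.
by rewrite /chi expr_div_n -rmorphXn /= w2 fmorph_rat divff // fmorph_eq0.
Qed.

Lemma chi_sign nu : chi nu = 1 \/ chi nu = -1.
Proof. by have /eqP := chi2 nu; rewrite sqrf_eq1 => /orP[]/eqP; [left|right]. Qed.

Lemma chi_comp (nu mu : aut) : chi (nu \o mu) = chi nu * chi mu.
Proof.
have [e|e] := chi_sign mu; have: mu w = chi mu * w by rewrite /chi divfK ?w_neq0.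
  by move=> h; rewrite {1}/chi /= h e mulr1 mul1r.
by move=> h; rewrite {1}/chi /= h e mulN1r mulrN1 rmorphN mulNr.
Qed.

(* The points of a curve over Q, acted upon this way, are those of its
   quadratic twist by [d] with the ordinary Galois action. *)
Definition actP (nu : aut) (P : option (algC * algC)) : option (algC * algC) :=
  if P is Some (x, y) then Some (nu x, chi nu * nu y) else None.

Section OnCurve.
Variables (E : ecurve) (ratE : rational_curve E).

Lemma actP_on nu (P : pt E) : onE E (actP nu P).
Proof.
have [eA eB eC] := ratE nu; case: P => [[[x y]|]] //= /eqP o; apply/eqP.
rewrite exprMn chi2 mul1r -rmorphXn /= o !(rmorphD, rmorphM, rmorphXn) /=.
by rewrite eA eB eC.
Qed.

Definition act nu (P : pt E) : pt E := Pt (actP_on nu P).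

Lemma actD nu : {morph act nu : P Q / P + Q}.
Proof.
have [eA eB eC] := ratE nu.
move=> P Q; apply: pt_inj; rewrite ptvalD.
have := actP_on nu Q; have := actP_on nu P.
change (onE E (actP nu P) -> onE E (actP nu Q) ->
  actP nu (eadd E P Q) = eadd E (actP nu P) (actP nu Q)).
move: (ptP P) (ptP Q); case: (ptval P) (ptval Q) => [[x1 y1]|] [[x2 y2]|] //.
move=> o1 o2 o1' o2'; case: (eaddE o1 o2) => [-> ->|l [h1 h2]].
  by rewrite /actP rmorphN mulrN eadd_opp.
rewrite /actP in o1' o2' *.
have s : secant (ecA E) (ecB E) (nu x1) (chi nu * nu y1) (nu x2) (chi nu * nu y2)
  (chi nu * nu l).
  split; first by rewrite -mulrBr -rmorphB h1 rmorphM rmorphB; ring.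
  rewrite -mulrDr mulrACA -expr2 chi2 mul1r -rmorphD -rmorphM h2.
  by rewrite !(rmorphD, rmorphM, rmorphXn) /= eA eB.
rewrite (eadd_secant o1' o2' s) /chord; congr (Some (_, _)).
  by rewrite exprMn chi2 mul1r !(rmorphD, rmorphN, rmorphXn) /= eA.
rewrite exprMn chi2 mul1r !(rmorphD, rmorphN, rmorphM, rmorphXn) /= eA.
ring.
Qed.

Lemma actN nu P : act nu (- P) = - act nu P.
Proof. by apply: pt_inj; case: P => [[[x y]|]] //= o; rewrite rmorphN mulrN. Qed.

HB.instance Definition _ nu := GRing.isZmodMorphism.Build (pt E) (pt E) (act nu)
  (fun R S => etrans (actD nu R (- S)) (congr1 _ (actN nu S))).

Lemma act_comp nu mu P : act nu (act mu P) = act (nu \o mu) P.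
Proof.
apply: pt_inj; case: P => [[[x y]|]] //= o; rewrite chi_comp rmorphM.
congr (Some (_, _)); rewrite mulrA; congr (_ * _).
by have [->|->] := chi_sign mu; rewrite ?rmorphN rmorph1.
Qed.

End OnCurve.
End TwistedAction.

Lemma ratr_eq (x y : rat) : (ratr x = ratr y :> algC) -> x = y.
Proof. exact: fmorph_inj. Qed.

Lemma wadd_secant (A B C x1 y1 x2 y2 : rat) (E := WCurve 0 A 0 B C) :
  on_curve E (Some (x1, y1)) -> on_curve E (Some (x2, y2)) ->
  (x1 == x2) && (y1 + y2 == 0) = false ->
  exists l : rat, [/\ y1 - y2 = l * (x1 - x2),
    l * (y1 + y2) = x1 ^+ 2 + x1 * x2 + x2 ^+ 2 + A * (x1 + x2) + B &
    let x3 := l ^+ 2 - A - x1 - x2 in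
    wadd E (Some (x1, y1)) (Some (x2, y2)) = Some (x3, - (l * (x3 - x1) + y1))].
Proof.
rewrite /on_curve /= !mul0r !addr0 => o1 o2 /negbT nopp.
rewrite (negPf nopp); move: nopp; have [e /= ny|nx _] := eqVneq x1 x2; last first.
  have nz : x2 - x1 != 0 by rewrite subr_eq0 eq_sym.
  exists ((y2 - y1) / (x2 - x1)); split.
  - by field.
  - apply: (mulIf nz).
    have -> : (y2 - y1) / (x2 - x1) * (y1 + y2) * (x2 - x1) = y2 ^+ 2 - y1 ^+ 2 by field.
    by rewrite o1 o2; ring.
  - by rewrite ?mul0r ?addr0; congr (Some (_, _)); field.
subst x2.
have ey : y1 = y2.
  apply/eqP; rewrite -subr_eq0.
  have : (y1 - y2) * (y1 + y2) = 0 by rewrite -subr_sqr o1 o2 subrr.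
  by move/eqP; rewrite mulf_eq0 (negPf ny) orbF.
subst y2; have ny1 : y1 != 0 by apply: contraNneq ny => ->; rewrite addr0.
exists ((3 * x1 ^+ 2 + 2 * A * x1 + B) / (2 * y1)); split; rewrite ?subrr ?mulr0 //.
  by field.
rewrite ?mul0r ?addr0; congr (Some (_, _)).
(* The tangent intercept in [wadd] contains a6, which the curve equation removes. *)
have eC : C = y1 ^+ 2 - x1 ^+ 3 - A * x1 ^+ 2 - B * x1 by rewrite o1; ring.
by rewrite eC; field.
Qed.

Section Embedding.

Variables (a b d : rat) (dE : dab a b = d) (a0 : a != 0) (d0 : d != 0).
Hypothesis aD : a ^+ 2 - 11 * a - 1 != 0.

Local Notation w := (sqrtC (ratr d) : algC).
Local Notation ac := (ratr a : algC).

Lemma ac0 : ac != 0. Proof. by rewrite fmorph_eq0. Qed.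
Lemma acD : ac ^+ 2 - 11 * ac - 1 != 0.
Proof.
have -> : ac ^+ 2 - 11 * ac - 1 = ratr (a ^+ 2 - 11 * a - 1).
  by ring.
by rewrite fmorph_eq0.
Qed.

Definition CW := W ac0 acD.
Definition CWst := Wst ac0 acD.

Lemma rational_CW : rational_curve CW.
Proof.
move=> nu; have := fmorph_rat nu a; rewrite /=; move: ac => c e.
by split; rewrite !(rmorph_nat, rmorph1, rmorphD, rmorphN, rmorphM, rmorphXn) /= e.
Qed.

Lemma rational_CWst : rational_curve CWst.
Proof.
move=> nu; have := fmorph_rat nu a; rewrite /=; move: ac => c e.
by split; rewrite !(rmorph_nat, rmorph1, rmorphD, rmorphN, rmorphM, rmorphXn) /= e.
Qed.

(** The isomorphism over Q(sqrt d) from E_{a,b} to W: abscissae are divided by d and ordinates by d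
    sqrt d. *)
Definition embP (P : point) : option (algC * algC) :=
  if P is Some (x, y) then Some (ratr (x / d), ratr (y / d) / w) else None.

Lemma embP_on P : on_curve (Eab a b) P <-> onE CW (embP P).
Proof.
case: P => [[x y]|] //; rewrite /Eab dE /= !mul0r !addr0 expr_div_n w2.
have -> : (ratr (y / d) : algC) ^+ 2 / ratr d = ratr ((y / d) ^+ 2 / d).
  by rewrite -rmorphXn -fmorph_div.
pose r := (x / d) ^+ 3 + (a ^+ 2 - 30 * a + 1) * (x / d) ^+ 2
  + - 8 * a * (3 * a + 1) * (4 * a - 7) * (x / d)
  + - 16 * a * (4 * a ^+ 4 - 4 * a ^+ 3 - 40 * a ^+ 2 + 91 * a - 4).
set R := (X in _ == X).
have -> : R = ratr r.
  by rewrite /R /r; field; rewrite fmorph_eq0.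
have d3 : d ^+ 3 != 0 by rewrite expf_neq0.
have er : x ^+ 3 + d * (a ^+ 2 - 30 * a + 1) * x ^+ 2 +
  - 8 * d ^+ 2 * a * (3 * a + 1) * (4 * a - 7) * x +
  - 16 * d ^+ 3 * a * (4 * a ^+ 4 - 4 * a ^+ 3 - 40 * a ^+ 2 + 91 * a - 4) = r * d ^+ 3.
  by rewrite /r; field.
rewrite er; split=> [e|/eqP/ratr_eq <-]; last by field.
by apply/eqP; congr ratr; apply: (mulIf d3); rewrite -e; field.
Qed.

Lemma wneg_embP P : embP (wneg (Eab a b) P) = eneg (embP P).
Proof.
case: P => [[x y]|] //=; congr (Some (_, _)).
by rewrite !mul0r !subr0 !mulNr rmorphN mulNr.
Qed.

Lemma wadd_embP P Q : on_curve (Eab a b) P -> on_curve (Eab a b) Q ->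
  embP (wadd (Eab a b) P Q) = eadd CW (embP P) (embP Q).
Proof.
case: P Q => [[x1 y1]|] [[x2 y2]|] // o1 o2.
have /embP_on c1 := o1; have /embP_on c2 := o2.
have wq : ratr d = w ^+ 2 :> algC by rewrite w2.
have w0 : w != 0 by apply: w_neq0.
case opp: ((x1 == x2) && (y1 + y2 == 0)).
  rewrite /wadd /= !mul0r !addr0 opp; case/andP: opp => /eqP-> /eqP e.
  have -> : y2 = - y1 by apply/eqP; rewrite -addr_eq0 addrC e.
  by rewrite mulNr rmorphN mulNr eqxx subrr eqxx.
have := wadd_secant (A := wa2 (Eab a b)) (B := wa4 (Eab a b)) (C := wa6 (Eab a b)) o1 o2 opp.
rewrite -[WCurve _ _ _ _ _]/(Eab a b) => -[l [h1 h2 ->]].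
rewrite /Eab dE /= in h1 h2.
have dC : ratr d != 0 :> algC by rewrite fmorph_eq0.
have s : secant (ecA CW) (ecB CW) (ratr (x1 / d)) (ratr (y1 / d) / w)
    (ratr (x2 / d)) (ratr (y2 / d) / w) (ratr l / w).
  split=> /=.
    rewrite -mulrBl -!rmorphB -!mulrBl h1 [RHS]mulrAC -rmorphM.
    by congr (ratr _ / _); ring.
  rewrite -mulrDl mulrACA -invfM -expr2 w2 -rmorphD -mulrDl -rmorphM mulrA h2.
  by field.
rewrite (eadd_secant c1 c2 s) /chord /Eab dE /=.
have -> : (ratr l / w) ^+ 2 = ratr (l ^+ 2 / d) by rewrite expr_div_n w2; field.
set X := (X in _ = Some (X, _)); set x3 := (X in Some (ratr (X / d), _)).
have -> : X = ratr (x3 / d) by rewrite /X /x3; field.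
by congr (Some (_, _)); field; rewrite w0 dC.
Qed.

Lemma wadd_on P Q : on_curve (Eab a b) P -> on_curve (Eab a b) Q ->
  on_curve (Eab a b) (wadd (Eab a b) P Q).
Proof.
by move=> oP oQ; apply/embP_on; rewrite wadd_embP //; apply: onE_add; apply/embP_on.
Qed.

Lemma wneg_on P : on_curve (Eab a b) P -> on_curve (Eab a b) (wneg (Eab a b) P).
Proof. by move=> oP; apply/embP_on; rewrite wneg_embP onE_neg; apply/embP_on. Qed.

Lemma embP_inj : injective embP.
Proof.
have w0 : w != 0 by apply: w_neq0.
have dV : d^-1 != 0 by rewrite invr_eq0.
move=> [[x y]|] [[x' y']|] //= [/ratr_eq/(mulIf dV)-> e].
by move/(mulIf (invr_neq0 w0))/ratr_eq/(mulIf dV): e => ->.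
Qed.

(** Points off the curve go to 0, which is why [act_emb] carries no hypothesis on the point. *)
Definition emb (P : point) : pt CW := insubd (pt0 CW) (embP P).

Lemma embE P : on_curve (Eab a b) P -> ptval (emb P) = embP P.
Proof. by move=> /embP_on oP; rewrite /emb [LHS]insubdK. Qed.

Lemma emb_inj P Q : on_curve (Eab a b) P -> on_curve (Eab a b) Q ->
  emb P = emb Q -> P = Q.
Proof. by move=> oP oQ /(congr1 (@ptval _)); rewrite !embE // => /embP_inj. Qed.

Lemma emb0 : emb None = 0.
Proof. by apply: pt_inj; rewrite embE. Qed.

Lemma embD P Q : on_curve (Eab a b) P -> on_curve (Eab a b) Q ->
  emb (wadd (Eab a b) P Q) = emb P + emb Q.
Proof.
move=> oP oQ; apply: pt_inj.
by rewrite ptvalD (embE (wadd_on oP oQ)) wadd_embP // !embE.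
Qed.

Lemma embB P Q : on_curve (Eab a b) P -> on_curve (Eab a b) Q ->
  emb (wsub (Eab a b) P Q) = emb P - emb Q.
Proof.
move=> oP oQ; rewrite /wsub (embD oP (wneg_on oQ)); congr (_ + _); apply: pt_inj.
by rewrite ptvalN (embE (wneg_on oQ)) embE // wneg_embP.
Qed.

Lemma wsub_on P Q : on_curve (Eab a b) P -> on_curve (Eab a b) Q ->
  on_curve (Eab a b) (wsub (Eab a b) P Q).
Proof. by move=> oP oQ; apply: wadd_on => //; apply: wneg_on. Qed.

Lemma wmul_on n P : on_curve (Eab a b) P -> on_curve (Eab a b) (wmul (Eab a b) n P).
Proof. by move=> oP; elim: n => [|n IH] //=; apply: wadd_on. Qed.

Lemma embM n P : on_curve (Eab a b) P -> emb (wmul (Eab a b) n P) = emb P *+ n.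
Proof.
move=> oP; elim: n => [|n IH]; first by rewrite emb0.
by rewrite [wmul _ _ _]/= (embD oP (wmul_on n oP)) IH mulrS.
Qed.

Local Notation act := (act d0).

(** Invariance under the twisted action makes x and y sqrt d fixed by all automorphisms, hence
    rational. *)
Lemma act_fixedP (E : ecurve) (ratE : rational_curve E) (R : pt E) :
  (forall nu, act ratE nu R = R) <->
  ptval R = None \/ exists q r, ptval R = Some (ratr q, ratr r / w).
Proof.
have w0 : w != 0 by apply: w_neq0.
split=> [fixR|e nu].
  case: R fixR => [[[x y]|]] o fixR; [right | by left].
  have [q eq] : exists q : rat, x = ratr q.
    by apply: aut_fixed_rat => nu; have /(congr1 (@ptval _))[] := fixR nu.
  have [r er] : exists r : rat, y * w = ratr r.
    apply: aut_fixed_rat => nu; have /(congr1 (@ptval _))[_ {2}<-] := fixR nu.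
    by rewrite /chi rmorphM mulrAC divfK // mulrC.
  by exists q, r; rewrite /= -eq -er mulfK.
apply: pt_inj; rewrite /act [LHS]/=; case: e => [->|[q [r ->]]] //=.
congr (Some (_, _)); first exact: fmorph_rat.
rewrite fmorph_div fmorph_rat /chi; move: (ratr r) => z.
by field; rewrite ?fmorph_eq0 ?w0.
Qed.

Lemma act_emb nu P : act rational_CW nu (emb P) = emb P.
Proof.
move: nu; apply/act_fixedP; have [/embP_on oP|nP] := boolP (onE CW (embP P)); last first.
  by left; rewrite /emb /insubd insubN.
rewrite embE //; case: P {oP} => [[x y]|]; [right | by left].
by exists (x / d), (y / d).
Qed.

(** The map f* followed by the passage to the short model, U = 4 x'. The factors 25 and 125 are the
    squared and cubed scaling by 5 between E*_{a,b} and the twist of W*. *)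
Definition embstP (P : point) : option (algC * algC) :=
  if P is Some (x, y) then
    Some (ratr (x / (25 * d) - 8 * (a ^+ 2 - 5 * a + 1) / 25), ratr (y / (125 * d)) / w)
  else None.

Lemma embstP_on P : on_curve (Estab a b) P <-> onE CWst (embstP P).
Proof.
case: P => [[x y]|]; last by split.
rewrite /on_curve /Estab dE /onE /embstP; cbn [wa1 wa2 wa3 wa4 wa6].
set L := (X in _ = X <-> _).
have -> : y ^+ 2 + 0 * x * y + 0 * y = y ^+ 2 by ring.
have : L = L by []; rewrite {2}/L; move: (L) => L' eL; rewrite expr_div_n w2.
set U := _ / _ - _.
have -> : (ratr (y / (125 * d)) : algC) ^+ 2 / ratr d = ratr ((y / (125 * d)) ^+ 2 / d).
  by rewrite -rmorphXn -fmorph_div.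
pose r := U ^+ 3 + (a ^+ 2 - 6 * a + 1) * U ^+ 2 + 8 * a * (a - 1) * U + 16 * a ^+ 2.
set R := (X in _ == X).
have -> : R = ratr r by rewrite /R /r /=; ring.
have d3 : 5 ^+ 6 * d ^+ 3 != 0 by rewrite mulf_neq0 // expf_neq0.
have -> : L' = r * (5 ^+ 6 * d ^+ 3) by rewrite eL /r /U; field.
split=> [e|/eqP/ratr_eq <-]; last by field.
by apply/eqP; congr ratr; apply: (mulIf d3); rewrite -e; field.
Qed.

Lemma Nlam_horner (t : rat) : (Nlam a).[t] =
  t ^+ 5 - 2 * a * t ^+ 4 + a * (a ^+ 2 + 3 * a - 1) * t ^+ 3
  - 3 * a ^+ 2 * (a - 1) * t ^+ 2 + a ^+ 3 * (a - 3) * t + a ^+ 4.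
Proof. by rewrite /Nlam !(hornerD, hornerN, hornerM, hornerXn, hornerX, hornerC). Qed.

Lemma dNlam_horner (t : rat) : (Nlam a)^`().[t] =
  5 * t ^+ 4 - 8 * a * t ^+ 3 + 3 * a * (a ^+ 2 + 3 * a - 1) * t ^+ 2
  - 6 * a ^+ 2 * (a - 1) * t + a ^+ 3 * (a - 3).
Proof.
rewrite /Nlam !(derivD, derivN, derivM, derivXn, derivX, derivC) /=.
rewrite !(hornerD, hornerN, hornerM, hornerMn, hornerXn, hornerX, hornerC) /=.
by ring.
Qed.

Lemma Dlam_horner (t : rat) : (Dlam a).[t] = t ^+ 2 * (t - a) ^+ 2.
Proof.
by rewrite /Dlam !(hornerD, hornerN, hornerM, horner_exp, hornerXn, hornerX, hornerC).
Qed.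

Lemma dDlam_horner (t : rat) :
  (Dlam a)^`().[t] = 2 * t * (t - a) ^+ 2 + 2 * t ^+ 2 * (t - a).
Proof.
rewrite /Dlam !(derivD, derivN, derivM, derivXn, derivX, derivC, derivE) /=.
rewrite !(hornerD, hornerN, hornerM, hornerMn, horner_exp, hornerXn, hornerX, hornerC) /=.
by ring.
Qed.

Lemma phistar_embP Q : embP (phistar a b Q) = lamP ac (embstP Q).
Proof.
case: Q => [[x y]|] //; rewrite /phistar dE Dlam_horner Nlam_horner dNlam_horner dDlam_horner.
set t := x / (100 * d) - _; rewrite /embstP /lamP.
have -> : x / (25 * d) - 8 * (a ^+ 2 - 5 * a + 1) / 25 = 4 * t by rewrite /t; field.
have -> : Ker ac (ratr (4 * t)) = ratr (16 * t * (t - a)) by rewrite /Ker; ring.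
rewrite fmorph_eq0.
have -> : (t ^+ 2 * (t - a) ^+ 2 == 0) = (16 * t * (t - a) == 0).
  by rewrite [LHS]mulf_eq0 !sqrf_eq0 [in RHS]mulf_eq0 [in RHS]mulf_eq0.
case: ifP => // /negbT; rewrite !mulf_eq0 !negb_or => /andP[/andP[_ t0] t1].
have t0' : ratr t != 0 :> algC by rewrite fmorph_eq0.
have t1' : ratr t - ac != 0 by rewrite -rmorphB fmorph_eq0.
have t2' : 4 * ratr t - 4 * ac != 0 by rewrite -mulrBr mulf_neq0 // pnatr_eq0.
have dC : ratr d != 0 :> algC by rewrite fmorph_eq0.
rewrite /embP /lamx /lamy; congr (Some (_, _)).
  by field; do ?[apply/andP; split=> //].
have w0 : w != 0 by apply: w_neq0.
by field; do ?[apply/andP; split=> //].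
Qed.

Lemma in_imageP P : on_curve (Eab a b) P -> (in_image a b P <->
  exists2 R : pt CWst, (forall nu, act rational_CWst nu R = R) & lam R = emb P).
Proof.
move=> oP; split=> [[Q [oQ eQ]]|[R fixR eR]].
  have oQ' := (embstP_on Q).1 oQ; exists (Pt oQ').
    apply/act_fixedP; case: Q {oQ eQ} oQ' => [[x y]|] ?; [right | by left].
    by eexists; eexists.
  by apply: pt_inj; rewrite embE // -eQ phistar_embP.
have [Q oQ eQ] : exists2 Q, on_curve (Estab a b) Q & embstP Q = ptval R.
  move/act_fixedP: fixR => [e|[q [r e]]]; first by exists None; rewrite // e.
  pose Q := Some (25 * d * (q + 8 * (a ^+ 2 - 5 * a + 1) / 25), 125 * d * r).
  have eQ : embstP Q = ptval R.
    by rewrite e /=; congr (Some (ratr _, ratr _ / _)); field.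
  by exists Q => //; apply/embstP_on; rewrite eQ; apply: ptP.
exists Q; split=> //; apply: embP_inj.
by rewrite phistar_embP eQ -(embE oP) -eR.
Qed.
End Embedding.

(** * Fibres of the isogeny and their cocycles with values in Z/5 *)

Fixpoint autn (nu : aut) (n : nat) : aut :=
  if n is n'.+1 then nu \o autn nu n' else idfun.

Lemma expn4_mod5 i : ~~ (5 %| i)%N -> (i ^ 4 = 1 %[mod 5])%N.
Proof.
rewrite -modnXm /dvdn; have : (i %% 5 < 5)%N by rewrite ltn_mod.
by case: (i %% 5)%N => [|[|[|[|[|]]]]].
Qed.

Section Fibres.

Variables (a d : rat) (a0 : a != 0) (d0 : d != 0).
Hypothesis aD : a ^+ 2 - 11 * a - 1 != 0.

Local Notation w := (sqrtC (ratr d) : algC).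
Local Notation ac := (ratr a : algC).
Local Notation CW := (CW a0 aD).
Local Notation CWst := (CWst a0 aD).
Local Notation actw := (act d0 (rational_CW a0 aD)).
Local Notation acts := (act d0 (rational_CWst a0 aD)).
Local Notation chi := (chi d).
Local Notation T := (T (ac0 a0) (acD aD)).

Implicit Types (R S : pt CWst) (P Q : pt CW) (nu mu : aut).

Lemma act_lam nu R : lam (acts nu R) = actw nu (lam R).
Proof.
have e : nu ac = ac by rewrite fmorph_rat.
apply: pt_inj; case: R => [[[U V]|]] o //.
rewrite [LHS]/= [RHS]/=.
have -> : Ker ac (nu U) = nu (Ker ac U) by rewrite /Ker -[in LHS]e; ring.
rewrite fmorph_eq0; case: ifP => //= /negbT K0.
have [U0 U1] := KerP K0.
have U0' : nu U != 0 by rewrite fmorph_eq0.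
have U1' : nu U - 4 * nu ac != 0.
  by rewrite -[4](rmorph_nat nu) -rmorphM -rmorphB fmorph_eq0.
rewrite /lamx /lamy; congr (Some (_, _)); move: e U0 U1 U0' U1' => e.
  by rewrite -[X in X = _]/(_ : algC) -[in LHS]e => *; field; do ?[apply/andP; split=> //].
by rewrite -[in LHS]e => *; field; do ?[apply/andP; split=> //].
Qed.

Lemma act_T nu : acts nu T = if chi nu == 1 then T else - T.
Proof.
apply: pt_inj; have e : nu (4 * ac) = 4 * ac by rewrite rmorphM rmorph_nat fmorph_rat.
have -> : ptval (acts nu T) = Some (0, chi nu * (4 * ac)) by rewrite /= e rmorph0.
case: ifP => [/eqP->|/eqP n]; first by rewrite mul1r.
by have [//|->] := chi_sign d0 nu; rewrite mulN1r.
Qed.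

Lemma act_T1 nu n : chi nu = 1 -> acts nu (T *+ n) = T *+ n.
Proof. by move=> e; rewrite raddfMn /= act_T e eqxx. Qed.

Lemma act_TN nu n : chi nu <> 1 -> acts nu (T *+ n) = - (T *+ n).
Proof. by move=> /eqP/negPf e; rewrite raddfMn /= act_T e mulNrn. Qed.

Lemma T_neq0 : T != 0. Proof. by rewrite -val_eqE. Qed.

Lemma Tmod i j : (i = j %[mod 5])%N -> T *+ i = T *+ j.
Proof.
move=> e; rewrite (divn_eq i 5) (divn_eq j 5) e !mulrnDr.
by rewrite !(mulnC _ 5%N) !mulrnA T5 !mul0rn.
Qed.

Lemma Tn_eq0 i : (T *+ i == 0) = (5 %| i)%N.
Proof.
apply/idP/idP => [|/dvdnP[k ->]]; last by rewrite mulnC mulrnA T5 mul0rn.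
apply: contraLR => /expn4_mod5 e; apply: contraNneq T_neq0 => Ti.
by rewrite -[T]mulr1n -(Tmod e) expnS mulrnA Ti mul0rn.
Qed.

Lemma fibreP R S : lam R = lam S -> exists i, S = R + T *+ i.
Proof.
move=> e; have /lam_eq0P[i h] : lam (S - R) == 0 by rewrite raddfB /= e subrr.
by exists i; rewrite -h addrC subrK.
Qed.

Definition fixedw P := forall nu, actw nu P = P.
Definition fixeds R := forall nu, acts nu R = R.
Definition Himage P := exists2 R, fixeds R & lam R = P.

Lemma fixedwB P Q : fixedw P -> fixedw Q -> fixedw (P - Q).
Proof. by move=> h h' nu; rewrite raddfB /= h h'. Qed.

Lemma fixedwMn P n : fixedw P -> fixedw (P *+ n).
Proof. by move=> h nu; rewrite raddfMn /= h. Qed.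

Lemma Himage0 : Himage 0.
Proof. by exists 0; [move=> nu; rewrite raddf0 | rewrite raddf0]. Qed.

Lemma HimageB P Q : Himage P -> Himage Q -> Himage (P - Q).
Proof.
move=> [R fR <-] [S fS <-]; exists (R - S); last by rewrite raddfB.
by move=> nu; rewrite raddfB /= fR fS.
Qed.

Lemma HimageN P : Himage P -> Himage (- P).
Proof. by move=> h; rewrite -[- P]add0r; apply: HimageB => //; apply: Himage0. Qed.

Lemma HimageD P Q : Himage P -> Himage Q -> Himage (P + Q).
Proof. by move=> h h'; rewrite -[Q]opprK; apply: HimageB => //; apply: HimageN. Qed.

Lemma HimageMn P n : Himage P -> Himage (P *+ n).
Proof.
move=> h; elim: n => [|n IH]; first exact: Himage0.
by rewrite mulrS; apply: HimageD.
Qed.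

Lemma cocycle R nu : fixedw (lam R) -> exists i, acts nu R = R + T *+ i.
Proof. by move=> fP; apply: fibreP; rewrite act_lam fP. Qed.

(** If P = lam R then 5R is a fixed point above 5P, because the cocycle of R takes its values in the
    multiples of T, which 5 kills. *)
Lemma Himage5 P : fixedw P -> Himage (P *+ 5).
Proof.
have [R <-] := lam_surj P => fP; exists (R *+ 5); last by rewrite raddfMn.
move=> nu; have [i e] := cocycle nu fP.
by rewrite raddfMn /= e mulrnDl -mulrnA mulnC mulrnA T5 mul0rn addr0.
Qed.

(** The quotient by the image is killed by 5, and n^3 is an inverse of n modulo 5. *)
Lemma Himage_coprime P n : fixedw P -> ~~ (5 %| n)%N -> Himage (P *+ n) -> Himage P.
Proof.
move=> fP n5 h.
have e : (n * n ^ 3 = (n ^ 4 %/ 5) * 5 + 1)%N.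
  by rewrite -expnS [LHS](divn_eq _ 5) (expn4_mod5 n5).
have -> : P = P *+ n *+ n ^ 3 - P *+ 5 *+ (n ^ 4 %/ 5).
  by rewrite -!mulrnA e mulnC mulrnDr addrAC subrr add0r.
by apply: HimageB; apply: HimageMn => //; apply: Himage5.
Qed.

Lemma chi_autn nu n : chi nu = 1 -> chi (autn nu n) = 1.
Proof.
move=> e; elim: n => [|n IH]; last by rewrite /= chi_comp // e IH mulr1.
by rewrite /chi divff ?w_neq0.
Qed.

Lemma act_autn nu n R i : chi nu = 1 -> acts nu R = R + T *+ i ->
  acts (autn nu n) R = R + T *+ (i * n).
Proof.
move=> c e; elim: n => [|n IH].
  rewrite muln0 addr0; apply: pt_inj; case: R {e} => [[[x y]|]] o //=.
  by rewrite /chi divff ?w_neq0 // mul1r.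
rewrite /= -act_comp IH raddfD /= e act_T1 // -addrA -mulrnDr.
by rewrite mulnS.
Qed.

Lemma autn_root (z : algC) nu n (u : nat) : nu z = z ^+ u -> autn nu n z = z ^+ (u ^ n).
Proof.
by move=> e; elim: n => [|n IH] //=; rewrite IH rmorphXn /= e -exprM expnS.
Qed.

(* On automorphisms fixing w the cocycle of R is a homomorphism to Z/5; it
   vanishes because its fourth multiple does, and a suitable translate of R by
   T is then fixed by the remaining automorphisms, which negate T. *)
Lemma descent (z : algC) R : 5.-primitive_root z -> fixedw (lam R) ->
  (forall nu, chi nu = 1 -> nu z = z -> acts nu R = R) -> Himage (lam R).
Proof.
move=> pz fP fz.
have fw nu : chi nu = 1 -> acts nu R = R.
  move=> c; have [i e] := cocycle nu fP.
  have nz5 : nu z ^+ 5 = 1 by rewrite -rmorphXn /= prim_expr_order // rmorph1.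
  have [[u /= _] eu] := prim_rootP pz nz5.
  have u5 : ~~ (5 %| u)%N.
    apply/negP => /dvdnP[k ek]; have /eqP : nu z = 1.
      by rewrite eu ek mulnC exprM (prim_expr_order pz) expr1n.
    rewrite fmorph_eq1 => /eqP z1.
    by have := prim_order_dvd pz 1; rewrite expr1 z1 eqxx.
  have z4 : z ^+ (u ^ 4) = z.
    rewrite -[RHS]expr1; apply/eqP; rewrite (eq_prim_root_expr pz).
    exact/eqP/expn4_mod5.
  have := fz (autn nu 4) (chi_autn 4 c); rewrite (autn_root 4 eu) z4.
  move=> /(_ erefl); rewrite (act_autn 4 c e) => /eqP.
  rewrite -subr_eq0 addrAC subrr add0r Tn_eq0 Euclid_dvdM // orbF => /dvdnP[k ek].
  by rewrite e ek mulnC mulrnA T5 mul0rn addr0.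
have [[mu c]|h] := classic (exists mu, chi mu <> 1); last first.
  exists R => // nu; apply: fw; apply: NNPP => c; apply: h; exists nu; exact: c.
have [i e] := cocycle mu fP.
(* [mu] sends R + cT to R + (i - c)T, so c must be i / 2, which is 3i modulo 5. *)
exists (R + T *+ (3 * i)); last by rewrite lamDTn.
move=> nu; have [c1|c1] := classic (chi nu = 1); first by rewrite raddfD /= fw // act_T1.
have [j ej] := cocycle nu fP.
have c2 : chi (mu \o nu) = 1.
  by rewrite chi_comp //; have [//|->] := chi_sign d0 mu; have [//|->] := chi_sign d0 nu;
    rewrite mulrNN mulr1.
have Tij : T *+ j = T *+ i.
  have := fw _ c2; rewrite -act_comp ej raddfD /= e act_TN // -addrA => /eqP.
  by rewrite -subr_eq0 addrAC subrr add0r subr_eq0 => /eqP.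
rewrite raddfD /= ej act_TN // Tij -addrA; congr (_ + _).
by apply/eqP; rewrite -subr_eq0 -addrA -opprD -mulrnDr subr_eq0; apply/eqP/Tmod; lia.
Qed.
End Fibres.

(** * Roots of the Brumer quintic and splitting fields *)

Lemma BruE a b : Bru a b =
  Poly [:: a; b; a ^+ 2 - a - 2 * b - 1; - (a - b - 3); a - 3; 1].
Proof. by rewrite /= !cons_poly_def /Bru; ring. Qed.

Lemma size_Bru a b : size (Bru a b) = 6%N.
Proof. by rewrite BruE (@PolyK _ 0) //= oner_eq0. Qed.

Lemma Bru_horner (a b : rat) (z : algC) : (map_poly ratr (Bru a b)).[z] =
  z ^+ 5 + (ratr a - 3) * z ^+ 4 - (ratr a - ratr b - 3) * z ^+ 3
  + (ratr a ^+ 2 - ratr a - 2 * ratr b - 1) * z ^+ 2 + ratr b * z + ratr a.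
Proof. by rewrite BruE map_Poly horner_Poly [map _ _]/= [LHS]/=; ring. Qed.

Section BruFibres.

Variables (a b d : rat) (dE : dab a b = d) (a0 : a != 0) (d0 : d != 0).
Hypothesis aD : a ^+ 2 - 11 * a - 1 != 0.

Local Notation w := (sqrtC (ratr d) : algC).
Local Notation ac := (ratr a : algC).
Local Notation CW := (CW a0 aD).
Local Notation CWst := (CWst a0 aD).
Local Notation actw := (act d0 (rational_CW a0 aD)).
Local Notation acts := (act d0 (rational_CWst a0 aD)).
Local Notation chi := (chi d).
Local Notation T := (T (ac0 a0) (acD aD)).
Local Notation emb := (emb d a0 aD).
Local Notation Himage := (@Himage a d a0 d0 aD).

Implicit Types (R S : pt CWst) (P Q : pt CW) (nu mu : aut) (p q : point).

(** The origin of the roots 4a / U: under U = 4a / z the equation [lamx U = u] turns into the Brumer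
    quintic with second parameter -u / 4, and u = x(P) / d gives exactly Bru(P; X). *)
Lemma Bru_lamx b' z : z != 0 -> (lamx_poly ac (ratr (- 4 * b'))).[4 * ac / z] * z ^+ 5
  = 2 ^+ 10 * ac ^+ 4 * (map_poly ratr (Bru a b')).[z].
Proof. by move=> z0; rewrite Bru_horner horner_Poly /=; field. Qed.

Lemma fibre_coords p R : on_curve (Eab a b) p -> p <> None -> lam R = emb p ->
  exists U V, ptval R = Some (U, V) /\ Ker ac U != 0.
Proof.
move=> op np e; have R0 : lam R != 0.
  rewrite e; apply/eqP => /(congr1 (@ptval _)); rewrite (embE dE) //.
  by case: (p) np => [[]|].
case: R R0 {e} => [[[U V]|]] o; last by move=> /eqP[]; apply: pt_inj.
rewrite -val_eqE => K0; exists U, V; split=> //.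
by apply: contra K0 => /= ->.
Qed.

Lemma root_BruP p z : on_curve (Eab a b) p -> p <> None ->
  root (map_poly ratr (BruP a b p)) z <->
  exists R U V, [/\ lam R = emb p, ptval R = Some (U, V) & z = 4 * ac / U].
Proof.
have ac0 : ac != 0 := ac0 a0; have ac4 : 4 * ac != 0 by rewrite mulf_neq0 ?pnatr_eq0.
move=> op; case: p op => [[x y]|] // op _; rewrite /BruP dE.
have eu : - 4 * (x / (- 4 * d)) = x / d by field.
have eP := embE dE a0 d0 aD op.
split=> [r0|[R [U [V [eR eRU ->]]]]].
  have z0 : z != 0.
    apply: contraTneq r0 => ->; rewrite /root Bru_horner.
    by rewrite !expr0n /= !mulr0 !(add0r, addr0, subr0, oppr0).
  have := Bru_lamx (x / (- 4 * d)) z0; rewrite (rootP r0) mulr0 eu => /eqP.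
  rewrite mulf_eq0 expf_eq0 (negPf z0) orbF => /(root_lamx_poly ac0)[K0 eU].
  have [R [V [eR eRP]]] := lam_lift eP K0 eU.
  exists R, (4 * ac / z), V; split=> //; field; by rewrite z0 ac0.
have ne : Some (x, y) <> None by [].
have [U' [V' [e K0]]] := fibre_coords op ne eR.
move: e; rewrite eRU => -[e1 e2]; subst U' V'.
have [U0 _] := KerP K0.
have z0 : 4 * ac / U != 0 by rewrite mulf_neq0 ?invr_eq0.
have := Bru_lamx (x / (- 4 * d)) z0; rewrite eu.
have -> : 4 * ac / (4 * ac / U) = U by field; rewrite U0 ac0.
have := congr1 (@ptval _) eR; rewrite eP.
have -> : ptval (lam R) = Some (lamx ac U, lamy ac U V) by rewrite /= eRU /= (negPf K0).
move=> [eU _]; rewrite lamx_polyE // eU subrr !mul0r => /esym/eqP.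
by rewrite mulf_eq0 mulf_eq0 !expf_eq0 pnatr_eq0 (negPf ac0).
Qed.

Lemma same_x (E : ecurve) (P Q : pt E) x y y' :
  ptval P = Some (x, y) -> ptval Q = Some (x, y') -> P = Q \/ P = - Q.
Proof.
move=> eP eQ; have := ptP P; have := ptP Q; rewrite eP eQ => oQ oP.
have [e|ny] := eqVneq (y + y') 0.
  right; apply: pt_inj; rewrite ptvalN eP eQ /=; congr (Some (_, _)).
  by apply/eqP; rewrite -addr_eq0 e.
by left; apply: pt_inj; rewrite eP eQ (onE_same_x oP oQ ny).
Qed.

(** Two points of a fibre with the same abscissa are equal or opposite; if opposite, the point P
    below them satisfies P = -P. *)
Lemma fibre_x_inj R i j U V V' : lam R *+ 2 != 0 ->
  ptval (R + T *+ i) = Some (U, V) -> ptval (R + T *+ j) = Some (U, V') ->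
  (i = j %[mod 5])%N.
Proof.
move=> P2 ei ej; have [e|e] := same_x ei ej.
  have eT : T *+ i = T *+ j by apply: addrI e.
  have /eqP : T *+ (i + 4 * j) = 0.
    by rewrite mulrnDr eT -mulrnDr; apply/eqP; rewrite Tn_eq0; lia.
  by rewrite Tn_eq0; lia.
case/eqP: P2; have := congr1 (fun S => lam S) e; rewrite /= raddfN /= !lamDTn => {}e.
by rewrite mulr2n {1}e addNr.
Qed.

(* The automorphism nu permutes the five roots of Bru(P) cyclically. *)
Lemma Bru_irreducible p R nu : on_curve (Eab a b) p -> p <> None -> lam R = emb p ->
  emb p *+ 2 != 0 -> chi nu = 1 -> acts nu R <> R -> irreducible_poly (BruP a b p).
Proof.
move=> op np eR P2 c nR.
have fP : fixedw d0 (lam R) by rewrite eR => mu; apply: (act_emb dE).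
have [i ei] := cocycle nu fP.
have i5 : ~~ (5 %| i)%N.
  by apply/negP => i5; apply: nR; rewrite ei; move: i5; rewrite -(Tn_eq0 a0 aD) => /eqP->; rewrite addr0.
have sB : size (BruP a b p) = 6%N by case: (p) np => [[x y]|] // _; apply: size_Bru.
split=> [|q sq dq]; first by rewrite sB.
have B0 : BruP a b p != 0 by rewrite -size_poly_eq0 sB.
have q0 : q != 0 by apply: contraTneq dq => ->; rewrite dvd0p.
pose qC : {poly algC} := map_poly ratr q.
have qC0 : qC != 0 by rewrite map_poly_eq0.
have : size qC != 1%N by rewrite size_map_poly.
move=> /closed_rootP[z rz].
have : root (map_poly ratr (BruP a b p)) z.
  by apply: (@root_dvdp _ qC) rz; rewrite /qC dvdp_map.
move=> /(root_BruP _ op np)[S [U [V [eS eU ez]]]].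
have [k ek] := fibreP (etrans eR (esym eS)).
pose zk n := 4 * ac / xc (ptval (R + T *+ (k + i * n))).
have rk n : root qC (zk n).
  have -> : zk n = autn nu n z.
    rewrite /zk; have -> : R + T *+ (k + i * n) = acts (autn nu n) S.
      rewrite ek actD (act_autn n c ei) act_T1 ?chi_autn //.
      by rewrite mulrnDr [T *+ k + _]addrC addrA.
    rewrite [ptval (acts _ _)]/= eU /= ez fmorph_div rmorphM rmorph_nat fmorph_rat.
    by [].
  have : root (map_poly (autn nu n) qC) (autn nu n z) by rewrite fmorph_root.
  rewrite /qC -map_poly_comp; congr (root _ _); apply: eq_map_poly => y /=.
  exact: fmorph_rat.
have zinj : {in iota 0 5 &, injective zk}.
  have coord n : exists U V, ptval (R + T *+ n) = Some (U, V).
    have [U' [V' [e _]]] := fibre_coords (R := R + T *+ n) op np (etrans (lamDTn _ _) eR).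
    by exists U', V'.
  move=> m n; rewrite !mem_iota /= => mi ni; rewrite /zk.
  have [U1 [V1 e1]] := coord (k + i * m)%N; have [U2 [V2 e2]] := coord (k + i * n)%N.
  have ac4 : 4 * ac != 0 by rewrite mulf_neq0 ?pnatr_eq0 ?fmorph_eq0.
  rewrite e1 e2 /= => /(mulfI ac4)/invr_inj eU12; rewrite eU12 in e1.
  have P2' : lam R *+ 2 != 0 by rewrite eR.
  move: (fibre_x_inj P2' e1 e2) i5 mi ni => /eqP; rewrite eqn_modDl => h i5 mi ni.
  wlog le : m n h mi ni {e1 e2 eU12} / (m <= n)%N.
    by move=> H; have [le|/ltnW le] := leqP m n; [|apply/esym]; apply: H => //; rewrite eq_sym.
  move: h; rewrite eq_sym eqn_mod_dvd ?leq_mul2l ?le ?orbT // -mulnBr Euclid_dvdM //.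
  by rewrite (negPf i5) /=; lia.
have us : uniq [seq zk n | n <- iota 0 5] by rewrite map_inj_in_uniq ?iota_uniq.
have := max_poly_roots qC0 _ us; rewrite size_map_poly !size_map size_iota => s6.
have {}s6 : (5 < size q)%N by apply: s6; apply/allP => _ /mapP[n _ ->]; apply: rk.
rewrite -(dvdp_size_eqp dq) eqn_leq dvdp_leq //= sB.
exact: s6.
Qed.
End BruFibres.

(** * Splitting fields and the points defined over them *)

Section SplField.
Variable g : {poly rat}.
Local Notation K := (Spl g).

Lemma Spl_nat n : K n%:R.
Proof. by rewrite -(rmorph_nat (ratr : {rmorphism rat -> algC})); apply: Spl_rat. Qed.

Lemma Spl_one : K 1. Proof. exact: (Spl_nat 1). Qed.

Lemma Spl_sub x y : K x -> K y -> K (x - y).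
Proof. by move=> hx hy; apply: Spl_add => //; apply: Spl_opp. Qed.

Lemma Spl_div x y : K x -> K y -> K (x / y).
Proof. by move=> hx hy; apply: Spl_mul => //; apply: Spl_inv. Qed.

Lemma Spl_exp x n : K x -> K (x ^+ n).
Proof.
by move=> hx; elim: n => [|n IH]; rewrite ?exprS; [apply: Spl_one | apply: Spl_mul].
Qed.

Lemma Spl_fixed (nu : aut) :
  (forall z, root (map_poly ratr g) z -> nu z = z) -> forall z, K z -> nu z = z.
Proof.
move=> h z; elim=> {z} [q|z||||]; [exact: fmorph_rat | exact: h | | | |].
- by move=> u v _ e _ e'; rewrite rmorphD /= e e'.
- by move=> u _ e; rewrite rmorphN /= e.
- by move=> u v _ e _ e'; rewrite rmorphM /= e e'.
- by move=> u _ e; rewrite fmorphV /= e.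
Qed.

End SplField.

Lemma Spl_incl (g h : {poly rat}) :
  (forall z, root (map_poly ratr g) z -> Spl h z) -> forall z, Spl g z -> Spl h z.
Proof.
move=> H z; elim=> {z} [q|z||||]; [exact: Spl_rat | exact: H | | | |].
- by move=> u v _ e _ e'; apply: Spl_add.
- by move=> u _ e; apply: Spl_opp.
- by move=> u v _ e _ e'; apply: Spl_mul.
- by move=> u _ e; apply: Spl_inv.
Qed.

Ltac spl := repeat first [ assumption | apply: Spl_rat | apply: Spl_nat | apply: Spl_one
  | apply: Spl_sub | apply: Spl_add | apply: Spl_opp | apply: Spl_div | apply: Spl_exp
  | apply: Spl_mul | apply: Spl_inv ].

Section SplBru.

Variables (a b d : rat) (dE : dab a b = d) (a0 : a != 0) (d0 : d != 0).
Hypothesis aD : a ^+ 2 - 11 * a - 1 != 0.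

Local Notation w := (sqrtC (ratr d) : algC).
Local Notation ac := (ratr a : algC).
Local Notation CW := (CW a0 aD).
Local Notation CWst := (CWst a0 aD).
Local Notation actw := (act d0 (rational_CW a0 aD)).
Local Notation acts := (act d0 (rational_CWst a0 aD)).
Local Notation chi := (chi d).
Local Notation T := (T (ac0 a0) (acD aD)).
Local Notation emb := (emb d a0 aD).
Local Notation Himage := (@Himage a d a0 d0 aD).

Implicit Types (R S : pt CWst) (P Q : pt CW) (nu mu : aut) (p q : point).

Lemma in_image_Himage p : on_curve (Eab a b) p -> (in_image a b p <-> Himage (emb p)).
Proof. exact: in_imageP. Qed.

Lemma fixed_emb p : fixedw d0 (emb p).
Proof. by move=> nu; apply: (act_emb dE). Qed.

(** A 2-torsion point lies in the image, since 2 is invertible modulo 5. *)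
Lemma not_image_double p : ~ Himage (emb p) -> emb p *+ 2 != 0.
Proof.
move=> nP; apply/eqP => e; apply: nP.
apply: (Himage_coprime (n := 2) (fixed_emb p)) => //; rewrite e; exact: Himage0.
Qed.

Lemma not_image_moved R : fixedw d0 (lam R) -> ~ Himage (lam R) ->
  exists2 nu, chi nu = 1 & acts nu R <> R.
Proof.
move=> fP nP; have [z pz] := C_prim_root_exists (isT : (0 < 5)%N).
apply: NNPP => H; apply: nP; apply: (descent pz fP) => nu c _.
by apply: NNPP => h; apply: H; exists nu.
Qed.

Lemma not_image_neq p : ~ Himage (emb p) -> p <> None.
Proof. by move=> h e; apply: h; rewrite e (emb0 dE) //; exact: Himage0. Qed.

Lemma reducible_iff_image x y : on_curve (Eab a b) (Some (x, y)) ->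
  (~ irreducible_poly (BruP a b (Some (x, y))) <-> in_image a b (Some (x, y))).
Proof.
move=> op; have np : Some (x, y) <> None by [].
split=> [red|/(in_image_Himage op)[R fR eR] [sB irr]].
  apply: NNPP => /(in_image_Himage op) nP; apply: red.
  have [R eR] := lam_surj (emb (Some (x, y))).
  have fP := fixed_emb (Some (x, y)); rewrite -eR in fP nP.
  have [nu c nR] := not_image_moved fP nP.
  apply: (Bru_irreducible dE op np eR _ c nR).
  by apply: not_image_double; rewrite -eR.
have [U [V [eU K0]]] := fibre_coords dE d0 op np eR.
move/act_fixedP: fR => [|[q [r]]]; rewrite eU // => -[eq _].
have : root (map_poly ratr (BruP a b (Some (x, y)))) (ratr (4 * a / q) : algC).
  apply/(root_BruP dE a0 d0 aD _ op np); exists R, U, V; split=> //.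
  by rewrite eq fmorph_div rmorphM rmorph_nat.
rewrite fmorph_root => /factor_theorem[h eB].
have /irr : size ('X - (4 * a / q)%:P : {poly rat}) != 1%N by rewrite size_XsubC.
rewrite {1}eB dvdp_mull // => /(_ isT)/eqp_size; rewrite size_XsubC.
by rewrite /BruP size_Bru.
Qed.

Section KPoints.

Variable g : {poly rat}.
Local Notation K := (Spl g).

(** The K-points of the quadratic twist. The condition is on V sqrt d and not on V, so it makes
    sense before sqrt d is known to lie in K. *)
Definition Kpt R : Prop :=
  if ptval R is Some (U, V) then K U /\ K (V * w) else True.

Lemma Kpt_fixed R : fixeds d0 R -> Kpt R.
Proof.
move/act_fixedP => [e|[q [r e]]]; rewrite /Kpt e //.
by rewrite divfK ?w_neq0 //; split; apply: Spl_rat.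
Qed.

Lemma KptN R : Kpt R -> Kpt (- R).
Proof.
rewrite /Kpt ptvalN; case: (ptval R) => [[U V]|] //= [h h'].
by split=> //; rewrite mulNr; apply: Spl_opp.
Qed.

Lemma KptD R S : Kpt R -> Kpt S -> Kpt (R + S).
Proof.
have w0 : w != 0 by apply: w_neq0.
rewrite /Kpt; have wd := w2 d; move: (w) w0 wd => v w0 wd.
rewrite ptvalD; have := ptP R; have := ptP S.
case: (ptval R) (ptval S) => [[x1 y1]|] [[x2 y2]|] // o2 o1 [kx1 ky1] [kx2 ky2].
have nopp l := secant_nopp (l := l) (x2 := x2) (y2 := y2) o1.
case: (eaddE o1 o2) => // l sl; have := nopp l sl; case: sl => h1 h2 {}nopp.
have kl : K (l * v).
  move: nopp; rewrite negb_and => /orP[nx|ny].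
    have nx' : x1 - x2 != 0 by rewrite subr_eq0.
    have -> : l * v = (y1 * v - y2 * v) / (x1 - x2).
      by rewrite -mulrBl h1; field.
    by spl.
  have -> : l * v = (x1 ^+ 2 + x1 * x2 + x2 ^+ 2 + ecA CWst * (x1 + x2) + ecB CWst)
      * ratr d / (y1 * v + y2 * v).
    by rewrite -h2 -wd; field; rewrite -mulrDl mulf_neq0.
  by rewrite /=; spl.
have kx : K (l ^+ 2 - ecA CWst - x1 - x2).
  have -> : l ^+ 2 = (l * v) ^+ 2 / ratr d by rewrite -wd; field.
  by rewrite /=; spl.
rewrite /chord; split=> //; set x3 := l ^+ 2 - _ - _ - _ in kx *.
have -> : - (l * (x3 - x1) + y1) * v = - ((l * v) * (x3 - x1) + y1 * v) by ring.
by spl.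
Qed.

Lemma KptMn R n : Kpt R -> Kpt (R *+ n).
Proof.
by move=> kR; elim: n => [|n IH]; [rewrite /Kpt | rewrite mulrS; apply: KptD].
Qed.

End KPoints.

(** U is 4a divided by a root of the quintic. Since [lamy] is V times a rational function of U, the
    ordinate of P determines V sqrt d inside the field; that function does not vanish at U because P
    is not 2-torsion. *)
Lemma Kpt_fibre p R : on_curve (Eab a b) p -> ~ Himage (emb p) -> lam R = emb p ->
  Kpt (BruP a b p) R.
Proof.
move=> op nP eR; have np := not_image_neq nP; have P2 := not_image_double nP.
have [U [V [eU K0]]] := fibre_coords dE d0 op np eR; rewrite /Kpt eU.
have [U0 U1] := KerP K0.
have kU : Spl (BruP a b p) U.
  have : Spl (BruP a b p) (4 * ac / U).
    by apply: Spl_root; apply/(root_BruP dE a0 d0 aD _ op np); exists R, U, V.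
  have ac0 : ac != 0 := ac0 a0.
  move=> h; have -> : U = 4 * ac / (4 * ac / U) by field; rewrite U0 ac0.
  by spl.
split=> //; case: p op eR {nP np} P2 kU => [[x y]|] op eR P2 kU; last first.
  by rewrite (emb0 dE) // mul0rn eqxx in P2.
have := congr1 (@ptval _) eR; rewrite (embE dE) //.
have -> : ptval (lam R) = Some (lamx ac U, lamy ac U V) by rewrite /= eU /= (negPf K0).
move=> [_ eV].
have y0 : y != 0.
  apply: contraNneq P2 => y0; rewrite mulr2n addr_eq0; apply/eqP/pt_inj.
  by rewrite ptvalN (embE dE) //= y0 mul0r rmorph0 mul0r oppr0.
have w0 : w != 0 by apply: w_neq0.
have eV' : lamy ac U V = V * lamy ac U 1 by rewrite /lamy; ring.
have l0 : lamy ac U 1 != 0.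
  apply: contraNneq y0 => l0; move: eV; rewrite eV' l0 mulr0 => /esym/eqP.
  by rewrite mulf_eq0 invr_eq0 (negPf w0) orbF fmorph_eq0 mulf_eq0 invr_eq0 (negPf d0) orbF.
have -> : V * w = ratr (y / d) / lamy ac U 1.
  by rewrite -[ratr (y / d)](divfK w0) -eV eV'; field.
by rewrite /lamy; spl.
Qed.

(** The fibre above q consists of the points H + nR + jT with H fixed. All three summands are
    defined over the field of p; T is so as the difference of the fibre points R + T and R. *)
Lemma Spl_incl_image p q n : on_curve (Eab a b) p -> on_curve (Eab a b) q ->
  ~ Himage (emb p) -> q <> None -> Himage (emb q - emb p *+ n) ->
  forall z, Spl (BruP a b q) z -> Spl (BruP a b p) z.
Proof.
move=> op oq nP nq [H fH eH]; apply: Spl_incl => z.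
move=> /(root_BruP dE a0 d0 aD _ oq nq)[S [U [V [eS eU ->]]]].
have [R eR] := lam_surj (emb p).
have kR := Kpt_fibre op nP eR.
have kRT : Kpt (BruP a b p) (R + T) by apply: Kpt_fibre; rewrite ?lamDT.
have kT : Kpt (BruP a b p) T.
  by rewrite -[T](addKr R); apply: KptD => //; apply: KptN.
have [j eS'] : exists j, S = H + R *+ n + T *+ j.
  by apply: fibreP; rewrite raddfD raddfMn /= eH eR subrK eS.
have : Kpt (BruP a b p) S.
  by rewrite eS'; apply: KptD; [apply: KptD|]; do ?apply: KptMn => //; apply: Kpt_fixed.
by rewrite /Kpt eU => -[kU _]; spl.
Qed.
End SplBru.

(** * Subgroups of order 5 of the quotient and their fields *)

Section Subgroups.

Variables (a b d : rat) (dE : dab a b = d) (a0 : a != 0) (d0 : d != 0).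
Hypothesis aD : a ^+ 2 - 11 * a - 1 != 0.

Local Notation ac := (ratr a : algC).
Local Notation CW := (CW a0 aD).
Local Notation CWst := (CWst a0 aD).
Local Notation acts := (act d0 (rational_CWst a0 aD)).
Local Notation chi := (chi d).
Local Notation T := (T (ac0 a0) (acD aD)).
Local Notation emb := (emb d a0 aD).
Local Notation Himage := (@Himage a d a0 d0 aD).
Local Notation on := (on_curve (Eab a b)).

Implicit Types (p q : point) (S : point -> Prop).

(** If nu fixes R1, it fixes the whole fibre of p, hence the common splitting field, hence the
    abscissa of R2; the points above q have distinct abscissae, so it fixes R2. *)
Lemma Spl_fixed_fibre p q R1 R2 nu : on p -> on q ->
  ~ Himage (emb p) -> ~ Himage (emb q) -> lam R1 = emb p -> lam R2 = emb q ->
  same_field (Spl (BruP a b p)) (Spl (BruP a b q)) ->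
  chi nu = 1 -> acts nu R1 = R1 -> acts nu R2 = R2.
Proof.
move=> op oq nP nQ e1 e2 sf c f1.
have np := not_image_neq dE nP; have nq := not_image_neq dE nQ.
have fixK z : Spl (BruP a b q) z -> nu z = z.
  move/sf; apply: Spl_fixed => {}z /(root_BruP dE a0 d0 aD _ op np)[S [U [V [eS eU ->]]]].
  have [j eS'] := fibreP (etrans e1 (esym eS)).
  have : acts nu S = S by rewrite eS' actD f1 act_T1.
  move/(congr1 (@ptval _)); rewrite [LHS]/= eU /= => -[eU' _].
  by rewrite fmorph_div rmorphM rmorph_nat fmorph_rat eU'.
have [U [V [eU K0]]] := fibre_coords dE d0 oq nq e2; have [U0 _] := KerP K0.
have eU' : nu U = U.
  have : nu (4 * ac / U) = 4 * ac / U.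
    by apply/fixK/Spl_root; apply/(root_BruP dE a0 d0 aD _ oq nq); exists R2, U, V.
  rewrite fmorph_div rmorphM rmorph_nat fmorph_rat => /mulfI-/(_ _)/invr_inj; apply.
  by rewrite mulf_neq0 ?pnatr_eq0 ?fmorph_eq0.
have fQ : fixedw d0 (lam R2) by rewrite e2; apply: (fixed_emb dE).
have [j ej] := cocycle nu fQ.
have ej' : ptval (R2 + T *+ j) = Some (U, chi nu * nu V) by rewrite -ej [LHS]/= eU /= eU'.
have eU0 : ptval (R2 + T *+ 0) = Some (U, V) by rewrite mulr0n addr0.
have P2 : lam R2 *+ 2 != 0 by rewrite e2; apply: (not_image_double dE).
by rewrite ej (Tmod a0 aD (fibre_x_inj d0 P2 ej' eU0)) mulr0n addr0.
Qed.

(* Both cocycles are homomorphisms to Z/5 on the automorphisms fixing w, with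
   the same kernel, hence proportional. *)
Lemma Spl_eq_image p q : on p -> on q -> ~ Himage (emb p) -> ~ Himage (emb q) ->
  same_field (Spl (BruP a b p)) (Spl (BruP a b q)) ->
  exists m, Himage (emb p *+ m - emb q).
Proof.
move=> op oq nP nQ sf.
have [R1 e1] := lam_surj (emb p); have [R2 e2] := lam_surj (emb q).
have fP : fixedw d0 (lam R1) by rewrite e1; apply: (fixed_emb dE).
have fQ : fixedw d0 (lam R2) by rewrite e2; apply: (fixed_emb dE).
have nP' : ~ Himage (lam R1) by rewrite e1.
have [mu c nR] := not_image_moved fP nP'.
have [i ei] := cocycle mu fP; have [j ej] := cocycle mu fQ.
have i5 : ~~ (5 %| i)%N.
  apply/negP; rewrite -(Tn_eq0 a0 aD) => /eqP Ti.
  by apply: nR; rewrite ei Ti addr0.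
(* The ratio j / i modulo 5, i^3 being the inverse of i. *)
exists (j * i ^ 3)%N.
have -> : emb p *+ (j * i ^ 3) - emb q = lam (R1 *+ (j * i ^ 3) - R2).
  by rewrite raddfB raddfMn /= e1 e2.
have [z pz] := C_prim_root_exists (isT : (0 < 5)%N).
apply: (descent (d0 := d0) pz).
  by rewrite raddfB raddfMn /=; apply: fixedwB => //; apply: fixedwMn.
move=> nu cn _; have [k ek] := cocycle nu fP; have [l el] := cocycle nu fQ.
have i4 : (i ^ 3 * i = 1 %[mod 5])%N by rewrite -expnSr; apply: expn4_mod5.
(* e is -k / i modulo 5, chosen so that nu mu^e fixes R1. *)
pose e := (4 * k * i ^ 3)%N.
have f1 : acts (nu \o autn mu e) R1 = R1.
  rewrite -act_comp (act_autn e c ei) actD ek act_T1 // -addrA -mulrnDr.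
  apply/eqP; rewrite -subr_eq0 addrAC subrr add0r Tn_eq0 /e.
  rewrite /dvdn -modnDmr (_ : i * _ = 4 * k * (i ^ 3 * i))%N; last by ring.
  by rewrite -modnMmr i4 modnMmr muln1 modnDmr; lia.
have c1 : chi (nu \o autn mu e) = 1 by rewrite chi_comp // cn chi_autn // mulr1.
have f2 := Spl_fixed_fibre op oq nP nQ e1 e2 sf c1 f1.
have Tl : T *+ (l + j * e) = 0.
  move: f2; rewrite -act_comp (act_autn e c ej) actD el act_T1 // -addrA -mulrnDr.
  by move/eqP; rewrite -subr_eq0 addrAC subrr add0r => /eqP.
rewrite raddfB raddfMn /= ek el mulrnDl -mulrnA opprD addrACA.
suff -> : T *+ (k * (j * i ^ 3)) - T *+ l = 0 by rewrite addr0.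
apply/eqP; rewrite subr_eq0; apply/eqP; apply: (addIr (T *+ (j * e))).
rewrite -!mulrnDr Tl; apply/eqP; rewrite Tn_eq0 /e.
by rewrite (_ : _ + _ = 5 * (k * j * i ^ 3))%N ?dvdn_mulr //; ring.
Qed.

Lemma congHE p q : on p -> on q -> (congH a b p q <-> Himage (emb p - emb q)).
Proof.
by move=> op oq; rewrite /congH -(embB dE) //; apply: in_imageP => //; apply: (wsub_on dE).
Qed.

Lemma Himage_multiple_inj p i j : ~ Himage (emb p) ->
  (i < 5)%N -> (j < 5)%N -> Himage (emb p *+ i - emb p *+ j) -> i = j.
Proof.
move=> nP; wlog le : i j / (i <= j)%N => [H i5 j5 h|i5 j5 h].
  have [le|/ltnW le] := leqP i j; first exact: H.
  by apply/esym/H => //; rewrite -opprB; apply: HimageN.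
have {}h : Himage (emb p *+ (j - i)).
  by rewrite mulrnBr // -opprB; apply: HimageN.
apply/eqP; rewrite eqn_leq le /= -subn_eq0; apply/negPn/negP => nz; apply: nP.
by apply: Himage_coprime h; [apply: (fixed_emb dE) | apply/negP; lia].
Qed.

Lemma subgroup_wadd S p q : is_subgroup_over_H a b S -> S p -> S q -> S (wadd (Eab a b) p q).
Proof.
move=> [Son [SH Ssub]] Sp Sq; have op := Son _ Sp; have oq := Son _ Sq.
have S0 : S None by apply: SH => //; exists None.
have SN : S (wsub (Eab a b) None q) by apply: Ssub.
have oN := wsub_on dE a0 d0 aD (I : on None) oq.
have -> : wadd (Eab a b) p q = wsub (Eab a b) p (wsub (Eab a b) None q).
  apply: (emb_inj dE d0 (a0 := a0) (aD := aD)).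
  - exact: (wadd_on dE a0 d0 aD).
  - exact: (wsub_on dE a0 d0 aD).
  by rewrite (embD dE a0 d0 aD op oq) (embB dE a0 d0 aD op oN) (embB dE a0 d0 aD _ oq) //
    (emb0 dE) // sub0r opprK.
exact: Ssub.
Qed.

Lemma subgroup_wmul S p n : is_subgroup_over_H a b S -> S p -> S (wmul (Eab a b) n p).
Proof.
move=> hS Sp; elim: n => [|n IH]; last exact: subgroup_wadd.
by case: hS => _ [SH _]; apply: SH => //; exists None.
Qed.

Lemma subgroup_congr S p q : is_subgroup_over_H a b S -> on p -> S q ->
  Himage (emb p - emb q) -> S p.
Proof.
move=> hS op Sq h; have [Son [SH Ssub]] := hS; have oq := Son _ Sq.
have oh := wsub_on dE a0 d0 aD op oq.
have Sh : S (wsub (Eab a b) p q).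
  by apply: SH => //; apply/(in_imageP dE a0 d0 aD oh); rewrite (embB dE).
have -> : p = wadd (Eab a b) (wsub (Eab a b) p q) q.
  apply: (emb_inj dE d0 (a0 := a0) (aD := aD)) => //; first exact: (wadd_on dE a0 d0 aD).
  by rewrite (embD dE) // (embB dE) // subrK.
exact: subgroup_wadd.
Qed.

Lemma subgroup5_not_image S : subgroup5 a b S -> exists2 p, S p & ~ Himage (emb p).
Proof.
move=> [[Son _] [s [ss [Ss [sinj _]]]]]; apply: NNPP => H.
have all_im p : S p -> Himage (emb p).
  by move=> Sp; apply: NNPP => nP; apply: H; exists p.
have Si i : (i < 5)%N -> S (nth None s i).
  by move=> i5; apply/Ss/mem_nth; rewrite ss.
have S0 := Si 0%N isT; have S1 := Si 1%N isT.
suff : 0%N = 1%N by [].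
apply: sinj => //; apply/congHE; rewrite ?Son //.
- exact: Son.
- exact: Son.
by apply: HimageB; apply: all_im.
Qed.

(** The multiples 0, ..., 4 of p lie in distinct classes, so they inject into the five
    representatives and therefore meet every class. *)
Lemma subgroup5_gen S p q : subgroup5 a b S -> S p -> ~ Himage (emb p) -> S q ->
  exists n, Himage (emb q - emb p *+ n).
Proof.
move=> [hS [s [ss [Ss [sinj scov]]]]] Sp nP Sq.
have [Son _] := hS; have op := Son _ Sp.
have rep r : S r -> exists i : 'I_5, Himage (emb r - emb (nth None s i)).
  move=> Sr; have [t ts ht] := scov _ Sr.
  have ti : (index t s < 5)%N by rewrite -ss index_mem.
  exists (Ordinal ti); rewrite /= nth_index //.
  by apply/congHE => //; apply: Son => //; apply: Ss.
have /fin_all_exists[f hf] (i : 'I_5) : exists k : 'I_5,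
    Himage (emb p *+ i - emb (nth None s k)).
  by have [k hk] := rep _ (subgroup_wmul i hS Sp); exists k; rewrite -(embM dE a0 d0 aD).
have finj : injective f.
  move=> i j e; suff h : Himage (emb p *+ i - emb p *+ j).
    by apply: val_inj; apply: (Himage_multiple_inj nP _ _ h).
  have -> : emb p *+ i - emb p *+ j = (emb p *+ i - emb (nth None s (f i)))
    - (emb p *+ j - emb (nth None s (f j))) by rewrite e opprB addrA subrK.
  exact: HimageB.
have [k hk] := rep q Sq; have [g _ fg] := injF_bij finj.
exists (g k).
have -> : emb q - emb p *+ g k = (emb q - emb (nth None s k))
    - (emb p *+ g k - emb (nth None s (f (g k)))) by rewrite fg opprB addrA subrK.
exact: HimageB.
Qed.

Definition multiples p q := on q /\ exists n : nat, congH a b q (wmul (Eab a b) n p).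

Lemma multiplesE p q : on p -> on q ->
  multiples p q <-> exists n, Himage (emb q - emb p *+ n).
Proof.
move=> op oq; split=> [[_ [n h]]|[n h]]; last split=> //; exists n.
  by move/congHE: h; rewrite (embM dE) //; apply=> //; apply: (wmul_on dE).
by apply/congHE; rewrite ?(embM dE) //; apply: (wmul_on dE).
Qed.

Lemma multiples_subgroup5 p : on p -> ~ Himage (emb p) -> subgroup5 a b (multiples p).
Proof.
move=> op nP; have P5 : Himage (emb p *+ 5) by apply/Himage5/(fixed_emb dE).
have mo i : on (wmul (Eab a b) i p) by apply: (wmul_on dE).
split.
  split; first by move=> q [].
  split=> [q oq im|q r [oq hq] [orr hr]].
    by apply/multiplesE => //; exists 0%N; rewrite mulr0n subr0; apply/(in_imageP dE).
  have /(multiplesE op oq)[n hn] : multiples p q by [].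
  have /(multiplesE op orr)[m hm] : multiples p r by [].
  have oqr := wsub_on dE a0 d0 aD oq orr; apply/multiplesE => //.
  (* 4m stands for -m, since 5 kills the quotient. *)
  exists (n + 4 * m)%N; rewrite (embB dE) //.
  have -> : emb q - emb r - emb p *+ (n + 4 * m) = (emb q - emb p *+ n)
      - (emb r - emb p *+ m) - emb p *+ 5 *+ m.
    rewrite mulrnDr -mulrnA (_ : 5 * m = 4 * m + m)%N; last by lia.
    rewrite mulrnDr !opprD !opprK (addrACA (emb q)) -[in RHS]addrA; congr (_ + _).
    by rewrite [X in _ = _ + X]addrC addrA addrK.
  by apply: HimageB; [apply: HimageB | apply: HimageMn].
exists [seq wmul (Eab a b) i p | i <- iota 0 5]; split; first by rewrite size_map size_iota.
split; [|split].
- move=> _ /mapP[i _ ->]; apply/multiplesE => //; exists i.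
  by rewrite (embM dE) // subrr; apply: Himage0.
- move=> i j i5 j5; rewrite !(nth_map 0%N) ?size_iota // !nth_iota // !add0n.
  by move/congHE; rewrite !(embM dE) // => h; apply: (Himage_multiple_inj nP) => //; apply: h.
move=> q hq; have [oq _] := hq; have /(multiplesE op oq)[n hn] := hq.
exists (wmul (Eab a b) (n %% 5) p).
  by apply/mapP; exists (n %% 5)%N => //; rewrite mem_iota /= ltn_mod.
apply/congHE => //; rewrite (embM dE) //.
have -> : emb q - emb p *+ (n %% 5) = (emb q - emb p *+ n) + emb p *+ 5 *+ (n %/ 5).
  have -> : emb p *+ n = emb p *+ 5 *+ (n %/ 5) + emb p *+ (n %% 5).
    by rewrite {1}(divn_eq n 5) mulrnDr mulnC mulrnA.
  by rewrite opprD -!addrA; congr (_ + _); rewrite addrCA addNr addr0.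
by apply: HimageD => //; apply: HimageMn.
Qed.

(** A union over all generators of the subgroup, so that none has to be chosen; [FfieldE] shows that
    the fields united are equal. *)
Definition Ffield (S : point -> Prop) (z : algC) : Prop :=
  exists p, [/\ S p, ~ Himage (emb p) & Spl (BruP a b p) z].

Lemma subgroup5_Spl_incl S p q : subgroup5 a b S -> S p -> S q ->
  ~ Himage (emb p) -> ~ Himage (emb q) ->
  forall z, Spl (BruP a b q) z -> Spl (BruP a b p) z.
Proof.
move=> hS Sp Sq nP nQ; have [[Son _] _] := hS.
have [n hn] := subgroup5_gen hS Sp nP Sq.
exact: (Spl_incl_image dE (Son _ Sp) (Son _ Sq) nP (not_image_neq dE nQ) hn).
Qed.

Lemma FfieldE S p : subgroup5 a b S -> S p -> ~ Himage (emb p) ->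
  same_field (Ffield S) (Spl (BruP a b p)).
Proof.
move=> hS Sp nP z; split=> [[q [Sq nQ]]|h]; last by exists p.
exact: (subgroup5_Spl_incl hS).
Qed.

(** By [Spl_eq_image], equal fields make a generator of S2 congruent to a multiple of a generator of
    S1. *)
Lemma Ffield_sub S1 S2 : subgroup5 a b S1 -> subgroup5 a b S2 ->
  same_field (Ffield S1) (Ffield S2) -> forall q, S2 q -> S1 q.
Proof.
move=> h1 h2 sf q Sq.
have [p1 Sp1 nP1] := subgroup5_not_image h1; have [p2 Sp2 nP2] := subgroup5_not_image h2.
have [[hS1 _] [[Son2 _] _]] := (h1, h2); have [Son1 _] := hS1.
have op1 := Son1 _ Sp1; have op2 := Son2 _ Sp2; have oq := Son2 _ Sq.
have sf' : same_field (Spl (BruP a b p1)) (Spl (BruP a b p2)).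
  move=> z; rewrite -(FfieldE h1 Sp1 nP1 z) (sf z); exact: FfieldE.
have [m hm] := Spl_eq_image op1 op2 nP1 nP2 sf'.
have Sp21 : S1 p2.
  apply: (subgroup_congr hS1 op2 (subgroup_wmul m hS1 Sp1)).
  by rewrite (embM dE) // -opprB; apply: HimageN.
have [n hn] := subgroup5_gen h2 Sp2 nP2 Sq.
by apply: (subgroup_congr hS1 oq (subgroup_wmul n hS1 Sp21)); rewrite (embM dE).
Qed.

Lemma field_correspondence :
   exists F : (point -> Prop) -> (algC -> Prop),
     (forall S P, subgroup5 a b S -> on_curve (Eab a b) P -> generated_by a b S P ->
        same_field (F S) (Spl (BruP a b P))) /\
     (forall S, subgroup5 a b S ->
        exists P, [/\ on_curve (Eab a b) P, ~ in_image a b P &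
                      same_field (F S) (Spl (BruP a b P))]) /\
     (forall S1 S2, subgroup5 a b S1 -> subgroup5 a b S2 ->
        same_field (F S1) (F S2) -> forall P, S1 P <-> S2 P) /\
     (forall P, on_curve (Eab a b) P -> ~ in_image a b P ->
        exists S, subgroup5 a b S /\ same_field (F S) (Spl (BruP a b P))).
Proof.
exists Ffield; split; [|split; [|split]].
- move=> S p hS op gen; have [[Son _] _] := hS.
  have Sp : S p.
    apply/gen; apply/multiplesE => //; exists 1%N.
    by rewrite mulr1n subrr; apply: Himage0.
  apply: FfieldE => // im; have [q Sq] := subgroup5_not_image hS; case.
  have /gen/multiplesE[//||n hn] := Sq; first exact: Son.
  by rewrite -[emb q](subrK (emb p *+ n)); apply: HimageD => //; apply: HimageMn.
- move=> S hS; have [[Son _] _] := hS; have [p Sp nP] := subgroup5_not_image hS.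
  have op := Son _ Sp; exists p; split=> //; last exact: FfieldE.
  by move/(in_imageP dE a0 d0 aD op).
- move=> S1 S2 h1 h2 sf q; split; apply: Ffield_sub => //.
  by move=> z; rewrite (sf z).
move=> p op nim; have nP : ~ Himage (emb p) by move/(in_imageP dE a0 d0 aD op).
exists (multiples p); split; first exact: multiples_subgroup5.
apply: FfieldE => //; first exact: multiples_subgroup5.
by apply/multiplesE => //; exists 1%N; rewrite mulr1n subrr; apply: Himage0.
Qed.
End Subgroups.

(** * The Kummer map of the dual isogeny *)

Section Kummer.

Variable z : algC.
Hypothesis pz : 5.-primitive_root z.

(** g generates Q(sqrt 5), as (2g + 1)^2 = 5, and k generates Q(z) over it, with k^2 = -(g + 3) and
    complex conjugate -k. *)
Definition zg : algC := z ^+ 2 + z ^+ 3.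
Definition zk : algC := z ^+ 2 - z ^+ 3.
Local Notation g := zg.
Local Notation k := zk.

Lemma z5 : z ^+ 5 = 1. Proof. exact: prim_expr_order. Qed.

Lemma zsum : z ^+ 4 + z ^+ 3 + z ^+ 2 + z + 1 = 0.
Proof.
have z1 : z - 1 != 0.
  by rewrite subr_eq0 -[z]expr1 -(prim_order_dvd pz).
apply: (mulfI z1); rewrite mulr0; apply: (lincomb1 (c := 1) z5); ring.
Qed.

Lemma zg2 : g ^+ 2 + g = 1.
Proof. by apply: (lincomb1 (c := z ^+ 2 + z - 1) zsum); rewrite /zg; ring. Qed.

Lemma zk2 : k ^+ 2 = - (g + 3).
Proof. by apply: (lincomb1 (c := z ^+ 2 - 3 * z + 3) zsum); rewrite /zg /zk; ring. Qed.

Lemma zE : z = (- 1 - g - g * k) / 2.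
Proof.
apply: (mulfI (_ : 2 != 0 :> algC)); first by rewrite pnatr_eq0.
rewrite mulrCA divff ?pnatr_eq0 // mulr1.
apply: (lincomb1 (c := 1 + z - z ^+ 2) zsum); rewrite /zg /zk; ring.
Qed.

(* Elements x + y g of Q(sqrt 5) as pairs (x, y): coordinates keep the ring
   identities below within reach of [ring]. *)
Definition gval (x : algC * algC) : algC := x.1 + x.2 * g.
Definition gmul (x y : algC * algC) : algC * algC :=
  (x.1 * y.1 + x.2 * y.2, x.1 * y.2 + x.2 * y.1 - x.2 * y.2).
Definition gadd (x y : algC * algC) : algC * algC := (x.1 + y.1, x.2 + y.2).
Definition gscale (c : algC) (x : algC * algC) : algC * algC := (c * x.1, c * x.2).

Lemma gvalM x y : gval (gmul x y) = gval x * gval y.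
Proof.
by apply: (lincomb1 (c := - (x.2 * y.2)) zg2); rewrite /gval /gmul /=; ring.
Qed.
Lemma gvalD x y : gval (gadd x y) = gval x + gval y.
Proof. by rewrite /gval /=; ring. Qed.
Lemma gvalZ c x : gval (gscale c x) = c * gval x.
Proof. by rewrite /gval /=; ring. Qed.

Section Rho.

Variables (a : algC) (a0 : a != 0) (aD : a ^+ 2 - 11 * a - 1 != 0).
Local Notation Wst := (Wst a0 aD).
Local Notation W := (W a0 aD).
Local Notation T := (T a0 aD).

Definition p_al (U : algC) : algC * algC :=
  (- (2 * a * U ^+ 2) - (4 * a ^+ 2 + 4 * a) * U + 16 * a ^+ 2,
   - ((a - 1) * U ^+ 2) - 12 * a * U + 32 * a ^+ 2).
Definition p_be (U : algC) : algC * algC := (U - 4 * a, - (4 * a)).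
Definition p_kk : algC * algC := (- 3, - 1).
(** k times [p_c] and [p_e] are the parameters of the Tate form y^2 + (c + e) x y + c^2 e y = x^3 +
    c e x^2 that W takes when T' is moved to the origin with horizontal tangent. k times [p_vT] and
    [p_s] are the ordinate of T' and its tangent slope. *)
Definition p_c : algC * algC := ((- (8 * a) - 6) / 5, (8 - 6 * a) / 5).
Definition p_e : algC * algC := ((8 - 6 * a) / 5, (8 * a + 6) / 5).
Definition p_uT : algC * algC :=
  ((- (12 * a ^+ 2) + 72 * a - 8) / 5, (- (4 * a ^+ 2) + 44 * a + 4) / 5).
Definition p_vT : algC * algC := gscale 2^-1 (gmul p_kk (gmul (gmul p_c p_c) p_e)).
Definition p_s : algC * algC := gscale 2^-1 (gadd p_c p_e).

Definition kc : algC := k * gval p_c.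
Definition ke : algC := k * gval p_e.
Definition uT : algC := gval p_uT.

(* The function on W with divisor 5 (T') - 5 (O), where T' = (uT, kc^2 ke / 2)
   generates the kernel of the dual isogeny. *)
Definition kx (u : algC) : algC := u - uT.
Definition ky (u v : algC) : algC := v - kc ^+ 2 * ke / 2 - (kc + ke) / 2 * kx u.
Definition Fk (u v : algC) : algC :=
  kx u * ky u v + kc ^+ 2 * ky u v - kc * kx u ^+ 2.

Definition rho (U V : algC) : algC :=
  (gval (p_al U) + k * gval (p_be U) * V) / Ker a U.

Lemma gval_kk : gval p_kk = k ^+ 2.
Proof. by rewrite zk2 /gval /=; ring. Qed.

(** With V^2 replaced by the cubic f, both sides have the form ev + k V od, where ev and od are
    pairs of coordinates in 1 and g. Comparing coordinates leaves four identities in U and a for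
    [field]. *)
Lemma rho5 U V : onE Wst (Some (U, V)) -> Ker a U != 0 ->
  rho U V ^+ 5 = 5 * k * (g + 2) * Fk (lamx a U) (lamy a U V).
Proof.
move=> /eqP /= o K0; have [U0 U1] := KerP K0.
pose f := U ^+ 3 + (a ^+ 2 - 6 * a + 1) * U ^+ 2 + 8 * a * (a - 1) * U + 16 * a ^+ 2.
have {}o : V ^+ 2 = f by [].
pose al := p_al U; pose be := p_be U; pose E := Ker a U.
pose al2 := gmul al al; pose bk := gmul (gmul be be) p_kk.
pose aa := gmul al2 al2; pose ab := gmul al2 bk; pose bb := gmul bk bk.
pose ev := gmul al (gadd aa (gadd (gscale (10 * f) ab) (gscale (5 * f ^+ 2) bb))).
pose od := gmul be (gadd (gscale 5 aa) (gadd (gscale (10 * f) ab) (gscale (f ^+ 2) bb))).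
have eL : rho U V ^+ 5 = (gval ev + k * V * gval od) / E ^+ 5.
  rewrite /ev /od /aa /ab /bb /al2 /bk !(gvalM, gvalD, gvalZ) gval_kk -o /rho -/al -/be -/E.
  by field.
pose X := gadd (lamx a U, 0) (gscale (-1) p_uT).
pose Y := gadd X (gmul p_kk (gmul p_c p_c)).
pose q := gscale 5 (2, 1).
pose evR := gscale (-1) (gmul (gmul q p_kk) (gadd (gmul Y (gadd p_vT (gmul p_s X)))
   (gmul p_c (gmul X X)))).
pose odR := gscale (lamy a U 1) (gmul q Y).
have eR : 5 * k * (g + 2) * Fk (lamx a U) (lamy a U V) = gval evR + k * V * gval odR.
  have -> : lamy a U V = V * lamy a U 1 by rewrite /lamy; ring.
  rewrite /evR /odR /Y /X /q /p_vT /p_s !(gvalM, gvalD, gvalZ) gval_kk.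
  rewrite /Fk /ky /kx /kc /ke /uT.
  have -> : gval (lamx a U, 0) = lamx a U by rewrite /gval /= mul0r addr0.
  have -> : gval (2, 1) = g + 2 by rewrite /gval /=; ring.
  by field.
rewrite eL eR; apply: (mulIf (expf_neq0 5 K0)); rewrite divfK ?expf_neq0 //.
have -> : (gval evR + k * V * gval odR) * Ker a U ^+ 5 =
    gval (gscale (Ker a U ^+ 5) evR) + k * V * gval (gscale (Ker a U ^+ 5) odR).
  by rewrite !gvalZ; ring.
congr (gval _ + _ * gval _); rewrite /ev /evR /od /odR; congr pair.
all: rewrite /aa /ab /bb /al2 /bk /q /Y /X /al /be /f /p_vT /p_s /p_uT /p_c /p_e /p_kk /p_al /p_be.
all: cbv beta iota zeta delta [gmul gadd gscale fst snd].
all: rewrite /lamx /lamy /Ker.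
all: by field; rewrite U0 U1.
Qed.

(** The line of slope m through T meets the cubic again at the roots U and U1 of [rel], so (U1, V1)
    is (U, V) + T. With z written by [zE], the claim is compared coordinatewise in 1, g, k and
    gk. *)
Lemma rho_chord U m (V := m * U + 4 * a) (U1 := m ^+ 2 - (a ^+ 2 - 6 * a + 1) - U)
    (V1 := - (m * U1 + 4 * a)) :
  U ^+ 2 - (m ^+ 2 - (a ^+ 2 - 6 * a + 1)) * U + 8 * a * (a - 1 - m) = 0 ->
  Ker a U != 0 -> Ker a U1 != 0 -> rho U1 V1 = z * rho U V.
Proof.
move=> rel K0 K1.
pose ev := gscale 2^-1 (gadd (gmul (-1, -1) (p_al U))
  (gscale (- V) (gmul (gmul (0, 1) p_kk) (p_be U)))).
pose od := gscale 2^-1 (gadd (gscale (-1) (gmul (0, 1) (p_al U)))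
  (gscale V (gmul (-1, -1) (p_be U)))).
have eR : z * rho U V = (gval ev + k * gval od) / Ker a U.
  rewrite {1}zE /rho /ev /od !(gvalM, gvalD, gvalZ) gval_kk.
  have -> : gval (-1, -1) = - 1 - g by rewrite /gval /=; ring.
  have -> : gval (0, 1) = g by rewrite /gval /=; ring.
  by field.
rewrite eR; apply: (mulIf K0); apply: (mulIf K1); rewrite divfK //.
have -> : rho U1 V1 * Ker a U * Ker a U1 = gval (gscale (Ker a U) (p_al U1))
    + k * gval (gscale (V1 * Ker a U) (p_be U1)).
  by rewrite /rho !gvalZ; field.
have -> : (gval ev + k * gval od) * Ker a U1 =
   gval (gscale (Ker a U1) ev) + k * gval (gscale (Ker a U1) od).
  by rewrite !gvalZ; ring.
congr (gval _ + k * gval _); congr pair.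
- apply: (lincomb1 (c := (
    - U ^+ 2 * m - 7 * U ^+ 2 * a + U ^+ 2 + U * m ^+ 3 + 7 * U * m ^+ 2 * a - U * m ^+ 2
    - U * m * a ^+ 2 + 14 * U * m * a - U * m - 7 * U * a ^+ 3 + 51 * U * a ^+ 2
    - 21 * U * a + U - 12 * m ^+ 3 * a - 12 * m ^+ 2 * a ^+ 2 + 12 * m ^+ 2 * a
    + 12 * m * a ^+ 3 - 72 * m * a ^+ 2 + 12 * m * a + 12 * a ^+ 4 - 84 * a ^+ 3
    + 84 * a ^+ 2 - 12 * a) / 2) rel).
  by rewrite /gmul /gadd /gscale /= /Ker /V1 /U1 /V; field.
- apply: (lincomb1 (c := - U ^+ 2 * m - 2 * U ^+ 2 * a + U ^+ 2 + U * m ^+ 3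
    + 2 * U * m ^+ 2 * a - U * m ^+ 2 - U * m * a ^+ 2 + 4 * U * m * a - U * m
    - 2 * U * a ^+ 3 + 11 * U * a ^+ 2 - 6 * U * a + U - 2 * m ^+ 3 * a
    - 2 * m ^+ 2 * a ^+ 2 + 2 * m ^+ 2 * a + 2 * m * a ^+ 3 - 12 * m * a ^+ 2
    + 2 * m * a + 2 * a ^+ 4 - 14 * a ^+ 3 + 14 * a ^+ 2 - 2 * a) rel).
  by rewrite /gmul /gadd /gscale /= /Ker /V1 /U1 /V; field.
- apply: (lincomb1 (c := (- U ^+ 2 * m - U ^+ 2 * a + U ^+ 2 + U * m ^+ 3
    + U * m ^+ 2 * a - U * m ^+ 2 - U * m * a ^+ 2 + 2 * U * m * a - U * m
    - U * a ^+ 3 + 3 * U * a ^+ 2 - 3 * U * a + U) / 2) rel).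
  by rewrite /gmul /gadd /gscale /= /Ker /V1 /U1 /V; field.
apply: (lincomb1 (c := (U ^+ 2 * m - U ^+ 2 * a - U ^+ 2 - U * m ^+ 3 + U * m ^+ 2 * a
  + U * m ^+ 2 + U * m * a ^+ 2 - 14 * U * m * a + U * m - U * a ^+ 3 - 3 * U * a ^+ 2
  + 13 * U * a - U + 4 * m ^+ 3 * a + 4 * m ^+ 2 * a ^+ 2 - 4 * m ^+ 2 * a
  - 4 * m * a ^+ 3 + 24 * m * a ^+ 2 - 4 * m * a - 4 * a ^+ 4 + 28 * a ^+ 3
  - 28 * a ^+ 2 + 4 * a) / 2) rel).
by rewrite /gmul /gadd /gscale /= /Ker /V1 /U1 /V; field.
Qed.

Definition rhoP (R : pt Wst) : algC :=
  if ptval R is Some (U, V) then rho U V else 0.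

Lemma lam_coords (R : pt Wst) : lam R != 0 -> exists U V, [/\ ptval R = Some (U, V),
  Ker a U != 0 & ptval (lam R) = Some (lamx a U, lamy a U V)].
Proof.
case: R => [[[U V]|]] o; last by move/eqP=> []; apply: pt_inj.
rewrite -val_eqE => K0; have K1 : Ker a U != 0 by apply: contra K0 => /= ->.
by exists U, V; split=> //=; rewrite (negPf K1).
Qed.

Lemma rhoP_T (R : pt Wst) : lam R != 0 -> rhoP (R + T) = z * rhoP R.
Proof.
move=> R0; have R1 : lam (R + T) != 0 by rewrite lamDT.
have [U [V [eR K0 _]]] := lam_coords R0; have [U1 [V1 [eR1 K1 _]]] := lam_coords R1.
have [U0 _] := KerP K0.
rewrite /rhoP eR eR1; have := eR1; rewrite ptvalD eR.
change (ptval T) with (Some (0 : algC, 4 * a)).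
rewrite eadd_chord // sub0r; pose m := (V - 4 * a) / U.
have -> : (4 * a - V) / - U = m by rewrite /m; field.
have eV : V = m * U + 4 * a by rewrite /m divfK // subrK.
have o : onE Wst (Some (U, V)) by rewrite -eR; apply: ptP.
have {}o := eqP o; rewrite /= in o.
move=> [eU1 eV1].
have e1 : U1 = m ^+ 2 - (a ^+ 2 - 6 * a + 1) - U by rewrite -eU1 /= subr0.
have e2 : V1 = - (m * (m ^+ 2 - (a ^+ 2 - 6 * a + 1) - U) + 4 * a).
  by rewrite -eV1 /=; apply: (lincomb1 (c := -1) eV); ring.
clearbody m; clear eU1 eV1 R1 eR1 eR; subst V U1 V1.
apply: rho_chord => //.
apply: (mulfI U0); rewrite mulr0.
by apply: (lincomb1 (c := -1) o); ring.
Qed.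

Lemma rhoP_Tn (R : pt Wst) n : lam R != 0 -> rhoP (R + T *+ n) = z ^+ n * rhoP R.
Proof.
move=> R0; elim: n => [|n IH]; first by rewrite mulr0n addr0 mul1r.
by rewrite mulrSr addrA rhoP_T ?lamDTn // IH exprS mulrA.
Qed.

(** The Tate form at T'. Of the three coefficient identities, [i3] says that T' lies on W, [i2] that
    (kc + ke) / 2 is the tangent slope there, and [i1] matches the coefficient of x^2. *)
Lemma Fk_curve u v : onE W (Some (u, v)) ->
  ky u v ^+ 2 + (kc + ke) * kx u * ky u v + kc ^+ 2 * ke * ky u v
  = kx u ^+ 3 + kc * ke * kx u ^+ 2.
Proof.
move=> /eqP o; rewrite /= in o.
pose A := a ^+ 2 - 30 * a + 1; pose B := - 8 * a * (3 * a + 1) * (4 * a - 7).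
pose C := - 16 * a * (4 * a ^+ 4 - 4 * a ^+ 3 - 40 * a ^+ 2 + 91 * a - 4).
pose cst x : algC * algC := (x, 0).
have gcst x : gval (cst x) = x by rewrite /gval /= mul0r addr0.
have i1 : 3 * uT + A = ((kc + ke) / 2) ^+ 2 + kc * ke.
  transitivity (gval (gadd (gscale 3 p_uT) (cst A))); first by rewrite gvalD gvalZ gcst.
  transitivity (gval (gmul p_kk (gadd (gmul p_s p_s) (gmul p_c p_e)))); last first.
    by rewrite /p_s !(gvalM, gvalD, gvalZ) gval_kk /kc /ke; field.
  by congr gval; congr pair; rewrite /p_s /A /gmul /gadd /gscale /=; field.
have i2 : 3 * uT ^+ 2 + 2 * A * uT + B = (kc + ke) * (kc ^+ 2 * ke / 2).
  transitivity (gval (gadd (gscale 3 (gmul p_uT p_uT)) (gadd (gscale (2 * A) p_uT) (cst B)))).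
    by rewrite !(gvalM, gvalD, gvalZ) gcst; rewrite /uT; ring.
  transitivity (gval (gscale 2 (gmul p_kk (gmul p_s p_vT)))); last first.
    by rewrite /p_s /p_vT !(gvalM, gvalD, gvalZ) gval_kk /kc /ke; field.
  congr gval; congr pair; rewrite /p_vT /p_s /p_uT /p_c /p_e /p_kk /A /B /cst;
    cbv beta iota zeta delta [gmul gadd gscale fst snd]; by field.
have i3 : uT ^+ 3 + A * uT ^+ 2 + B * uT + C = (kc ^+ 2 * ke / 2) ^+ 2.
  transitivity (gval (gadd (gmul p_uT (gmul p_uT p_uT)) (gadd (gscale A (gmul p_uT p_uT))
      (gadd (gscale B p_uT) (cst C))))).
    by rewrite !(gvalM, gvalD, gvalZ) gcst; rewrite /uT; ring.
  transitivity (gval (gmul p_kk (gmul p_vT p_vT))); last first.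
    by rewrite /p_vT !(gvalM, gvalD, gvalZ) gval_kk /kc /ke; field.
  congr gval; congr pair; rewrite /p_vT /p_uT /p_c /p_e /p_kk /A /B /C /cst;
    cbv beta iota zeta delta [gmul gadd gscale fst snd]; by field.
have ev : v = ky u v + kc ^+ 2 * ke / 2 + (kc + ke) / 2 * kx u by rewrite /ky; ring.
have eu : u = kx u + uT by rewrite /kx subrK.
have {}o : v ^+ 2 = u ^+ 3 + A * u ^+ 2 + B * u + C by rewrite o /A /B /C.
move: (kx u) (ky u v) ev eu o i1 i2 i3 => x y -> -> o i1 i2 i3.
have : (y + kc ^+ 2 * ke / 2 + (kc + ke) / 2 * x) ^+ 2 = x ^+ 3 + (3 * uT + A) * x ^+ 2
  + (3 * uT ^+ 2 + 2 * A * uT + B) * x + (uT ^+ 3 + A * uT ^+ 2 + B * uT + C).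
  by rewrite o; ring.
by rewrite i1 i2 i3 => h; apply: (lincomb1 (c := 1) h); field.
Qed.
End Rho.
End Kummer.

(** * Lattice points and integrality *)

(** Integer vectors with entries in [0, N) are sorted by their residue modulo n and by the cell of
    side [c j] containing each form. There are more vectors than classes, and the difference of two
    vectors in one class is the required x. *)
Lemma pigeonhole_forms m (l : 'I_m -> 'I_m -> algC) (M : algC) (n : nat)
    (res : 'I_m -> int) (c : 'I_m -> algC) :
  (forall j i, l j i \is Num.real) -> 0 < M -> (forall j, \sum_i `|l j i| <= M) ->
  (0 < n)%N -> (forall j, 0 < c j) -> n%:R * (3 * M) ^+ m < \prod_j c j ->
  exists x : 'I_m -> int, [/\ exists i, x i != 0,
    (n%:Z %| \sum_i x i * res i)%Z &
    forall j, `|\sum_i l j i * (x i)%:~R| <= c j].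
Proof.
move=> lr M0 lM n0 c0 hn.
(* N is large enough for [c j <= M * N], so that the added 1 in [K j] is absorbed: [K j] is at most
   3 M N / c j. This is where the constant 3 arises. *)
pose N := (Num.truncn (\sum_j c j / M)).+1.
have cN j : c j <= M * N%:R.
  have : \sum_j c j / M < N%:R.
    by apply: real_truncnS_gt; apply: sum_real => i _; apply/gtr0_real/divr_gt0.
  rewrite (bigD1 j) //=; set s := (X in _ + X) => h.
  have s0 : 0 <= s by apply: sumr_ge0 => i _; rewrite ltW // divr_gt0.
  rewrite mulrC -ler_pdivrMr //; apply: ltW; apply: le_lt_trans h.
  by rewrite lerDl.
pose L (v : {ffun 'I_m -> 'I_N}) j := \sum_i l j i * (v i : nat)%:R.
have LM v j : `|L v j| <= M * N%:R.
  apply: (le_trans (ler_norm_sum _ _ _)).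
  apply: (@le_trans _ _ (\sum_i `|l j i| * N%:R)).
    apply: ler_sum => i _; rewrite normrM normr_nat ler_wpM2l // ler_nat ltnW //.
  by rewrite -mulr_suml ler_wpM2r // ler0n.
have Lr v j : L v j \is Num.real.
  by apply: sum_real => i _; rewrite realM // realn.
have L0 v j : 0 <= L v j + M * N%:R.
  have := LM v j; rewrite real_ler_norml // => /andP[h _].
  by rewrite -lerBlDr sub0r.
(* The number of cells of length [c j] that cover the interval from -M N to M N. *)
pose K j := (Num.truncn (2 * M * N%:R / c j)).+1.
have tK v j : (Num.truncn ((L v j + M * N%:R) / c j) < K j)%N.
  rewrite ltnS le_truncn // ler_pdivrMr // divfK ?gt_eqF //.
  have := LM v j; rewrite real_ler_norml // => /andP[_ h].
  by rewrite -[2]/(1 + 1) !mulrDl !mul1r lerD2r.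
pose cell v : {dffun forall j : 'I_m, 'I_(K j)} := [ffun j => Ordinal (tK v j)].
have rn (v : {ffun 'I_m -> 'I_N}) : (`|((\sum_i ((v i : nat)%:Z) * res i) %% n%:Z)%Z| < n)%N.
  by rewrite -ltz_nat gez0_abs ?modz_ge0 ?ltz_pmod // -lt0n.
pose f (v : {ffun 'I_m -> 'I_N}) := (Ordinal (rn v), cell v).
have cardlt : (n * \prod_j K j < N ^ m)%N.
  have KN j : (K j)%:R <= 3 * M * N%:R / c j :> algC.
    have -> : (K j)%:R = (Num.truncn (2 * M * N%:R / c j))%:R + 1 :> algC by rewrite natr1.
    rewrite ler_pdivlMr // mulrDl mul1r.
    have -> : 3 * M * N%:R = 2 * M * N%:R + M * N%:R by ring.
    apply: lerD => //; rewrite -ler_pdivlMr //.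
    have : 0 <= 2 * M * N%:R / c j by rewrite divr_ge0 ?mulr_ge0 ?ler0n // ltW.
    by move/truncn_itv/andP=> [].
  rewrite -(ltr_nat algC) natrM natr_prod natrX.
  have pK : \prod_j (K j)%:R <= \prod_j (3 * M * N%:R / c j) :> algC.
    by apply: ler_prod => j _; rewrite ler0n KN.
  have c0' : 0 < \prod_j c j by apply: prodr_gt0.
  have N0 : 0 < N%:R ^+ m :> algC by rewrite exprn_gt0 // ltr0n.
  apply: (@le_lt_trans _ _ (n%:R * \prod_j (3 * M * N%:R / c j))).
    by rewrite ler_wpM2l ?ler0n.
  have -> : \prod_j (3 * M * N%:R / c j) = (3 * M) ^+ m * N%:R ^+ m / \prod_j c j.
    rewrite big_split /= prodfV prodr_const card_ord exprMn.
    by [].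
  rewrite !mulrA ltr_pdivrMr // mulrC ltr_pM2l //.
have : ~~ injectiveb f.
  apply/negP => /injectiveP/leq_card.
  rewrite card_prod card_ffun !card_ord card_dep_ffun.
  have -> : foldr muln 1%N [seq #|'I_(K x)| | x : 'I_m] = (\prod_j K j)%N.
    rewrite foldrE big_image /=.
    by apply: eq_bigr => j _; rewrite card_ord.
  by rewrite leqNgt cardlt.
move=> /injectivePn[v [v' nvv' [er ec]]].
exists (fun i => (v i : nat)%:Z - (v' i : nat)%:Z); split.
- have [i ni] : exists i, v i != v' i.
    apply/existsP; rewrite -negb_forall; apply: contra nvv' => /forallP h.
    by apply/eqP/ffunP => i; apply/eqP.
  exists i; rewrite subr_eq0; apply: contra ni => /eqP[e].
  exact/eqP/val_inj.
- have -> : \sum_i ((v i : nat)%:Z - (v' i : nat)%:Z) * res i =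
    \sum_i (v i : nat)%:Z * res i - \sum_i (v' i : nat)%:Z * res i.
    by rewrite -sumrB; apply: eq_bigr => i _; rewrite mulrBl.
  rewrite -eqz_mod_dvd; apply/eqP.
  have nz : n%:Z != 0 by rewrite -lt0n.
  by rewrite -[LHS]gez0_abs ?modz_ge0 // -[RHS]gez0_abs ?modz_ge0 // er.
move=> j; have -> : \sum_i l j i * ((v i : nat)%:Z - (v' i : nat)%:Z)%:~R = L v j - L v' j.
  by rewrite /L -sumrB; apply: eq_bigr => i _; rewrite intrB mulrBr.
have /(congr1 (fun h : {dffun forall j : 'I_m, 'I_(K j)} => val (h j))) := ec.
rewrite !ffunE /= => et.
have h u : 0 <= (L u j + M * N%:R) / c j by rewrite divr_ge0 // ltW.
have /andP[a1 a2] := truncn_itv (h v); have /andP[b1 b2] := truncn_itv (h v').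
rewrite -et in b1 b2; move: a1 a2 b1 b2; set t := Num.truncn _.
rewrite ler_pdivlMr // ltr_pdivrMr // ler_pdivlMr // ltr_pdivrMr // => a1 a2 b1 b2.
rewrite -natr1 mulrDl mul1r in a2 b2.
rewrite real_ler_norml ?realB //; apply/andP; split.
  rewrite -subr_ge0.
  have -> : L v j - L v' j - - c j = (L v j + M * N%:R - t%:R * c j)
     + (t%:R * c j + c j - (L v' j + M * N%:R)) by ring.
  by rewrite addr_ge0 // subr_ge0 // ltW.
rewrite -subr_ge0.
have -> : c j - (L v j - L v' j) = (L v' j + M * N%:R - t%:R * c j)
     + (t%:R * c j + c j - (L v j + M * N%:R)) by ring.
by rewrite addr_ge0 // subr_ge0 // ltW.
Qed.

(** Stated for families so that one denominator serves all members; in the descent the index runs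
    over the rational points. *)
Definition bint (I : Type) (f : I -> algC) :=
  exists2 K : nat, (0 < K)%N & forall i, K%:R * f i \in Aint.

Section BoundedDenominators.
Variable I : Type.
Implicit Types f h : I -> algC.

Lemma bint_ext f h : (forall i, f i = h i) -> bint f -> bint h.
Proof. by move=> e [K K0 hK]; exists K => // i; rewrite -e. Qed.

Lemma bint_Aint f : (forall i, f i \in Aint) -> bint f.
Proof. by move=> h; exists 1%N => // i; rewrite mul1r. Qed.

Lemma bint_int (f : I -> int) : bint (fun i => (f i)%:~R).
Proof. by apply: bint_Aint => i; apply: Aint_int. Qed.

Lemma bint_nat n : bint (fun _ : I => n%:R).
Proof. by apply: bint_Aint => i; apply: (Aint_int n). Qed.

Lemma bint_one : bint (fun _ : I => 1).
Proof. exact: (bint_nat 1). Qed.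

Lemma bint_ratr q : bint (fun _ : I => ratr q).
Proof.
exists `|denq q|%N; first by rewrite absz_gt0 denq_neq0.
move=> _; have -> : (`|denq q|%N%:R : algC) * ratr q = (numq q)%:~R; last exact: Aint_int.
by rewrite pmulrn absz_denq /ratr mulrCA divff ?mulr1 // intr_eq0 denq_neq0.
Qed.

Lemma bintD f h : bint f -> bint h -> bint (fun i => f i + h i).
Proof.
move=> [K K0 hK] [K' K0' hK']; exists (K * K')%N; first by rewrite muln_gt0 K0.
move=> i; have -> : (K * K')%:R * (f i + h i) = K'%:R * (K%:R * f i) + K%:R * (K'%:R * h i).
  by rewrite natrM; ring.
by rewrite rpredD // rpredM // ?hK ?hK' //; apply: (Aint_int (Posz _)).
Qed.

Lemma bintM f h : bint f -> bint h -> bint (fun i => f i * h i).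
Proof.
move=> [K K0 hK] [K' K0' hK']; exists (K * K')%N; first by rewrite muln_gt0 K0.
move=> i; have -> : (K * K')%:R * (f i * h i) = (K%:R * f i) * (K'%:R * h i).
  by rewrite natrM; ring.
by rewrite rpredM.
Qed.

Lemma bintN f : bint f -> bint (fun i => - f i).
Proof. by move=> [K K0 hK]; exists K => // i; rewrite mulrN rpredN. Qed.

Lemma bintX f n : bint f -> bint (fun i => f i ^+ n).
Proof.
move=> hf; elim: n => [|n IH]; first exact: bint_one.
by apply: (bint_ext (f := fun i => f i * f i ^+ n)) (bintM hf IH) => i; rewrite exprS.
Qed.

Lemma bint_sum n (f : nat -> I -> algC) :
  (forall j, bint (f j)) -> bint (fun i => \sum_(j < n) f j i).
Proof.
move=> h; elim: n => [|n IH].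
  by apply: (bint_ext (f := fun _ => 0%:R)) (bint_nat 0) => i; rewrite big_ord0.
by apply: (bint_ext (f := fun i => _ + f n i)) (bintD IH (h n)) => i; rewrite big_ord_recr.
Qed.

End BoundedDenominators.

Ltac bint := repeat first [ assumption | apply: bint_ratr | apply: bint_int
  | apply: bint_nat | apply: bint_one | apply: bintD | apply: bintN | apply: bintX
  | apply: bintM ].

(** * Divisibility of gamma^5 by alpha up to a uniform denominator *)

Section Integrality.

Variables (I : Type) (r s t : I -> int) (x0 x1 x2 x3 q u v : I -> int).
Variables (cc ee X Y S X' : algC).
Local Notation "f %C" := (fun i => (f i)%:~R : algC) (at level 2).
Local Notation cst := (fun c (_ : I) => c : algC).
Hypotheses (bc : bint (cst cc)) (be : bint (cst ee)) (bX : bint (cst X)).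
Hypotheses (bY : bint (cst Y)) (bS : bint (cst S)) (bX' : bint (cst X')).

Let R i : algC := (r i)%:~R.
Let Q i : algC := (s i)%:~R.
Let T i : algC := (t i)%:~R.
Let x i : algC := R i - T i ^+ 2 * X.
Let y i : algC := Q i - T i ^+ 3 * Y - S * T i * x i.
Let c i : algC := T i * cc.
Let e i : algC := T i * ee.
Let alpha i : algC := x i * y i + c i ^+ 2 * y i - c i * x i ^+ 2.
Let gamma i : algC := (x0 i)%:~R + (x1 i)%:~R * X + (x2 i)%:~R * Y + (x3 i)%:~R * (X * Y).

Hypothesis curve : forall i,
  y i ^+ 2 + (c i + e i) * x i * y i + c i ^+ 2 * e i * y i = x i ^+ 3 + c i * e i * x i ^+ 2.
Hypothesis residue : forall i,
  (x0 i)%:~R * T i ^+ 5 + (x1 i)%:~R * R i * T i ^+ 3 + (x2 i)%:~R * Q i * T i ^+ 2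
  + (x3 i)%:~R * R i * Q i = x i * (R i - T i ^+ 2 * X') * (q i)%:~R.
Hypothesis bezout : forall i, (u i)%:~R * (R i * Q i) = 1 + T i * (v i)%:~R.
Hypothesis alpha0 : forall i, alpha i != 0.

Let bR : bint R. Proof. exact: bint_int. Qed.
Let bQ : bint Q. Proof. exact: bint_int. Qed.
Let bT : bint T. Proof. exact: bint_int. Qed.
Let bx : bint x. Proof. by rewrite /x; bint. Qed.
Let by_ : bint y. Proof. by rewrite /y; bint. Qed.
Let bcc : bint c. Proof. by rewrite /c; bint. Qed.
Let bee : bint e. Proof. by rewrite /e; bint. Qed.

(* x, y vanish to order 1, 2 and alpha to order 5 at T', so every monomial
   x^i y^j with i + 2 j >= 5 is a multiple of alpha. *)
Let b_xyy : bint (fun i => x i * y i ^+ 2 / alpha i).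
Proof.
apply: (bint_ext (f := fun i => y i + c i * x i + c i ^+ 2 * e i)); last by bint.
move=> i; apply: (mulIf (alpha0 i)); rewrite divfK //.
by apply: (lincomb1 (c := - (c i ^+ 2) * -1) (curve i)); rewrite /alpha; ring.
Qed.

Let b_xxxy : bint (fun i => x i ^+ 3 * y i / alpha i).
Proof.
apply: (bint_ext (f := fun i => x i ^+ 2 + c i * y i + (c i + e i) * c i * x i + e i * c i ^+ 3));
  last by bint.
move=> i; apply: (mulIf (alpha0 i)); rewrite divfK //.
by apply: (lincomb1 (c := x i * c i + c i ^+ 3) (curve i)); rewrite /alpha; ring.
Qed.

Let b_x5 : bint (fun i => x i ^+ 5 / alpha i).
Proof.
pose yb i := - y i - (c i + e i) * x i - c i ^+ 2 * e i.
apply: (bint_ext (f := fun i => - (x i * yb i + c i ^+ 2 * yb i - c i * x i ^+ 2)));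
  last by rewrite /yb; bint.
move=> i; apply: (mulIf (alpha0 i)); rewrite divfK //.
apply: (lincomb1 (c := x i ^+ 2 + 2 * x i * c i ^+ 2 + c i ^+ 4) (curve i)).
by rewrite /alpha /yb; ring.
Qed.

Let b_y3 : bint (fun i => y i ^+ 3 / alpha i).
Proof.
apply: (bint_ext (f := fun i => x i ^+ 2 - e i * y i + c i * e i * x i)); last by bint.
move=> i; apply: (mulIf (alpha0 i)); rewrite divfK //.
by apply: (lincomb1 (c := - (y i - x i * c i)) (curve i)); rewrite /alpha; ring.
Qed.

(** Modulo x and y the point P agrees with T', so [residue] allows t^5 gamma to be written as x a1 +
    y a2. In the fifth power every monomial has degree 5 and is covered by one of the four quotients
    above. *)
Let b_tgamma : bint (fun i => (T i ^+ 5 * gamma i) ^+ 5 / alpha i).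
Proof.
pose a1 i : algC := (q i)%:~R * (R i - T i ^+ 2 * X') - (x1 i)%:~R * T i ^+ 3
  - (x2 i)%:~R * T i ^+ 3 * S - (x3 i)%:~R * (T i ^+ 3 * Y + R i * S * T i).
pose a2 i : algC := - (x2 i)%:~R * T i ^+ 2 - (x3 i)%:~R * R i.
have ba1 : bint a1 by rewrite /a1; bint.
have ba2 : bint a2 by rewrite /a2; bint.
have eg i : T i ^+ 5 * gamma i = x i * a1 i + y i * a2 i.
  apply: (lincomb1 (c := 1) (residue i)).
  by rewrite /gamma /a1 /a2 /y /x; ring.
apply: (bint_ext (f := fun i => a1 i ^+ 5 * (x i ^+ 5 / alpha i)
  + 5 * a1 i ^+ 4 * a2 i * x i * (x i ^+ 3 * y i / alpha i)
  + 10 * a1 i ^+ 3 * a2 i ^+ 2 * y i * (x i ^+ 3 * y i / alpha i)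
  + 10 * a1 i ^+ 2 * a2 i ^+ 3 * x i * y i * (x i * y i ^+ 2 / alpha i)
  + 5 * a1 i * a2 i ^+ 4 * y i ^+ 2 * (x i * y i ^+ 2 / alpha i)
  + a2 i ^+ 5 * y i ^+ 2 * (y i ^+ 3 / alpha i))); last first.
  by bint.
by move=> i; rewrite eg; field.
Qed.

(* alpha is congruent to r s modulo t, hence prime to t: this removes t. *)
Lemma bint_gamma5 : bint (fun i => gamma i ^+ 5 / alpha i).
Proof.
pose h i : algC := (v i)%:~R + (u i)%:~R * (- T i * X * (Q i - T i ^+ 3 * Y - S * T i * x i)
  - R i * (T i ^+ 2 * Y + S * x i) + T i * cc ^+ 2 * y i - cc * x i ^+ 2).
have bh : bint h by rewrite /h; bint.
have ea i : (u i)%:~R * alpha i = 1 + T i * h i.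
  apply: (lincomb1 (c := 1) (bezout i)).
  by rewrite /alpha /h /y /x /c; ring.
have bg : bint gamma by rewrite /gamma; bint.
(* From u alpha = 1 + t h, the geometric sum gives 1 = u alpha sm + (-t h)^25; the exponent 25
   supplies the t^25 contained in (t^5 gamma)^5. *)
pose sm i := \sum_(j < 25) (- (T i * h i)) ^+ j.
have bsm : bint sm.
  by apply: (bint_sum 25 (f := fun j i => (- (T i * h i)) ^+ j)) => j; bint.
apply: (bint_ext (f := fun i => gamma i ^+ 5 * (u i)%:~R * sm i
   + (- h i) ^+ 25 * ((T i ^+ 5 * gamma i) ^+ 5 / alpha i))); last by bint.
move=> i; have := subrXX (1 : algC) (- (T i * h i)) 25.
rewrite (eq_bigr (fun j : 'I_25 => (- (T i * h i)) ^+ j)) => [|j _]; last first.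
  by rewrite expr1n mul1r.
rewrite -/(sm i) expr1n opprK -ea => e1.
apply: (mulIf (alpha0 i)); rewrite divfK // mulrDl -[X in _ + X]mulrA divfK //.
have -> : (- h i) ^+ 25 * (T i ^+ 5 * gamma i) ^+ 5 = gamma i ^+ 5 * (- (T i * h i)) ^+ 25.
  by ring.
by apply: (lincomb1 (c := - gamma i ^+ 5) e1); ring.
Qed.
End Integrality.

(** * The cyclic quartic field Q(om) and its automorphism tau *)

Section QuarticField.

Variables (z W : algC) (D : rat).
Hypotheses (pz : 5.-primitive_root z) (W2 : W ^+ 2 = ratr D) (D0 : D != 0).
Variable tau : aut.
Hypothesis tz : tau z = z ^+ 2.

Local Notation g := (zg z).
Local Notation k := (zk z).

(* The cyclic quartic field Q(om), with om^4 + 5 D om^2 + 5 D^2 = 0. *)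
Definition om : algC := k * W.

Lemma W_neq0 : W != 0.
Proof. by rewrite -sqrf_eq0 W2 fmorph_eq0. Qed.

Lemma tau_g : tau g = - 1 - g.
Proof.
rewrite /zg rmorphD !rmorphXn /= tz; apply: (lincomb2 (c := 1) (c' := z) (zsum pz) (z5 pz)).
ring.
Qed.

Lemma tau_k : tau k = g * k.
Proof.
by rewrite /zk /zg rmorphB !rmorphXn /= tz; ring.
Qed.

Lemma sign_W (nu : aut) : nu W = W \/ nu W = - W.
Proof.
have /eqP : nu W ^+ 2 = W ^+ 2 by rewrite -rmorphXn /= W2 fmorph_rat.
by rewrite eqf_sqr => /orP[]/eqP; [left | right].
Qed.

Lemma om2 : om ^+ 2 = - (g + 3) * ratr D.
Proof. by rewrite exprMn W2 (zk2 pz). Qed.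

Lemma tau_om : tau om = g * om \/ tau om = - (g * om).
Proof.
rewrite /om rmorphM /= tau_k; have [->|->] := sign_W tau; [left | right]; ring.
Qed.

Definition inM (x : algC) : Prop := exists q0 q1 q2 q3 : rat,
  x = ratr q0 + ratr q1 * g + (ratr q2 + ratr q3 * g) * om.

Lemma inM_rat q : inM (ratr q).
Proof. by exists q, 0, 0, 0; rewrite rmorph0; ring. Qed.

Lemma inM_nat n : inM n%:R.
Proof. by rewrite -(rmorph_nat (ratr : {rmorphism rat -> algC})); apply: inM_rat. Qed.

Lemma inM_one : inM 1. Proof. exact: (inM_nat 1). Qed.

Lemma inM_g : inM g.
Proof. by exists 0, 1, 0, 0; rewrite rmorph0 rmorph1; ring. Qed.

Lemma inM_om : inM om.
Proof. by exists 0, 0, 1, 0; rewrite rmorph0 rmorph1; ring. Qed.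

Lemma inMD x y : inM x -> inM y -> inM (x + y).
Proof.
move=> [p0 [p1 [p2 [p3 ->]]]] [q0 [q1 [q2 [q3 ->]]]].
by exists (p0 + q0), (p1 + q1), (p2 + q2), (p3 + q3); ring.
Qed.

Lemma inMN x : inM x -> inM (- x).
Proof.
by move=> [p0 [p1 [p2 [p3 ->]]]]; exists (- p0), (- p1), (- p2), (- p3); ring.
Qed.

Lemma inMM x y : inM x -> inM y -> inM (x * y).
Proof.
move=> [p0 [p1 [p2 [p3 ->]]]] [q0 [q1 [q2 [q3 ->]]]].
pose u0 := p2 * q2 + p3 * q3; pose u1 := p2 * q3 + p3 * q2 - p3 * q3.
exists (p0 * q0 + p1 * q1 - D * (3 * u0 + u1)),
  (p0 * q1 + p1 * q0 - p1 * q1 - D * (u0 + 2 * u1)),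
  (p0 * q2 + p1 * q3 + p2 * q0 + p3 * q1),
  (p0 * q3 + p1 * q2 - p1 * q3 + p2 * q1 + p3 * q0 - p3 * q1).
pose x3 : algC := ratr p3; pose y3 : algC := ratr q3.
have h := zg2 pz.
apply: (lincomb2 (c := (ratr p2 + ratr p3 * g) * (ratr q2 + ratr q3 * g))
  (c' := ratr p1 * ratr q1 + (ratr p1 * ratr q3 + ratr p3 * ratr q1) * om
    - ratr D * (ratr u1 + x3 * y3 * (g + 3))) om2 h).
by rewrite /u0 /u1 /x3 /y3; ring.
Qed.

Lemma inMX x n : inM x -> inM (x ^+ n).
Proof.
by move=> h; elim: n => [|n IH]; rewrite ?exprS; [apply: inM_one | apply: inMM].
Qed.

Lemma aut_inG (nu : aut) q0 q1 x :
  nu (ratr q0 + ratr q1 * x) = ratr q0 + ratr q1 * nu x.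
Proof.
transitivity (nu (ratr q0) + nu (ratr q1) * nu x); first by ring.
by rewrite !fmorph_rat.
Qed.

Lemma aut_inM (nu : aut) q0 q1 q2 q3 x y :
  nu (ratr q0 + ratr q1 * x + (ratr q2 + ratr q3 * x) * y) =
  ratr q0 + ratr q1 * nu x + (ratr q2 + ratr q3 * nu x) * nu y.
Proof.
transitivity (nu (ratr q0 + ratr q1 * x) + nu (ratr q2 + ratr q3 * x) * nu y).
  by ring.
by rewrite !aut_inG.
Qed.

Definition inG (x : algC) : Prop := exists q0 q1 : rat, x = ratr q0 + ratr q1 * g.

Lemma inGD x y : inG x -> inG y -> inG (x + y).
Proof. by move=> [p0 [p1 ->]] [q0 [q1 ->]]; exists (p0 + q0), (p1 + q1); ring. Qed.

Lemma inGM x y : inG x -> inG y -> inG (x * y).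
Proof.
move=> [p0 [p1 ->]] [q0 [q1 ->]].
exists (p0 * q0 + p1 * q1), (p0 * q1 + p1 * q0 - p1 * q1).
by apply: (lincomb1 (c := ratr p1 * ratr q1) (zg2 pz)); ring.
Qed.

Lemma inG_rat q : inG (ratr q).
Proof. by exists q, 0; rewrite rmorph0; ring. Qed.

Lemma inG_inM x : inG x -> inM x.
Proof. by move=> [p0 [p1 ->]]; exists p0, p1, 0, 0; rewrite rmorph0; ring. Qed.

Lemma inM_dec x : inM x -> exists2 A, inG A & exists2 B, inG B & x = A + B * om.
Proof.
move=> [q0 [q1 [q2 [q3 ->]]]].
exists (ratr q0 + ratr q1 * g); first by exists q0, q1.
by exists (ratr q2 + ratr q3 * g) => //; exists q2, q3.
Qed.

Lemma tau2_g : tau (tau g) = g.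
Proof. by rewrite tau_g rmorphB rmorphN rmorph1 /= tau_g; ring. Qed.

Lemma tau2_om : tau (tau om) = - om.
Proof.
have h : g * (1 + g) = 1 by rewrite -[RHS](zg2 pz); ring.
have [e|e] := tau_om; rewrite e ?rmorphN rmorphM /= tau_g e.
  by apply: (lincomb1 (c := - om) h); ring.
by apply: (lincomb1 (c := - om) h); ring.
Qed.

Lemma tau2_inG x : inG x -> tau (tau x) = x.
Proof. by move=> [p0 [p1 ->]]; rewrite !aut_inG tau2_g. Qed.

Lemma inM_tau x : inM x -> inM (tau x).
Proof.
move=> [q0 [q1 [q2 [q3 ->]]]].
have ig := inM_g; have io := inM_om.
have ht : inM (tau om).
  by have [->|->] := tau_om; [|apply: inMN]; apply: inMM.
have hg : inM (tau g) by rewrite tau_g; apply: inMD; apply: inMN => //; apply: inM_one.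
rewrite aut_inM.
by do ?[assumption | apply: inM_rat | apply: inMD | apply: inMM].
Qed.

(** Inversion through norms in two quadratic steps: tau^2 negates om and fixes g, so y = x tau^2(x)
    lies in Q(sqrt 5), and y tau(y) is rational. *)
Lemma inMV x : inM x -> inM x^-1.
Proof.
move=> hx; have [->|x0] := eqVneq x 0; first by rewrite invr0 -(rmorph0 (ratr : {rmorphism rat -> algC})); apply: inM_rat.
have [A hA [B hB ex]] := inM_dec hx.
have ex2 : tau (tau x) = A - B * om.
  transitivity (tau (tau A) + tau (tau B) * tau (tau om)); first by rewrite ex; ring.
  by rewrite (tau2_inG hA) (tau2_inG hB) tau2_om; ring.
pose y := x * tau (tau x).
have y0 : y != 0 by rewrite mulf_neq0 // !fmorph_eq0.
have [n0 [n1 ey]] : inG y.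
  have -> : y = A * A + B * B * (ratr 3 + ratr 1 * g) * ratr D.
    rewrite /y ex2 {1}ex; apply: (lincomb1 (c := - B ^+ 2) om2).
    by rewrite rmorph1 rmorph_nat; ring.
  apply: inGD; first exact: inGM.
  by apply: inGM; [apply: inGM; [apply: inGM | exists 3, 1] | apply: inG_rat].
have eN : y * tau y = ratr (n0 ^+ 2 - n0 * n1 - n1 ^+ 2).
  rewrite ey aut_inG tau_g.
  by apply: (lincomb1 (c := - ratr n1 ^+ 2) (zg2 pz)); ring.
have ty0 : tau y != 0 by rewrite fmorph_eq0.
have -> : x^-1 = tau (tau x) * tau y * ratr (n0 ^+ 2 - n0 * n1 - n1 ^+ 2)^-1.
  have -> : ratr (n0 ^+ 2 - n0 * n1 - n1 ^+ 2)^-1 = (y * tau y)^-1.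
    by rewrite eN; apply: fmorphV.
  have tx0 : tau (tau x) != 0 by rewrite !fmorph_eq0.
  apply: (mulIf (mulf_neq0 y0 ty0)); rewrite divfK ?mulf_neq0 //.
  by rewrite /y !mulrA mulVf // mul1r.
by do ?[assumption | apply: inM_rat | apply: inM_tau | apply: inMM].
Qed.

Lemma conj_z : z^* = z ^+ 4.
Proof.
have nz : `|z| = 1.
  have /eqP : `|z| ^+ 5 = 1 by rewrite -normrX z5 // normr1.
  by rewrite pexprn_eq1 // => /eqP.
have z0 : z != 0 by rewrite -normr_eq0 nz oner_eq0.
apply: (mulIf z0); rewrite -exprSr z5 // mulrC -normCK nz expr1n //.
Qed.

Lemma conj_g : g^* = g.
Proof.
rewrite /zg rmorphD !rmorphXn /= conj_z.
by apply: (lincomb1 (c := z ^+ 3 + z ^+ 2 * (z ^+ 5 + 1)) (z5 pz)); ring.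
Qed.

Lemma conj_k : k^* = - k.
Proof.
rewrite /zk rmorphB !rmorphXn /= conj_z.
by apply: (lincomb1 (c := z ^+ 3 - z ^+ 2 * (z ^+ 5 + 1)) (z5 pz)); ring.
Qed.

Lemma conj_om : om^* = om \/ om^* = - om.
Proof.
rewrite /om rmorphM /= conj_k; have [->|->] := sign_W Num.conj; [right | left]; ring.
Qed.

(** om is real or purely imaginary, according to the sign of D; complex conjugation is accordingly
    the identity or tau^2 on Q(om). *)
Lemma conj_inM x : inM x ->
  (om^* = om -> x^* = x) /\ (om^* = - om -> x^* = tau (tau x)).
Proof.
move=> [q0 [q1 [q2 [q3 ->]]]].
have e0 : (ratr q0 + ratr q1 * g + (ratr q2 + ratr q3 * g) * om)^* =
  ratr q0 + ratr q1 * g^* + (ratr q2 + ratr q3 * g^* ) * om^*.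
  exact: (aut_inM Num.conj).
by rewrite e0 conj_g !aut_inM tau2_g tau2_om; split=> ->.
Qed.
End QuarticField.

(** * A small element of a lattice defined by one congruence *)

Section LatticePoint.

Variables (z W : algC) (D : rat).
Hypotheses (pz : 5.-primitive_root z) (W2 : W ^+ 2 = ratr D) (D0 : D != 0).
Variable tau : aut.
Hypothesis tz : tau z = z ^+ 2.

Local Notation g := (zg z).
Local Notation om := (om z W).
Local Notation inM := (inM z W).
Local Notation inG := (inG z).

Lemma inG_g : inG g.
Proof. by exists 0, 1; rewrite rmorph0 rmorph1; ring. Qed.

Lemma inG_N x : inG x -> inG (- x).
Proof. by move=> [q0 [q1 ->]]; exists (- q0), (- q1); ring. Qed.

Lemma inG_tau x : inG x -> inG (tau x).
Proof.
move=> [q0 [q1 ->]]; rewrite aut_inG (tau_g pz tz).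
by exists (q0 - q1), (- q1); ring.
Qed.

Lemma conj_inG x : inG x -> x^* = x.
Proof.
move=> [q0 [q1 ->]].
transitivity (ratr q0 + ratr q1 * g^*); first exact: (aut_inG Num.conj).
by rewrite (conj_g pz).
Qed.

Definition inGom x := exists2 B, inG B & x = B * om.

Lemma inGom_tau x : inGom x -> inGom (tau x).
Proof.
move=> [B hB ->]; have hB' := inG_tau hB; rewrite rmorphM /=.
have [->|->] := tau_om W2 tz.
  by exists (tau B * g); [apply: (inGM pz) => //; apply: inG_g | ring].
exists (- (tau B * g)); last by ring.
by apply: inG_N; apply: (inGM pz) => //; apply: inG_g.
Qed.

Lemma conj_inGom x : om^* = - om -> inGom x -> x^* = - x.
Proof. by move=> e [B hB ->]; rewrite rmorphM /= e (conj_inG hB) mulrN. Qed.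

Lemma inGom_inM x : inGom x -> inM x.
Proof. by move=> [B hB ->]; apply: (inMM pz W2); [apply: inG_inM | apply: inM_om]. Qed.

Lemma autn_ind (P : algC -> Prop) j x :
  (forall x, P x -> P (tau x)) -> P x -> P (autn tau j x).
Proof. by move=> h hx; elim: j => //= j; apply: h. Qed.

Lemma inM_autn j x : inM x -> inM (autn tau j x).
Proof. by apply: autn_ind; apply: (inM_tau pz W2 tz). Qed.

Lemma norm_tau2 x : om^* = - om -> inM x -> `|tau (tau x)| = `|x|.
Proof.
by move=> e hx; have [_ /(_ e) <-] := conj_inM pz W2 tz hx; rewrite norm_conjC.
Qed.

Variables X Y : algC.
Hypotheses (gX : inG X) (gY : inGom Y).

Let bs (i : nat) : algC := nth 0 [:: 1; X; Y; X * Y] i.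

(** The box has sides L times the fifth roots of the conjugates of alpha. Its volume is L^4 n
    because the norm of alpha is n^5, and L = 3M + 1 meets the pigeonhole bound. The factor 2 in the
    constant pays for recombining real and imaginary parts when om is imaginary. *)
Lemma lattice_point : exists2 C : algC, 0 < C & forall alpha n (res : 'I_4 -> int),
  inM alpha -> (0 < n)%N -> \prod_(j < 4) `|autn tau j alpha| = n%:R ^+ 5 ->
  exists x : 'I_4 -> int, [/\ exists i, x i != 0, (n%:Z %| \sum_i x i * res i)%Z &
    forall j, (j < 4)%N ->
      `|autn tau j (\sum_(i < 4) bs i * (x i)%:~R)| ^+ 5 <= C * `|autn tau j alpha|].
Proof.
have g1 : inG 1 by rewrite -(rmorph1 (ratr : {rmorphism rat -> algC})); apply: inG_rat.
have gXY : inGom (X * Y).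
  by have [B hB ->] := gY; exists (X * B); [apply: (inGM pz) | rewrite mulrA].
have bM (i : 'I_4) : inM (bs i).
  by case: i => [[|[|[|[|i]]]] hi] //; rewrite /bs /=;
    do ?[exact: inG_inM | exact: inGom_inM].
pose M : algC := 1 + \sum_(j < 4) \sum_(i < 4) `|autn tau j (bs i)|.
have M0 : 0 < M by rewrite ltr_pwDl // sumr_ge0 // => j _; rewrite sumr_ge0.
have hM j : (j < 4)%N -> \sum_(i < 4) `|autn tau j (bs i)| <= M.
  move=> j4; rewrite -[leLHS]add0r lerD ?ler01 // [leRHS](bigD1 (Ordinal j4)) //= lerDl.
  by rewrite sumr_ge0 // => i _; rewrite sumr_ge0.
pose L : algC := 3 * M + 1.
have L0 : 0 < L by rewrite addr_gt0 // mulr_gt0.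
exists ((2 * L) ^+ 5); first by rewrite exprn_gt0 // mulr_gt0.
move=> alpha n res ha n0 hn.
pose r j : algC := 5.-root `|autn tau j alpha|.
have r5 j : r j ^+ 5 = `|autn tau j alpha| by rewrite rootCK.
have a0 : alpha != 0.
  apply/eqP => a0; have : n%:R ^+ 5 != 0 :> algC by rewrite expf_neq0 // pnatr_eq0 -lt0n.
  by rewrite -hn big_ord_recl /= a0 normr0 mul0r eqxx.
have r0 j : 0 < r j by rewrite rootC_gt0 // normr_gt0 fmorph_eq0.
have rn : \prod_(j < 4) r j = n%:R.
  apply/eqP; rewrite -(@eqrXn2 _ 5) // ?ler0n ?prodr_ge0 //; last first.
    by move=> j _; apply: ltW.
  by rewrite -prodrXl -hn; apply/eqP; apply: eq_bigr => j _.
have hL : n%:R * (3 * M) ^+ 4 < L ^+ 4 * n%:R.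
  rewrite mulrC ltr_pM2r ?ltr0n // ltrXn2r //.
    by rewrite mulr_ge0 // ltW.
  by rewrite ltrDl.
have sE (x : 'I_4 -> int) j : autn tau j (\sum_(i < 4) bs i * (x i)%:~R) =
    \sum_(i < 4) autn tau j (bs i) * (x i)%:~R.
  by rewrite rmorph_sum; apply: eq_bigr => i _; rewrite rmorphM /= rmorph_int.
have [e|e] := conj_om pz W2.
  have hr (j i : 'I_4) : autn tau j (bs i) \is Num.real.
    rewrite CrealE; apply/eqP.
    by have [/(_ e)] := conj_inM pz W2 tz (inM_autn j (bM i)).
  have [||x [nx dx bx]] := @pigeonhole_forms 4 (fun j i => autn tau j (bs i)) M n res
    (fun j => L * r j) hr M0 (fun j => hM j (ltn_ord j)) n0.
  - by move=> j; rewrite mulr_gt0.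
  - by rewrite big_split prodr_const card_ord /= rn.
  exists x; split=> // j j4; rewrite sE -r5 -exprMn lerXn2r ?nnegrE //.
    by rewrite mulr_ge0 ?mulr_ge0 // ltW.
  apply: (le_trans (bx (Ordinal j4))); rewrite /= -mulrA mulr_natl mulr2n lerDl.
  by rewrite mulr_ge0 // ltW.
(* Here om is imaginary and the embeddings j and j + 2 are complex conjugate. The forms 2j and 2j +
   1 are the real and imaginary parts of embedding j; 1 and X are real while Y and XY are purely
   imaginary, so each part sees only two coefficients. *)
pose l (j i : 'I_4) : algC := if odd j then
    (if (i < 2)%N then 0 else autn tau (j./2) (bs i) / 'i)
  else (if (i < 2)%N then autn tau (j./2) (bs i) else 0).
have hr j i : l j i \is Num.real.
  rewrite /l CrealE; case: (odd j); case: ifP => i2; rewrite ?rmorph0 //.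
    have h : inGom (autn tau j./2 (bs i)).
      apply: autn_ind; first exact: inGom_tau.
      by case: i i2 => [[|[|[|[|i]]]] hi].
    have -> : (autn tau j./2 (bs i) / 'i)^* = (autn tau j./2 (bs i))^* / 'i^*.
      exact: (fmorph_div Num.conj).
    by rewrite conjCi (conj_inGom e h) invrN mulrNN.
  rewrite conj_inG //; apply: autn_ind; first exact: inG_tau.
  by case: i i2 => [[|[|[|[|i]]]] hi].
have lM j : \sum_i `|l j i| <= M.
  apply: le_trans (hM j./2 _); last by case: j => [[|[|[|[|j]]]] hj].
  apply: ler_sum => i _; rewrite /l; case: (odd j); case: ifP => _; rewrite ?normr0 //.
  by rewrite normrM normfV normCi invr1 mulr1.
have rr j : r j.+2 = r j by rewrite /r norm_tau2 //; apply: inM_autn.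
have [||x [nx dx bx]] := @pigeonhole_forms 4 l M n res
  (fun j => L * r j./2) hr M0 lM n0.
- by move=> j; rewrite mulr_gt0.
- rewrite big_split prodr_const card_ord /=; congr (_ < _): hL; congr (_ * _).
  by rewrite -rn !big_ord_recl !big_ord0 /= !rr; ring.
exists x; split=> // j j4; rewrite -r5 -exprMn lerXn2r ?nnegrE //.
  by rewrite mulr_ge0 ?mulr_ge0 // ltW.
have hS : inM (\sum_(i < 4) bs i * (x i)%:~R).
  apply: big_ind => [||i _]; [by apply: (inM_nat _ _ 0) | by apply: inMD |].
  apply: (inMM pz W2) => //; rewrite -(rmorph_int (ratr : {rmorphism rat -> algC})).
  exact: inM_rat.
wlog j2 : j j4 / (j < 2)%N.
  move=> H; have [/H->//|] := ltnP j 2; case: j j4 => [|[|j]] // j4 _.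
  have h1 : `|autn tau j.+2 (\sum_(i < 4) bs i * (x i)%:~R)| = `|autn tau j (\sum_(i < 4) bs i * (x i)%:~R)|.
    by rewrite /= norm_tau2 //; apply: inM_autn.
  by rewrite h1 rr; apply: H; lia.
have o0 : (j.*2 < 4)%N by lia.
have o1 : (j.*2.+1 < 4)%N by lia.
have := bx (Ordinal o0); have := bx (Ordinal o1).
rewrite sE /l /= uphalf_double half_double !odd_double /=.
rewrite !big_ord_recl !big_ord0 /= !mul0r !addr0 !add0r => b1 b0.
rewrite addrA; apply: (le_trans (ler_normD _ _)).
have -> : 2 * L * r j = L * r j + L * r j by ring.
have hi (u v p q : algC) : `|u * p + v * q| = `|u / 'i * p + v / 'i * q|.
  rewrite -[LHS]mulr1 -invr1 -[X in _ * X^-1]normCi -normfV -normrM.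
  by congr (`|_|); ring.
by rewrite lerD // hi; apply: b1.
Qed.
End LatticePoint.

Section BoundedIntegers.
Variable I : Type.
Implicit Types f h : I -> algC.

Lemma bint_aut (nu : aut) f : bint f -> bint (fun i => nu (f i)).
Proof.
move=> [K K0 hK]; exists K => // i.
by rewrite -(rmorph_nat nu) -rmorphM /= Aint_aut.
Qed.

Lemma bint_sqrt (W : algC) (D : rat) : W ^+ 2 = ratr D -> bint (fun _ : I => W).
Proof.
move=> e; exists `|denq D|%N; first by rewrite absz_gt0 denq_neq0.
move=> _; set n := `|denq D|%N.
apply: (@root_monic_Aint ('X^2 - (n%:R * (numq D)%:~R)%:P)).
- rewrite /root !hornerE exprMn e subr_eq0 expr2 -mulrA.
  have -> : (n%:R : algC) * ratr D = (numq D)%:~R; last by [].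
  by rewrite pmulrn absz_denq /ratr mulrCA divff ?mulr1 // intr_eq0 denq_neq0.
- exact: monicXnsubC.
- apply/polyOverP => i; rewrite coefB coefXn coefC.
  apply: rpredB; first exact: rpred_nat.
  by case: ifP => _; [apply: rpredM; [apply: rpred_nat | apply: rpred_int] | apply: rpred0].
Qed.

Definition fins f := bint f /\ exists B, forall i, `|f i| <= B.

Lemma fins_ext f h : (forall i, f i = h i) -> fins f -> fins h.
Proof.
by move=> e [b [B hB]]; split; [apply: bint_ext b | exists B => i; rewrite -e].
Qed.

Lemma finsD f h : fins f -> fins h -> fins (fun i => f i + h i).
Proof.
move=> [bf [B hB]] [bh [C hC]]; split; first exact: bintD.
by exists (B + C) => i; apply: (le_trans (ler_normD _ _)); apply: lerD.
Qed.

Lemma finsM f h : fins f -> fins h -> fins (fun i => f i * h i).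
Proof.
move=> [bf [B hB]] [bh [C hC]]; split; first exact: bintM.
by exists (B * C) => i; rewrite normrM ler_pM.
Qed.

Lemma finsN f : fins f -> fins (fun i => - f i).
Proof.
move=> [bf [B hB]]; split; first exact: bintN.
by exists B => i; rewrite normrN.
Qed.

Lemma fins_cst c : bint (fun _ : I => c) -> fins (fun _ => c).
Proof. by move=> b; split=> //; exists `|c|. Qed.

Lemma fins_rat_finite f : fins f -> (forall i, f i \in Crat) ->
  exists s : seq algC, forall i, f i \in s.
Proof.
move=> [[K K0 hK] [B hB]] hr.
pose N := (Num.truncn (K%:R * `|B|)).+1.
exists ([seq n%:R / K%:R | n <- iota 0 N] ++ [seq - n%:R / K%:R | n <- iota 0 N]) => i.
have KC : K%:R != 0 :> algC by rewrite pnatr_eq0 -lt0n.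
have /intrP[m em] : K%:R * f i \is a Num.int.
  by apply: Cint_rat_Aint => //; rewrite rpredM ?rpred_nat.
have ef : f i = m%:~R / K%:R by rewrite -em mulrC mulKf.
have hm : (`|m| < N)%N.
  rewrite -(ltr_nat algC); apply: le_lt_trans (real_truncnS_gt _); last first.
    by rewrite realM ?realn ?normr_real.
  rewrite natr_absz intr_norm -em normrM normr_nat ler_pM2l ?ltr0n //.
  apply: (le_trans (hB i)); rewrite real_ler_norm //.
  by rewrite ger0_real // (le_trans _ (hB i)).
rewrite mem_cat ef; case: m hm {em ef} => n hm.
  by apply/orP; left; apply/mapP; exists n => //; rewrite mem_iota.
apply/orP; right; apply/mapP; exists n.+1; first by rewrite mem_iota.
by rewrite NegzE rmorphN.
Qed.
End BoundedIntegers.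

Section FiniteM.

Variables (z W : algC) (D : rat).
Hypotheses (pz : 5.-primitive_root z) (W2 : W ^+ 2 = ratr D) (D0 : D != 0).
Variable tau : aut.
Hypothesis tz : tau z = z ^+ 2.

Local Notation g := (zg z).
Local Notation om := (om z W).
Local Notation inM := (inM z W).
Local Notation inG := (inG z).

Lemma Aint_z : z \in Aint.
Proof. by apply: (Aint_unity_root (n := 5)) => //; rewrite unity_rootE z5. Qed.

Lemma bint_g I : bint (fun _ : I => g).
Proof. by apply: bint_Aint => _; rewrite /zg rpredD // rpredX // Aint_z. Qed.

Lemma bint_k I : bint (fun _ : I => zk z).
Proof. by apply: bint_Aint => _; rewrite /zk rpredB // rpredX // Aint_z. Qed.

Lemma bint_om I : bint (fun _ : I => om).
Proof. by apply: bintM; [apply: bint_k | apply: (bint_sqrt _ W2)]. Qed.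

Lemma bint_inG I x : inG x -> bint (fun _ : I => x).
Proof.
have bg := bint_g I.
by move=> [q0 [q1 ->]]; bint.
Qed.

Lemma om_neq0 : om != 0.
Proof.
rewrite mulf_neq0 ?(W_neq0 W2) // -sqrf_eq0 (zk2 pz) oppr_eq0.
have h : (g + 3) * (2 - g) = 5 by apply: (lincomb1 (c := -1) (zg2 pz)); ring.
apply/eqP => e; move: h; rewrite e mul0r => /esym/eqP.
by rewrite pnatr_eq0.
Qed.

Lemma omV : om^-1 = om * (g - 2) / (5 * ratr D).
Proof.
have Dn : ratr D != 0 :> algC by rewrite fmorph_eq0.
have on := om_neq0.
apply: (mulfI on); rewrite divff //.
transitivity (- (om ^+ 2 * (2 - g)) / (5 * ratr D)); last by field.
rewrite (om2 pz W2).
have -> : - (- (g + 3) * ratr D * (2 - g)) = 5 * ratr D.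
  by apply: (lincomb1 (c := - ratr D) (zg2 pz)); ring.
by rewrite divff // mulf_neq0 // pnatr_eq0.
Qed.

Lemma g_sq5 : (2 * g + 1) ^+ 2 = 5.
Proof. by apply: (lincomb1 (c := 4) (zg2 pz)); ring. Qed.

Lemma g_free q0 q1 : ratr q0 + ratr q1 * g = 0 -> q0 = 0 /\ q1 = 0.
Proof.
move=> e; have := congr1 tau e; rewrite aut_inG rmorph0 (tau_g pz tz) => e'.
have h : ratr q1 = 0 :> algC.
  apply: (mulfI (_ : 5 != 0 :> algC)); first by rewrite pnatr_eq0.
  rewrite -g_sq5.
  transitivity ((ratr q0 + ratr q1 * g - (ratr q0 + ratr q1 * (-1 - g))) * (2 * g + 1)).
    by ring.
  by rewrite e e' subrr mul0r mulr0.
by split; apply: ratr_eq; rewrite rmorph0 //; move: e; rewrite h mul0r addr0.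
Qed.

(** The four rational coordinates are fixed linear combinations of the four conjugates, so they too
    have bounded size and a common denominator. *)
Lemma finite_M I (f : I -> algC) B : (forall i, inM (f i)) -> bint f ->
  (forall i j, (j < 4)%N -> `|autn tau j (f i)| <= B) ->
  exists s : seq algC, forall i, f i \in s.
Proof.
move=> fM bf bd.
have F j : (j < 4)%N -> fins (fun i => autn tau j (f i)).
  by move=> j4; split; [exact: (bint_aut (autn tau j)) | exists B => i; apply: bd].
have F0 := F 0 isT; have F1 := F 1 isT; have F2 := F 2 isT; have F3 := F 3 isT.
have bg := bint_g I; have bo := bint_om I.
have cg : fins (fun _ : I => g) by apply: fins_cst.
have co : fins (fun _ : I => om) by apply: fins_cst.
have cq q : fins (fun _ : I => ratr q) by apply: fins_cst; apply: bint_ratr.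
have cn (n : nat) : fins (fun _ : I => n%:R) by apply: fins_cst; apply: bint_nat.
have cv : fins (fun _ : I => om^-1).
  apply: (fins_ext (f := fun _ => om * (g - 2%:R) * ratr (5 * D)^-1)); last first.
    exact: (finsM (finsM co (finsD cg (finsN (cn 2)))) (cq _)).
  move=> _; rewrite omV; congr (_ * _).
  transitivity (ratr (5 * D) : algC)^-1; first exact: fmorphV.
  by congr (_^-1); ring.
pose t j i := autn tau j (f i).
(* The trace difference equals 2 q1 (2g + 1), and (2g + 1)^2 = 5 explains the factor 1/10. The
   coordinates along om are found in the same way after division by om and [tau om]. *)
pose c1 i := (t 0%N i + t 2%N i - t 1%N i - t 3%N i) * (2%:R * g + 1%:R) * ratr 10^-1.
pose c0 i := (t 0%N i + t 1%N i + t 2%N i + t 3%N i + 2%:R * c1 i) * ratr 4^-1.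
pose y i := (t 0%N i - t 2%N i) * om^-1.
pose y1 i := (t 1%N i - t 3%N i) * tau om^-1.
have cto : fins (fun _ : I => tau om^-1).
  split; last by exists `|tau om^-1|.
  by case: cv => bv _; apply: (bint_aut tau bv).
pose c3 i := (y i - y1 i) * (2%:R * g + 1%:R) * ratr 10^-1.
pose c2 i := (y i + y1 i + 2%:R * c3 i) * ratr 4^-1.
have g21 := finsD (finsM (cn 2) cg) (cn 1).
have G1 : fins c1.
  exact: (finsM (finsM (finsD (finsD (finsD F0 F2) (finsN F1)) (finsN F3)) g21) (cq _)).
have G0 : fins c0.
  exact: (finsM (finsD (finsD (finsD (finsD F0 F1) F2) F3) (finsM (cn 2) G1)) (cq _)).
have Gy : fins y by exact: (finsM (finsD F0 (finsN F2)) cv).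
have Gy1 : fins y1 by exact: (finsM (finsD F1 (finsN F3)) cto).
have G3 : fins c3 by exact: (finsM (finsM (finsD Gy (finsN Gy1)) g21) (cq _)).
have G2 : fins c2.
  exact: (finsM (finsD (finsD Gy Gy1) (finsM (cn 2) G3)) (cq _)).
have key i : exists q0 q1 q2 q3, [/\ f i = ratr q0 + ratr q1 * g + (ratr q2 + ratr q3 * g) * om,
    c0 i = ratr q0, c1 i = ratr q1, c2 i = ratr q2 & c3 i = ratr q3].
  have [q0 [q1 [q2 [q3 e]]]] := fM i; exists q0, q1, q2, q3.
  have tg := tau_g pz tz; have to2 := tau2_om pz W2 tz; have tg2 := tau2_g pz tz.
  have e0 : t 0%N i = ratr q0 + ratr q1 * g + (ratr q2 + ratr q3 * g) * om by [].
  have e1 : t 1%N i = ratr q0 + ratr q1 * (-1 - g) + (ratr q2 + ratr q3 * (-1 - g)) * tau om.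
    by rewrite /t /= e aut_inM tg.
  have e2 : t 2%N i = ratr q0 + ratr q1 * g - (ratr q2 + ratr q3 * g) * om.
    by rewrite /t /= e !aut_inM tg2 to2 mulrN.
  have e3 : t 3%N i = ratr q0 + ratr q1 * (-1 - g) - (ratr q2 + ratr q3 * (-1 - g)) * tau om.
    by rewrite /t /= e !aut_inM tg2 to2 tg rmorphN mulrN.
  have h5 := g_sq5.
  have on := om_neq0.
  have ton : tau om != 0 by rewrite fmorph_eq0.
  have n4 : ratr 4^-1 = 4^-1 :> algC by rewrite (fmorphV (ratr : {rmorphism rat -> algC})) /= rmorph_nat.
  have n10 : ratr 10^-1 = 10^-1 :> algC by rewrite (fmorphV (ratr : {rmorphism rat -> algC})) /= rmorph_nat.
  have E1 : c1 i = ratr q1.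
    rewrite /c1 e0 e1 e2 e3 n10.
    by apply: (lincomb1 (c := ratr q1 / 5) h5); field.
  have E3y : y i = 2 * (ratr q2 + ratr q3 * g) by rewrite /y e0 e2; field.
  have E3y1 : y1 i = 2 * (ratr q2 + ratr q3 * (-1 - g)).
    by rewrite /y1 e1 e3 fmorphV; field.
  have E3 : c3 i = ratr q3.
    by rewrite /c3 E3y E3y1 n10; apply: (lincomb1 (c := ratr q3 / 5) h5); field.
  split=> //.
    by rewrite /c0 E1 e0 e1 e2 e3 n4; field.
  by rewrite /c2 E3 E3y E3y1 n4; field.
have R0 i : c0 i \in Crat by have [q0 [q1 [q2 [q3 [_ -> _ _ _]]]]] := key i; apply/CratP; exists q0.
have R1 i : c1 i \in Crat by have [q0 [q1 [q2 [q3 [_ _ -> _ _]]]]] := key i; apply/CratP; exists q1.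
have R2 i : c2 i \in Crat by have [q0 [q1 [q2 [q3 [_ _ _ -> _]]]]] := key i; apply/CratP; exists q2.
have R3 i : c3 i \in Crat by have [q0 [q1 [q2 [q3 [_ _ _ _ ->]]]]] := key i; apply/CratP; exists q3.
have [s0 h0] := fins_rat_finite G0 R0; have [s1 h1] := fins_rat_finite G1 R1.
have [s2 h2] := fins_rat_finite G2 R2; have [s3 h3] := fins_rat_finite G3 R3.
exists [seq a + b | a <- [seq a + b * g | a <- s0, b <- s1],
                    b <- [seq (a + b * g) * om | a <- s2, b <- s3]] => i.
have [q0 [q1 [q2 [q3 [-> <- <- <- <-]]]]] := key i.
by apply: allpairs_f; apply: (allpairs_f (fun a b => _)).
Qed.
End FiniteM.

(** * Finiteness of the quotient *)

Lemma rho_aut (nu : aut) z a U V : nu (rho z a U V) = rho (nu z) (nu a) (nu U) (nu V).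
Proof.
rewrite /rho fmorph_div; congr (_ / _); last by rewrite /Ker; ring.
rewrite /gval /p_al /p_be /zg /zk.
by cbv beta iota zeta delta [fst snd]; ring.
Qed.

Lemma kummer_unit z : 5.-primitive_root z -> 5 * zk z * (zg z + 2) != 0.
Proof.
move=> pz; apply/eqP => e.
have /eqP : (5 * zk z * (zg z + 2)) ^+ 2 * (7 - 11 * zg z) = 25 * 5 * -1 :> algC.
  apply: (lincomb2 (c := (5 * (zg z + 2)) ^+ 2 * (7 - 11 * zg z))
    (c' := 275 * zg z ^+ 2 + 1475 * zg z + 1975) (zk2 pz) (zg2 pz)); ring.
rewrite e expr0n mul0r eq_sym mulf_eq0 oppr_eq0 oner_eq0 orbF.
by rewrite -natrM pnatr_eq0.
Qed.

Section KummerInjective.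

Variables (a b d : rat) (dE : dab a b = d) (a0 : a != 0) (d0 : d != 0).
Hypothesis aD : a ^+ 2 - 11 * a - 1 != 0.
Variables (z : algC) (pz : 5.-primitive_root z).

Local Notation w := (sqrtC (ratr d) : algC).
Local Notation ac := (ratr a : algC).
Local Notation emb := (emb d a0 aD).
Local Notation acts := (act d0 (rational_CWst a0 aD)).
Local Notation T := (T (ac0 a0) (acD aD)).
Local Notation Fk := (Fk z ac).
Local Notation rhoP := (rhoP z (a0 := ac0 a0) (aD := acD aD)).

Lemma rhoP_aut nu R : chi d nu = 1 -> nu z = z -> rhoP (acts nu R) = nu (rhoP R).
Proof.
move=> c ez; case: R => [[[U V]|]] o; rewrite /rhoP /= ?rmorph0 //.
by rewrite c mul1r rho_aut ez fmorph_rat.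
Qed.

(* Fibre points R, R' satisfy rho(R) = z^i delta rho(R'), so an automorphism
   fixing z and delta translates R and R' by the same multiple of T. *)
Lemma kummer_inj x y x' y' (delta : algC) :
  on_curve (Eab a b) (Some (x, y)) -> on_curve (Eab a b) (Some (x', y')) ->
  Fk (ratr (x / d)) (ratr (y / d) / w) != 0 ->
  Fk (ratr (x / d)) (ratr (y / d) / w) =
    delta ^+ 5 * Fk (ratr (x' / d)) (ratr (y' / d) / w) ->
  (forall nu : aut, chi d nu = 1 -> nu z = z -> nu delta = delta) ->
  congH a b (Some (x, y)) (Some (x', y')).
Proof.
move=> op op' F0 eF fd.
apply/(congHE dE a0 d0 aD op op').
have [R eR] := lam_surj (emb (Some (x, y))).
have [R' eR'] := lam_surj (emb (Some (x', y'))).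
have key xx yy S : on_curve (Eab a b) (Some (xx, yy)) -> lam S = emb (Some (xx, yy)) ->
    lam S != 0 /\
    rhoP S ^+ 5 = 5 * zk z * (zg z + 2) * Fk (ratr (xx / d)) (ratr (yy / d) / w).
  move=> o e.
  have h : ptval (lam S) = Some (ratr (xx / d), ratr (yy / d) / w).
    by rewrite e (embE dE a0 d0 aD o).
  have S0 : lam S != 0 by apply/eqP => e0; rewrite e0 in h.
  split=> //; have [U [V [eS K0]]] := lam_coords S0; rewrite h => -[eu ev].
  have oS : onE (Wst (ac0 a0) (acD aD)) (Some (U, V)) by rewrite -eS; apply: ptP.
  by rewrite /rhoP eS (rho5 pz oS K0) -eu -ev.
have [R0 e1] := key _ _ _ op eR; have [R0' e2] := key _ _ _ op' eR'.
have r0 : rhoP R != 0.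
  apply: contraNneq (mulf_neq0 (kummer_unit pz) F0) => e.
  by rewrite -e1 e expr0n.
have /eqP e5 : (delta * rhoP R') ^+ 5 = rhoP R ^+ 5.
  by rewrite exprMn e1 e2 eF; ring.
have q5 : (rhoP R / (delta * rhoP R')) ^+ 5 = 1.
  by rewrite expr_div_n (eqP e5) divff // expf_neq0.
have dr0 : delta * rhoP R' != 0.
  apply: contraNneq (expf_neq0 5 r0) => e.
  by rewrite -(eqP e5) e expr0n.
have [i ei] := prim_rootP pz q5.
have {}ei : rhoP R = z ^+ i * (delta * rhoP R') by rewrite -ei divfK.
rewrite -eR -eR' -raddfB; apply: (descent pz).
  by rewrite raddfB /= eR eR'; apply: fixedwB; apply: (fixed_emb dE).
move=> nu c ez.
have fR : fixedw d0 (lam R) by rewrite eR; apply: (fixed_emb dE).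
have fR' : fixedw d0 (lam R') by rewrite eR'; apply: (fixed_emb dE).
have [n en] := cocycle nu fR; have [n' en'] := cocycle nu fR'.
have h1 := rhoP_aut R c ez; rewrite en (rhoP_Tn pz) // in h1.
have h2 := rhoP_aut R' c ez; rewrite en' (rhoP_Tn pz) // in h2.
have : z ^+ n * rhoP R = z ^+ n' * rhoP R.
  rewrite h1 {1}ei !rmorphM rmorphXn /= ez fd // -h2 ei; ring.
move/(mulIf r0)/eqP; rewrite (eq_prim_root_expr pz) => /eqP nn.
by rewrite raddfB /= en en' (Tmod a0 aD nn) opprD addrACA subrr addr0.
Qed.
End KummerInjective.

(** The numerator N of the right-hand side is prime to D, so D^3 and D'^2 divide each other and are
    equal. Then D divides D', and the quotient t satisfies t^2 = D and t^3 = D'. *)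
Lemma weierstrass_denominators (A B C : int) (X Y : rat) :
  Y ^+ 2 = X ^+ 3 + A%:~R * X ^+ 2 + B%:~R * X + C%:~R ->
  exists r s t : int, [/\ t != 0, X = r%:~R / t%:~R ^+ 2, Y = s%:~R / t%:~R ^+ 3,
    coprimez r t & coprimez s t].
Proof.
move=> e.
pose n := numq X; pose D := denq X; pose n' := numq Y; pose D' := denq Y.
have D0 : D != 0 by apply: denq_neq0.
have D0' : D' != 0 by apply: denq_neq0.
have cX : coprimez n D by rewrite coprimezE coprime_num_den.
have cY : coprimez n' D' by rewrite coprimezE coprime_num_den.
have eX : X = n%:~R / D%:~R by rewrite divq_num_den.
have eY : Y = n'%:~R / D'%:~R by rewrite divq_num_den.
pose N := n ^+ 3 + D * (A * n ^+ 2 + B * n * D + C * D ^+ 2).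
have E : n' ^+ 2 * D ^+ 3 = N * D' ^+ 2.
  apply: (@intr_inj rat).
  have d0 : D%:~R != 0 :> rat by rewrite intr_eq0.
  have d0' : D'%:~R != 0 :> rat by rewrite intr_eq0.
  have := e; rewrite eX eY => h.
  apply: (lincomb1 (c := (D%:~R ^+ 3 * D'%:~R ^+ 2)) h).
  by rewrite /N; field; rewrite d0 d0'.
have cN : coprimez N (D ^+ 3).
  apply: coprimezXr; apply/coprimezP.
  have /coprimezP[[u v] /= huv] := coprimezXl 3 cX.
  exists (u, v - u * (A * n ^+ 2 + B * n * D + C * D ^+ 2)).
  by rewrite -huv /N /=; ring.
have h1 : (D' ^+ 2 %| D ^+ 3)%Z.
  have c : coprimez (D' ^+ 2) (n' ^+ 2).
    by rewrite coprimez_sym; apply/coprimezXl/coprimezXr.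
  by rewrite -(Gauss_dvdzr _ c) E dvdz_mull.
have h2 : (D ^+ 3 %| D' ^+ 2)%Z.
  by rewrite coprimez_sym in cN; rewrite -(Gauss_dvdzr _ cN) -E dvdz_mull.
have DD : D ^+ 3 = D' ^+ 2.
  have Dp : 0 < D by apply: denq_gt0.
  have Dp' : 0 < D' by apply: denq_gt0.
  have p1 : 0 <= D ^+ 3 by rewrite exprn_ge0 // ltW.
  have p2 : 0 <= D' ^+ 2 by rewrite exprn_ge0 // ltW.
  rewrite -(gez0_abs p1) -(gez0_abs p2); congr Posz.
  by apply/eqP; rewrite eqn_dvd; apply/andP; split; [exact: h2 | exact: h1].
have /dvdzP[t et] : (D %| D')%Z.
  by rewrite -(@dvdz_pexp2r _ _ 2) // -DD dvdz_exp2l.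
have t2 : t ^+ 2 = D.
  apply: (mulIf (expf_neq0 2 D0)); rewrite -exprMn -et -DD; ring.
have t3 : t ^+ 3 = D' by rewrite et exprS t2.
exists n, n', t; split.
- by apply: contraNneq D0 => t0; rewrite -t2 t0 expr0n.
- by rewrite -rmorphXn /= t2.
- by rewrite -rmorphXn /= t3.
- by rewrite -(@coprimez_pexpr 2) // t2.
- by rewrite -(@coprimez_pexpr 3) // t3.
Qed.

Lemma common_denominator (s : seq rat) : exists2 m : nat, (0 < m)%N &
  forall q, q \in s -> exists k : int, m%:R * q = k%:~R.
Proof.
elim: s => [|q s [m m0 IH]]; first by exists 1%N.
have ed : (`|denq q|%N%:R : rat) * q = (numq q)%:~R.
  by rewrite pmulrn absz_denq -[X in _ * X]divq_num_den mulrC divfK // intr_eq0 denq_neq0.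
exists (m * `|denq q|)%N; first by rewrite muln_gt0 m0 absz_gt0 denq_neq0.
move=> p; rewrite in_cons => /orP[/eqP->|/IH[k ek]].
  by exists (m%:Z * numq q); rewrite natrM -mulrA ed rmorphM.
by exists (`|denq q|%N%:Z * k); rewrite natrM mulrAC ek rmorphM /= mulrC.
Qed.

(** * The descent with denominators cleared by m *)

Section Descent.

Variables (a b d : rat) (dE : dab a b = d) (a0 : a != 0) (d0 : d != 0).
Hypothesis aD : a ^+ 2 - 11 * a - 1 != 0.
Variables (z : algC) (pz : 5.-primitive_root z) (tau : aut) (tz : tau z = z ^+ 2).

Variables (m : nat) (A B C P Q : int).
Hypotheses (m0 : (0 < m)%N)
  (hA : m%:R * (d * (a ^+ 2 - 30 * a + 1)) = A%:~R)
  (hB : m%:R * (- 8 * d ^+ 2 * a * (3 * a + 1) * (4 * a - 7)) = B%:~R)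
  (hC : m%:R * (- 16 * d ^+ 3 * a * (4 * a ^+ 4 - 4 * a ^+ 3 - 40 * a ^+ 2 + 91 * a - 4))
        = C%:~R)
  (hP : m%:R * (d * ((- (12 * a ^+ 2) + 72 * a - 8) / 5)) = P%:~R)
  (hQ : m%:R * (d * ((- (4 * a ^+ 2) + 44 * a + 4) / 5)) = Q%:~R).

Local Notation w := (sqrtC (ratr d) : algC).
Local Notation ac := (ratr a : algC).
Local Notation g := (zg z).
Local Notation W := (m%:R * w).
Local Notation D := (m%:R ^+ 2 * d).
Local Notation om := (om z W).
Local Notation inM := (inM z W).
Local Notation inG := (inG z).
Local Notation inGom := (inGom z W).

Let mQ : m%:R != 0 :> rat. Proof. by rewrite pnatr_eq0 -lt0n. Qed.
Let W2 : W ^+ 2 = ratr D.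
Proof. by rewrite exprMn w2; ring. Qed.
Let D0 : D != 0. Proof. by rewrite mulf_neq0 // expf_neq0. Qed.
Let W0 : W != 0. Proof. exact: (W_neq0 W2 D0). Qed.

(** Scaling by W = m sqrt d turns the coordinates of a point of W into m^2 x and m^3 y, which
    satisfy an integral equation. It also turns kc and ke into multiples of om = k W by elements of
    Q(sqrt 5). *)
Definition cW : algC := W * kc z ac.
Definition eW : algC := W * ke z ac.
Definition XT : algC := W ^+ 2 * uT z ac.
Definition YT : algC := cW ^+ 2 * eW / 2.
Definition SW : algC := (cW + eW) / 2.

Lemma XTE : XT = (m%:Z * P)%:~R + (m%:Z * Q)%:~R * g.
Proof.
pose p1 := (- (12 * a ^+ 2) + 72 * a - 8) / 5; pose p2 := (- (4 * a ^+ 2) + 44 * a + 4) / 5.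
have e1 : (m%:Z * P)%:~R = ratr (m%:R * (m%:R * (d * p1))) :> algC.
  by rewrite hP -ratr_int; congr ratr; rewrite rmorphM.
have e2 : (m%:Z * Q)%:~R = ratr (m%:R * (m%:R * (d * p2))) :> algC.
  by rewrite hQ -ratr_int; congr ratr; rewrite rmorphM.
rewrite e1 e2 /XT W2 /uT /gval /p_uT /p1 /p2.
by cbv beta iota zeta delta [fst snd]; field.
Qed.

Lemma inG_int (k : int) : inG k%:~R.
Proof. by rewrite -ratr_int; apply: inG_rat. Qed.

Lemma inG_XT : inG XT.
Proof.
rewrite XTE; apply: inGD; first exact: inG_int.
by apply: (inGM pz); [apply: inG_int | apply: inG_g].
Qed.

Lemma g_coef (q0 q1 : rat) : (q0 != 0) || (q1 != 0) -> ratr q0 + ratr q1 * g != 0.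
Proof.
by move=> h; apply/eqP => /(g_free pz tz)[e0 e1]; rewrite e0 e1 eqxx in h.
Qed.

Lemma p_ce_neq0 : ((- (8 * a) - 6) / 5 != 0) || ((8 - 6 * a) / 5 != 0).
Proof.
rewrite -negb_and; apply/negP => /andP[/eqP h1 /eqP h2].
by lra.
Qed.

Lemma cW_E : cW != 0 /\ inGom cW.
Proof.
pose x := ratr ((- (8 * a) - 6) / 5) + ratr ((8 - 6 * a) / 5) * g.
have e : cW = x * om.
  rewrite /cW /kc /gval /p_c /om /x; cbv beta iota zeta delta [fst snd].
  by field.
split; last by exists x => //; exists ((- (8 * a) - 6) / 5), ((8 - 6 * a) / 5).
by rewrite e mulf_neq0 ?(om_neq0 pz W2 D0) // g_coef // p_ce_neq0.
Qed.

Lemma eW_E : eW != 0 /\ inGom eW.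
Proof.
pose x := ratr ((8 - 6 * a) / 5) + ratr ((8 * a + 6) / 5) * g.
have e : eW = x * om.
  rewrite /eW /ke /gval /p_e /om /x; cbv beta iota zeta delta [fst snd].
  by field.
split; last by exists x => //; exists ((8 - 6 * a) / 5), ((8 * a + 6) / 5).
rewrite e mulf_neq0 ?(om_neq0 pz W2 D0) // g_coef // orbC -oppr_eq0.
have -> : - ((8 * a + 6) / 5) = (- (8 * a) - 6) / 5 by ring.
exact: p_ce_neq0.
Qed.

Lemma inGomM x y : inGom x -> inGom y -> inG (x * y).
Proof.
move=> [p hp ->] [q hq ->].
have -> : p * om * (q * om) = p * q * (om ^+ 2) by ring.
rewrite (om2 pz W2); apply: (inGM pz); first exact: (inGM pz).
apply: (inGM pz); last exact: inG_rat.
by exists (-3), (-1); rewrite !rmorphN rmorph1 rmorph_nat; ring.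
Qed.

Lemma inG_inGomM x y : inG x -> inGom y -> inGom (x * y).
Proof. by move=> hx [q hq ->]; exists (x * q); [apply: (inGM pz) | ring]. Qed.

Lemma inGomD x y : inGom x -> inGom y -> inGom (x + y).
Proof. by move=> [p hp ->] [q hq ->]; exists (p + q); [apply: inGD | ring]. Qed.

Lemma inG_half : inG 2^-1.
Proof.
have -> : 2^-1 = ratr 2^-1 :> algC by field.
exact: inG_rat.
Qed.

Lemma inGom_YT : inGom YT.
Proof.
have [_ hc] := cW_E; have [_ he] := eW_E.
have -> : YT = 2^-1 * (cW * cW) * eW by rewrite /YT; field.
apply: inG_inGomM => //; apply: (inGM pz); [exact: inG_half | exact: inGomM].
Qed.

Lemma YT_neq0 : YT != 0.
Proof.
have [hc _] := cW_E; have [he _] := eW_E.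
by rewrite /YT mulf_neq0 ?invr_neq0 ?pnatr_eq0 // mulf_neq0 // expf_neq0.
Qed.

Lemma inGom_SW : inGom SW.
Proof.
have [_ hc] := cW_E; have [_ he] := eW_E.
by rewrite [SW]mulrC; apply: inG_inGomM; [exact: inG_half | exact: inGomD].
Qed.

Lemma tau2_inGom x : inGom x -> tau (tau x) = - x.
Proof.
move=> [p hp ->]; rewrite (rmorphM tau p) (rmorphM tau (tau p)) (tau2_inG pz tz hp) (tau2_om pz W2 tz).
by rewrite mulrN.
Qed.

Section OnePoint.

Variables (r s t : int).
Let R : algC := r%:~R.
Let S : algC := s%:~R.
Let T : algC := t%:~R.

(** The Tate coordinates of P relative to T', scaled by (t W)^2 and (t W)^3; [alp] is (t W)^5 F(P),
    and [nxt] is the norm of [xt] from Q(sqrt 5). *)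
Definition xt : algC := R - T ^+ 2 * XT.
Definition yt : algC := S - T ^+ 3 * YT - SW * T * xt.
Definition alp : algC := xt * yt + (T * cW) ^+ 2 * yt - T * cW * xt ^+ 2.
Definition nxt : int := (r - t ^+ 2 * (m%:Z * P)) ^+ 2
  + (r - t ^+ 2 * (m%:Z * P)) * (t ^+ 2 * (m%:Z * Q)) - (t ^+ 2 * (m%:Z * Q)) ^+ 2.

Lemma tau_int (k : int) : tau k%:~R = k%:~R. Proof. exact: rmorph_int. Qed.

Lemma tau_xt : tau xt = R - T ^+ 2 * tau XT.
Proof.
transitivity (tau R - tau T ^+ 2 * tau XT); first by rewrite /xt; ring.
by rewrite /R /T !tau_int.
Qed.

Lemma norm_xt : xt * tau xt = nxt%:~R.
Proof.
have tXT : tau XT = (m%:Z * P)%:~R + (m%:Z * Q)%:~R * (-1 - g).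
  transitivity (tau (m%:Z * P)%:~R + tau (m%:Z * Q)%:~R * tau g).
    by rewrite XTE; ring.
  by rewrite !tau_int (tau_g pz tz).
rewrite tau_xt /xt tXT XTE /nxt /R /T.
apply: (lincomb1 (c := - (t%:~R ^+ 2 * (m%:Z * Q)%:~R) ^+ 2) (zg2 pz)); ring.
Qed.

Lemma Q_neq0 : Q != 0.
Proof.
apply/eqP => e; move: hQ; rewrite e => /eqP.
rewrite mulf_eq0 (negPf mQ) mulf_eq0 (negPf d0) /=.
have -> : (- (4 * a ^+ 2) + 44 * a + 4) / 5 = (a ^+ 2 - 11 * a - 1) * (-4 / 5) by field.
by rewrite mulf_eq0 (negPf aD).
Qed.

Hypothesis t0 : t != 0.

Lemma xt_neq0 : xt != 0.
Proof.
have -> : xt = ratr (r%:~R - t%:~R ^+ 2 * (m%:Z * P)%:~R)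
    + ratr (- (t%:~R ^+ 2 * (m%:Z * Q)%:~R)) * g.
  by rewrite /xt XTE /R /T; ring.
apply: g_coef; apply/orP; right.
by rewrite oppr_eq0 mulf_neq0 ?expf_neq0 ?intr_eq0 // mulf_neq0 ?Q_neq0 // eqz_nat -lt0n.
Qed.

Variables (x y : rat).
Hypotheses (op : on_curve (Eab a b) (Some (x, y)))
  (ex : m%:R ^+ 2 * x = r%:~R / t%:~R ^+ 2) (ey : m%:R ^+ 3 * y = s%:~R / t%:~R ^+ 3).
Local Notation u := (ratr (x / d) : algC).
Local Notation v := (ratr (y / d) / w).

Let w0 : w != 0. Proof. exact: w_neq0. Qed.
Let dC : ratr d != 0 :> algC. Proof. by rewrite fmorph_eq0. Qed.

Lemma R_E : R = (T * W) ^+ 2 * u.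
Proof.
have er : r%:~R = m%:R ^+ 2 * x * t%:~R ^+ 2 :> rat.
  by rewrite ex divfK // expf_neq0 // intr_eq0.
rewrite /R -ratr_int er /T !exprMn w2.
by field.
Qed.

Lemma S_E : S = (T * W) ^+ 3 * v.
Proof.
have es : s%:~R = m%:R ^+ 3 * y * t%:~R ^+ 3 :> rat.
  by rewrite ey divfK // expf_neq0 // intr_eq0.
rewrite /S -ratr_int es /T.
have -> : (t%:~R * W) ^+ 3 * v = t%:~R ^+ 3 * m%:R ^+ 3 * w ^+ 2 * ratr (y / d).
  by move: w w0 (y / d) => w' h q; field.
by rewrite w2; field.
Qed.

Lemma xt_E : xt = (T * W) ^+ 2 * kx z ac u.
Proof. by rewrite /xt R_E /kx /XT; ring. Qed.

Lemma yt_E : yt = (T * W) ^+ 3 * ky z ac u v.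
Proof. by rewrite /yt S_E xt_E /ky /YT /SW /cW /eW; ring. Qed.

Lemma alp_E : alp = (T * W) ^+ 5 * Fk z ac u v.
Proof. by rewrite /alp xt_E yt_E /Fk /cW; ring. Qed.

Lemma curve_t : yt ^+ 2 + (T * cW + T * eW) * xt * yt + (T * cW) ^+ 2 * (T * eW) * yt
  = xt ^+ 3 + T * cW * (T * eW) * xt ^+ 2.
Proof.
have o : onE (CW a0 aD) (Some (u, v)).
  by have /(embP_on dE a0 d0 aD) := op.
have h := Fk_curve pz (a0 := ac0 a0) (aD := acD aD) o.
rewrite xt_E yt_E /cW /eW; apply: (lincomb1 (c := (T * W) ^+ 6) h); ring.
Qed.

(** tau^2 fixes the rational point P and replaces T' by -T'. The two functions with divisors 5 (T')
    - 5 (O) and 5 (-T') - 5 (O) multiply to the fifth power of the abscissa relative to T'. *)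
Lemma alp_tau2 : alp * tau (tau alp) = xt ^+ 5.
Proof.
have [_ hc] := cW_E; have [_ he] := eW_E.
have e1 : tau (tau xt) = xt.
  by rewrite tau_xt rmorphB rmorphM rmorphXn /= /R /T !tau_int (tau2_inG pz tz inG_XT).
have e2 : tau (tau yt) = S + T ^+ 3 * YT + SW * T * xt.
  transitivity (tau (tau S) - tau (tau T) ^+ 3 * tau (tau YT)
    - tau (tau SW) * tau (tau T) * tau (tau xt)); first by rewrite /yt; ring.
  rewrite e1 /S /T !tau_int (tau2_inGom inGom_YT) (tau2_inGom inGom_SW); ring.
have e3 : tau (tau alp) = xt * tau (tau yt) + (T * cW) ^+ 2 * tau (tau yt) + T * cW * xt ^+ 2.
  transitivity (tau (tau xt) * tau (tau yt) + (tau (tau T) * tau (tau cW)) ^+ 2 * tau (tau yt)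
    - tau (tau T) * tau (tau cW) * tau (tau xt) ^+ 2); first by rewrite /alp; ring.
  rewrite e1 /T !tau_int (tau2_inGom hc); ring.
have e4 : tau (tau yt) = yt + (T * cW + T * eW) * xt + (T * cW) ^+ 2 * (T * eW).
  by rewrite e2 /yt /SW /YT; field.
rewrite e3 e4 /alp.
apply: (lincomb1 (c := (xt + (T * cW) ^+ 2) ^+ 2) curve_t); ring.
Qed.

Lemma alp_neq0 : alp != 0.
Proof.
apply: contraNneq (expf_neq0 5 xt_neq0) => e.
by rewrite -alp_tau2 e mul0r.
Qed.

Lemma norm_alp : \prod_(j < 4) `|autn tau j alp| = `|nxt|%N%:R ^+ 5.
Proof.
rewrite natr_absz intr_norm -norm_xt -normrX exprMn -rmorphXn /= -alp_tau2.
by rewrite !big_ord_recl big_ord0 /= !(rmorphM, normrM) /=; ring.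
Qed.

Lemma nxt_neq0 : nxt != 0.
Proof.
have h := xt_neq0; have th : tau xt != 0 by rewrite fmorph_eq0.
by rewrite -(intr_eq0 algC) -norm_xt mulf_neq0.
Qed.

Lemma inM_alp : inM alp.
Proof.
have [_ hc] := cW_E.
have iR (k : int) : inM k%:~R by apply/inG_inM/inG_int.
have iX := inG_inM W inG_XT; have iY := inGom_inM pz W2 inGom_YT.
have iS := inGom_inM pz W2 inGom_SW; have ic := inGom_inM pz W2 hc.
rewrite /alp /yt /xt /R /S /T.
by do ?[assumption | apply: iR | apply: inMD | apply: inMN | apply: (inMX pz W2)
  | apply: (inMM pz W2)].
Qed.
End OnePoint.

Definition gam (x : 'I_4 -> int) : algC := (x 0)%:~R + (x 1)%:~R * XT
  + (x 2)%:~R * YT + (x 3)%:~R * (XT * YT).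

Lemma XT_free (p q : int) : p%:~R + q%:~R * XT = 0 -> p = 0 /\ q = 0.
Proof.
move=> e.
have : ratr (p%:~R + q%:~R * (m%:Z * P)%:~R) + ratr (q%:~R * (m%:Z * Q)%:~R) * g = 0.
  by rewrite -e XTE; ring.
move/(g_free pz tz) => [e1 /eqP].
rewrite mulf_eq0 !intr_eq0 (mulf_eq0 m%:Z) (negPf Q_neq0) orbF eqz_nat.
rewrite (gtn_eqF m0) orbF => /eqP q0; move: e1; rewrite q0 mul0r addr0 => /eqP.
by rewrite intr_eq0 => /eqP.
Qed.

(** tau^2 fixes X and negates Y, which separates the relation into two; X is not rational because
    its g-coordinate m Q is nonzero. *)
Lemma gam_neq0 x : (exists i, x i != 0) -> gam x != 0.
Proof.
move=> [i xi]; apply/eqP => e.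
have hY := tau2_inGom inGom_YT; have hX := tau2_inG pz tz inG_XT.
have e2 : (x 0)%:~R + (x 1)%:~R * XT - ((x 2)%:~R + (x 3)%:~R * XT) * YT = 0.
  transitivity (tau (tau (gam x))); last by rewrite e !rmorph0.
  transitivity (tau (tau (x 0)%:~R) + tau (tau (x 1)%:~R) * tau (tau XT)
    + tau (tau (x 2)%:~R) * tau (tau YT) + tau (tau (x 3)%:~R) * (tau (tau XT) * tau (tau YT))).
    by rewrite hX hY !tau_int; ring.
  by rewrite /gam; ring.
have n2 : 2 != 0 :> algC by rewrite pnatr_eq0.
have eA : (x 0)%:~R + (x 1)%:~R * XT = 0.
  apply: (mulfI n2); rewrite mulr0.
  by apply: (lincomb2 (c := 1) (c' := 1) e e2); rewrite /gam; ring.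
have eB : (x 2)%:~R + (x 3)%:~R * XT = 0.
  apply: (mulIf YT_neq0); rewrite mul0r.
  by apply: (lincomb2 (c := 1) (c' := -1) e eA); rewrite /gam; ring.
have [x0 x1] := XT_free eA; have [x2 x3] := XT_free eB.
case/negP: xi; apply/eqP.
case: i => [[|[|[|[|i]]]] hi] //; [rewrite -x0|rewrite -x1|rewrite -x2|rewrite -x3];
  by congr x; apply: val_inj.
Qed.

Lemma inM_gam x : inM (gam x).
Proof.
have iR (k : int) : inM k%:~R by apply/inG_inM/inG_int.
have iX := inG_inM W inG_XT; have iY := inGom_inM pz W2 inGom_YT.
rewrite /gam.
by do ?[assumption | apply: iR | apply: inMD | apply: (inMM pz W2)].
Qed.

Variable K : algC.

(** A point together with all choices made for it: reduced coordinates, gamma, the quotient in the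
    congruence and Bezout coefficients. It is the index type of the families, so that the bounds do
    not depend on the point. *)
Record datum := Datum {
  px : rat; py : rat; pr : int; ps : int; pt_ : int;
  pg : 'I_4 -> int; pq : int; pu : int; pv : int;
  d_on : on_curve (Eab a b) (Some (px, py));
  d_t : pt_ != 0;
  d_x : m%:R ^+ 2 * px = pr%:~R / pt_%:~R ^+ 2;
  d_y : m%:R ^+ 3 * py = ps%:~R / pt_%:~R ^+ 3;
  d_g : exists i, pg i != 0;
  d_res : pg 0 * pt_ ^+ 5 + pg 1 * pr * pt_ ^+ 3 + pg 2 * ps * pt_ ^+ 2 + pg 3 * pr * ps
    = nxt pr pt_ * pq;
  d_bez : pu * (pr * ps) = 1 + pt_ * pv;
  d_bd : forall j, (j < 4)%N ->
    `|autn tau j (gam pg)| ^+ 5 <= K * `|autn tau j (alp pr ps pt_)| }.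

Definition beta (i : datum) : algC := gam (pg i) ^+ 5 / alp (pr i) (ps i) (pt_ i).

Lemma alp_d i : alp (pr i) (ps i) (pt_ i) != 0.
Proof. exact: (alp_neq0 (d_t i) (d_on i) (d_x i) (d_y i)). Qed.

Lemma beta_finite : exists s : seq algC, forall i, beta i \in s.
Proof.
have [_ hc] := cW_E; have [_ he] := eW_E.
have bGom x : inGom x -> bint (fun _ : datum => x).
  move=> [p hp ->]; apply: bintM; first exact: (bint_inG pz).
  exact: (bint_om pz W2).
apply: (finite_M pz W2 D0 tz (B := K)).
- move=> i; apply: (inMM pz W2); first exact: (inMX pz W2 5 (inM_gam _)).
  by apply: (inMV pz W2 tz); apply: inM_alp.
- apply: (@bint_gamma5 datum pr ps pt_ (fun i => pg i 0) (fun i => pg i 1)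
    (fun i => pg i 2) (fun i => pg i 3) pq pu pv cW eW XT YT SW (tau XT)).
  + exact: bGom.
  + exact: bGom.
  + exact: (bint_inG pz _ inG_XT).
  + exact: (bGom _ inGom_YT).
  + exact: (bGom _ inGom_SW).
  + exact: (bint_inG pz _ (inG_tau pz tz inG_XT)).
  + move=> i; exact: (curve_t (d_t i) (d_on i) (d_x i) (d_y i)).
  + move=> i; have := congr1 (fun k : int => k%:~R : algC) (d_res i).
    rewrite [X in _ = X]rmorphM /= -norm_xt tau_xt => <-.
    by ring.
  + by move=> i; have := congr1 (fun k : int => k%:~R : algC) (d_bez i); rewrite !(rmorphM, rmorphD).
  + by move=> i; apply: alp_d.
move=> i j j4; rewrite fmorph_div rmorphXn /= normrM normrX normfV.
by rewrite ler_pdivrMr ?normr_gt0 ?fmorph_eq0 ?alp_d // d_bd.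
Qed.

Lemma aut_inM_fix (nu : aut) x : chi d nu = 1 -> nu z = z -> inM x -> nu x = x.
Proof.
move=> c ez [q0 [q1 [q2 [q3 ->]]]].
have ew : nu w = w.
  by move: c; rewrite /chi => /(congr1 (fun x => x * w)); rewrite divfK ?w_neq0 // mul1r.
have eg : nu g = g by rewrite /zg rmorphD !rmorphXn /= ez.
have eo : nu om = om.
  transitivity ((nu z ^+ 2 - nu z ^+ 3) * (m%:R * nu w)).
    by rewrite /om /zk; ring.
  by rewrite ez ew.
by rewrite aut_inM eg eo.
Qed.

Lemma beta_inj i j : beta i = beta j ->
  congH a b (Some (px i, py i)) (Some (px j, py j)).
Proof.
move=> e.
have ai := alp_d i; have aj := alp_d j.
have gi := gam_neq0 (d_g i); have gj := gam_neq0 (d_g j).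
have ti : (pt_ i)%:~R != 0 :> algC by rewrite intr_eq0 d_t.
have tj : (pt_ j)%:~R != 0 :> algC by rewrite intr_eq0 d_t.
have Ei := alp_E (d_t i) (d_x i) (d_y i); have Ej := alp_E (d_t j) (d_x j) (d_y j).
(* Equality of the two [beta] values says that F(P_i) / F(P_j) = delta^5, the powers of W
   cancelling; delta lies in Q(om), which automorphisms fixing sqrt d and z fix. *)
pose delta : algC := gam (pg i) * (pt_ j)%:~R / (gam (pg j) * (pt_ i)%:~R).
apply: (kummer_inj dE a0 d0 aD pz (d_on i) (d_on j) (delta := delta)).
- by apply: contraNneq ai => F0; rewrite Ei F0 mulr0.
- move: e ai aj; rewrite /beta Ei Ej /delta.
  set Fi := Fk _ _ (ratr (px i / d)) _; set Fj := Fk _ _ (ratr (px j / d)) _.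
  move: {Ei Ej delta} Fi Fj (gam (pg i)) (gam (pg j)) gi gj ti tj W0.
  move: (pt_ i)%:~R (pt_ j)%:~R => Ti Tj.
  move: W => V Fi Fj Gi Gj gi gj ti tj V0 e.
  rewrite mulf_eq0 negb_or => /andP[_ fi]; rewrite mulf_eq0 negb_or => /andP[_ fj].
  transitivity (Gi ^+ 5 / ((Ti * V) ^+ 5 * Fi) * (Fi * Fj * (Tj * V) ^+ 5 / Gj ^+ 5) * 
      ((Ti / Tj) ^+ 5 * (Gj / Gi) ^+ 5 * (Gi * Tj / (Gj * Ti)) ^+ 5)).
    by rewrite e; field; rewrite ?ti ?tj ?V0 ?gi ?gj ?fi ?fj.
  by field; rewrite ?ti ?tj ?V0 ?gi ?gj ?fi ?fj.
move=> nu c ez; apply: aut_inM_fix => //.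
have iR (k : int) : inM k%:~R by apply/inG_inM/inG_int.
apply: (inMM pz W2); first by apply: (inMM pz W2); [apply: inM_gam | apply: iR].
by apply: (inMV pz W2 tz); apply: (inMM pz W2); [apply: inM_gam | apply: iR].
Qed.

(** One point is kept for each listed value that [beta] attains; by [beta_inj] it represents every
    point with that value. *)
Lemma finite_representatives (s : seq algC) : exists reps : seq point,
  (forall q, q \in reps -> on_curve (Eab a b) q) /\
  forall i : datum, beta i \in s ->
    exists2 q, q \in reps & congH a b (Some (px i, py i)) q.
Proof.
elim: s => [|c s [reps [h1 h2]]]; first by exists [::].
have [[j ej]|h] := classic (exists j, beta j = c).
  exists (Some (px j, py j) :: reps); split.
    by move=> q; rewrite in_cons => /orP[/eqP->|/h1 //]; apply: d_on.
  move=> i; rewrite in_cons => /orP[/eqP ei|/h2[q hq cq]]; last first.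
    by exists q => //; rewrite in_cons hq orbT.
  by exists (Some (px j, py j)); [rewrite mem_head | apply: beta_inj; rewrite ei].
exists reps; split=> // i; rewrite in_cons => /orP[/eqP ei|/h2 //].
by case: h; exists i.
Qed.

Hypothesis lattice : forall alpha n (res : 'I_4 -> int),
  inM alpha -> (0 < n)%N -> \prod_(j < 4) `|autn tau j alpha| = n%:R ^+ 5 ->
  exists x : 'I_4 -> int, [/\ exists i, x i != 0, (n%:Z %| \sum_i x i * res i)%Z &
    forall j, (j < 4)%N -> `|autn tau j (\sum_(i < 4) nth 0 [:: 1; XT; YT; XT * YT] i
      * (x i)%:~R)| ^+ 5 <= K * `|autn tau j alpha|].

Lemma datum_exists x y : on_curve (Eab a b) (Some (x, y)) ->
  exists i : datum, px i = x /\ py i = y.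
Proof.
move=> op.
have ec : (m%:R ^+ 3 * y) ^+ 2 = (m%:R ^+ 2 * x) ^+ 3 + (m%:Z * A)%:~R * (m%:R ^+ 2 * x) ^+ 2
    + (m%:Z ^+ 3 * B)%:~R * (m%:R ^+ 2 * x) + (m%:Z ^+ 5 * C)%:~R.
  rewrite !rmorphM /= -hA -hB -hC.
  have := op; rewrite /on_curve /Eab dE; cbn [wa1 wa2 wa3 wa4 wa6] => h.
  apply: (lincomb1 (c := m%:R ^+ 6) h); ring.
have [r [s [t [t0 ex ey cr cs]]]] := weierstrass_denominators ec.
have n0 := nxt_neq0 r t0.
have np : (0 < `|nxt r t|)%N by rewrite absz_gt0.
(* The residues are t^5 times 1, X, Y and XY evaluated at P instead of T', with X = r / t^2 and Y =
   s / t^3: the congruence asks that gamma, so evaluated, be divisible by n. *)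
have [c [nc dc bc]] := lattice (fun i => nth 0 [:: t ^+ 5; r * t ^+ 3; s * t ^+ 2; r * s] i)
  (inM_alp r s t) np (norm_alp t0 op ex ey).
have /dvdzP[q eq] : (nxt r t %| \sum_i c i * nth 0 [:: t ^+ 5; r * t ^+ 3; s * t ^+ 2; r * s] i)%Z.
  exact: dc.
have /coprimezP[[u v] /= huv] : coprimez (r * s) t by rewrite coprimezMl cr.
have i0 : (ord0 : 'I_4) = 0 by [].
have i1 : lift ord0 (ord0 : 'I_3) = 1 :> 'I_4 by apply: val_inj.
have i2 : lift ord0 (lift ord0 (ord0 : 'I_2)) = 2 :> 'I_4 by apply: val_inj.
have i3 : lift ord0 (lift ord0 (lift ord0 (ord0 : 'I_1))) = 3 :> 'I_4 by apply: val_inj.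
have eres : c 0 * t ^+ 5 + c 1 * r * t ^+ 3 + c 2 * s * t ^+ 2 + c 3 * r * s = nxt r t * q.
  by rewrite [RHS]mulrC -eq !big_ord_recl big_ord0 i1 i2 i3 /=; ring.
have ebez : u * (r * s) = 1 + t * - v by rewrite -huv; ring.
have ebd j : (j < 4)%N -> `|autn tau j (gam c)| ^+ 5 <= K * `|autn tau j (alp r s t)|.
  move=> /bc; congr (`|autn tau j _| ^+ 5 <= _).
  by rewrite !big_ord_recl big_ord0 i1 i2 i3 /gam /=; ring.
by exists (Datum op t0 ex ey nc eres ebez ebd).
Qed.

Lemma finite_quotient : quotient_finite a b.
Proof.
have [s hs] := beta_finite; have [reps [h1 h2]] := finite_representatives s.
exists (None :: reps); split; first by move=> q; rewrite in_cons => /orP[/eqP->|/h1].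
case=> [[x y]|] op.
  have [i [<- <-]] := datum_exists op; have [q hq cq] := h2 i (hs i).
  by exists q => //; rewrite in_cons hq orbT.
exists None; first exact: mem_head.
by exists None.
Qed.
End Descent.

Lemma quotient_finite_Eab (a b : rat) : a != 0 -> dab a b != 0 ->
  a ^+ 2 - 11 * a - 1 != 0 -> quotient_finite a b.
Proof.
move=> a0 d0 aD; have [d dE] : exists d, dab a b = d by exists (dab a b).
rewrite dE in d0.
have [z pz] := C_prim_root_exists (isT : (0 < 5)%N).
have [tau tz] := Qn_aut_exists (isT : coprime 2 5).
have {}tz : tau z = z ^+ 2 by apply: tz; apply: prim_expr_order.
(* The coefficients of E_{a,b}, and d times the two coordinates of the abscissa of T': m must make
   all of them integral. *)
pose cs : seq rat := [:: d * (a ^+ 2 - 30 * a + 1);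
  - 8 * d ^+ 2 * a * (3 * a + 1) * (4 * a - 7);
  - 16 * d ^+ 3 * a * (4 * a ^+ 4 - 4 * a ^+ 3 - 40 * a ^+ 2 + 91 * a - 4);
  d * ((- (12 * a ^+ 2) + 72 * a - 8) / 5); d * ((- (4 * a ^+ 2) + 44 * a + 4) / 5)].
have [m m0 hm] := common_denominator cs.
have {}hm i (h : (i < size cs)%N) := hm _ (mem_nth 0 h).
have [A hA] := hm 0%N isT; have [B hB] := hm 1%N isT; have [C hC] := hm 2%N isT.
have [P hP] := hm 3%N isT; have [Q hQ] := hm 4%N isT.
have W2 : (m%:R * sqrtC (ratr d)) ^+ 2 = ratr (m%:R ^+ 2 * d) :> algC.
  by rewrite exprMn w2; ring.
have D0 : m%:R ^+ 2 * d != 0 by rewrite mulf_neq0 // expf_neq0 // pnatr_eq0 -lt0n.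
have [K _ hK] := lattice_point pz W2 D0 tz (inG_XT pz hP hQ) (inGom_YT a d0 pz tz m0).
exact: (finite_quotient dE a0 d0 aD pz tz m0 hA hB hC hP hQ hK).
Qed.

(** The discriminant is 2^12 d^6 a (a^2 - 11 a - 1)^5, so nonsingularity supplies the hypothesis
    [aD] of the preceding sections. *)
Lemma Eab_disc (a b : rat) : nonsingular (Eab a b) -> a ^+ 2 - 11 * a - 1 != 0.
Proof.
apply: contraNneq => e; apply/eqP.
have -> : wdisc (Eab a b) = 2 ^+ 12 * dab a b ^+ 6 * a * (a ^+ 2 - 11 * a - 1) ^+ 5.
  by rewrite /wdisc /Eab; cbn [wa1 wa2 wa3 wa4 wa6]; move: (dab a b) => d; ring.
by rewrite e expr0n mulr0.
Qed.

Theorem mainTheorem1 (a b : rat) :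
  a != 0 -> dab a b != 0 ->
  nonsingular (Eab a b) -> nonsingular (Estab a b) ->
  (* (1) *)
  (forall x y : rat, on_curve (Eab a b) (Some (x, y)) ->
     (~ irreducible_poly (BruP a b (Some (x, y))) <-> in_image a b (Some (x, y))))
  /\
  (* (2) *)
  (quotient_finite a b /\
   exists F : (point -> Prop) -> (algC -> Prop),
     (* F sends <P mod H> to Spl_Q(Bru(P;X)), for every generator P *)
     (forall S P, subgroup5 a b S -> on_curve (Eab a b) P -> generated_by a b S P ->
        same_field (F S) (Spl (BruP a b P))) /\
     (* F lands in { Spl_Q(Bru(P;X)) : P in E(Q) \ H } *)
     (forall S, subgroup5 a b S ->
        exists P, [/\ on_curve (Eab a b) P, ~ in_image a b P &
                      same_field (F S) (Spl (BruP a b P))]) /\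
     (* F is injective on subgroups of order 5 *)
     (forall S1 S2, subgroup5 a b S1 -> subgroup5 a b S2 ->
        same_field (F S1) (F S2) -> forall P, S1 P <-> S2 P) /\
     (* F is onto { Spl_Q(Bru(P;X)) : P in E(Q) \ H } *)
     (forall P, on_curve (Eab a b) P -> ~ in_image a b P ->
        exists S, subgroup5 a b S /\ same_field (F S) (Spl (BruP a b P)))).
Proof.
move=> a0 d0 /Eab_disc aD _; split.
  by move=> x y oP; apply: (reducible_iff_image erefl a0 d0 aD).
split; first exact: quotient_finite_Eab.
exact: (field_correspondence erefl a0 d0 aD).
Qed.
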